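(* (1) $F$ and $G$ lie in $M_{12}$. (2) $G=r^{5}(r+1)$, $F=r(r+1)^{5}$, and $(F+G)^{6}=FG$.
   Context: For even $k\ge 0$, $M_{k}$ is the set of $f\in\mathbb{Z}/2[[x]]$ for which there is a modular form of weight $k$ for $\Gamma_{0}(5)$ whose expansion at infinity (in $x=e^{2\pi i z}$) lies in $\mathbb{Z}[[x]]$ and reduces mod $2$ to $f$. In $\mathbb{Z}/2[[x]]$ let $F=\sum_{n\ \mathrm{odd},\,n>0}x^{n^{2}}$, $G=F(x^{5})$, and $r=\sum_{n>0}(x^{n^{2}}+x^{2n^{2}}+x^{5n^{2}}+x^{10n^{2}})$. *)

(* Defs.v *)
From Stdlib Require Import Reals ZArith List.
From Coquelicot Require Import Coquelicot.
Open Scope R_scope.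

Definition ps2 := nat -> bool.

Definition ps_one : ps2 := fun n => Nat.eqb n 0.
Definition ps_add (f g : ps2) : ps2 := fun n => xorb (f n) (g n).
Definition ps_mul (f g : ps2) : ps2 :=
  fun n => fold_left xorb (map (fun i => andb (f i) (g (n - i)))%nat (seq 0 (S n))) false.
Definition ps_pow (f : ps2) (k : nat) : ps2 := Nat.iter k (ps_mul f) ps_one.

Definition Fser : ps2 :=
  fun n => existsb (fun m => andb (Nat.odd m) (Nat.eqb (m * m)%nat n)) (seq 0 (S n)).
Definition Gser : ps2 :=
  fun n => if Nat.eqb (n mod 5) 0 then Fser (n / 5)%nat else false.
Definition theta_c (c : nat) : ps2 :=
  fun n => existsb (fun m => andb (Nat.ltb 0 m) (Nat.eqb (c * m * m)%nat n)) (seq 0 (S n)).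
Definition rser : ps2 :=
  ps_add (ps_add (theta_c 1) (theta_c 2)) (ps_add (theta_c 5) (theta_c 10)).

Definition ZtoC (a : Z) : C := RtoC (IZR a).

Definition mobius (a b c d : Z) (z : C) : C :=
  Cdiv (Cplus (Cmult (ZtoC a) z) (ZtoC b)) (Cplus (Cmult (ZtoC c) z) (ZtoC d)).

Definition autfac (c d : Z) (k : nat) (z : C) : C :=
  Cpow (Cplus (Cmult (ZtoC c) z) (ZtoC d)) k.

Definition in_Gamma0_5 (a b c d : Z) : Prop :=
  (a * d - b * c = 1)%Z /\ (5 | c)%Z.

(* f : C -> C is a (holomorphic) modular form of weight k for Gamma_0(5):
   holomorphic on the upper half plane, weight-k invariant under Gamma_0(5),
   and holomorphic (= bounded) at every cusp. *)
Definition modular_form_G0_5 (k : nat) (f : C -> C) : Prop :=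
  (forall z : C, 0 < Im z -> @ex_derive C_AbsRing C_NormedModule f z) /\
  (forall (a b c d : Z) (z : C), in_Gamma0_5 a b c d -> 0 < Im z ->
      f (mobius a b c d z) = Cmult (autfac c d k z) (f z)) /\
  (forall (a b c d : Z), (a * d - b * c = 1)%Z ->
      exists (M y0 : R), forall z : C, 0 < Im z -> y0 < Im z ->
        Cmod (Cdiv (f (mobius a b c d z)) (autfac c d k z)) <= M).

(* x^n with x = e^{2 pi i z} *)
Definition qpow (n : nat) (z : C) : C :=
  let t := 2 * PI * INR n in
  (exp (- t * Im z) * cos (t * Re z), exp (- t * Im z) * sin (t * Re z)).

Definition M (k : nat) (f : ps2) : Prop :=
  exists h : C -> C, modular_form_G0_5 k h /\
    exists a : nat -> Z,
      (forall z : C, 0 < Im z ->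
         @is_series C_AbsRing C_NormedModule (fun n => Cmult (ZtoC (a n)) (qpow n z)) (h z)) /\
      (forall n, f n = Z.odd (a n)).

(* Main.v *)
(** [F] and [G].  Let [P(s) = sum k^3 s^k].  The three Eisenstein series of weight 4 for Gamma(2),
    [sum (m z + n)^(-4)] over the pairs [(m, n)] of a fixed nonzero parity, are permuted by
    SL_2(Z), so that their product is modular of weight 12.  By Lipschitz' formula they are, up to
    constants, [alpha = sum_(m odd) P(s^m)], [beta = sum_(m odd) P(- s^m)] and
    [gamma = 1 + 16 sum_j P(- s^(2j))], where [s = e^(pi i z)] and [x = s^2].  The coefficient of
    [s^n] in [alpha] is even if [n] is, and else has the parity of the number of divisors of [n];
    so modulo 2, [alpha] is [F(s)] and [- alpha beta gamma = F(s)^2 = F(x)].  Replacing [z] by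
    [5 z] gives [G].

    Relations.  Put [P = sum_(a > 0, (a, 6) = 1) X^(a^2)].  Counting norms in Z[sqrt(-3)] and
    Z[sqrt(-5)] by means of reflections gives [P(X)^3 = F(X^3)] and
    [P(X) P(X^5) = F(X^6) + F(X^30)] modulo 2; cubing the latter, [(F + G)^6 = F G].  As
    [r^2 + r = F + G], the series [G] is one of the roots [r^5 (r + 1)] and [r (r + 1)^5] of
    [Y^2 + (F + G) Y + (F + G)^6], and the lowest terms decide which. *)
Require Import Defs.
From Stdlib Require Import Reals ZArith List.
From Coquelicot Require Import Coquelicot.
From Stdlib Require Import Znumtheory NArith Lia ZifyNat Lra Bool Ring.
From Stdlib Require Import FunctionalExtensionality Permutation Classical.

Local Open Scope nat_scope.

(** * Power series modulo 2 *)

(** In weight 4 all lattice sums converge absolutely, so the behaviour under z -> -1/z is a mere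
    exchange of summations. The exchange leaves one inhomogeneous term, the sum of n^(-4) over odd
    n; its value is read off from Lipschitz' formula itself by letting the argument tend to 0. That
    formula is proved by showing that the difference of its sides has period 2, satisfies a
    duplication formula and has no pole of order 4 at 0, which forces it to vanish. The cube of P is
    reached through P(X^4) = P(X) F(X^3): modulo 2 the left side is P^4, and P can be cancelled
    because it begins with X. For x^2 + 5 y^2 the obstacle is that 3 splits in Q(sqrt(-5)): the
    reflection may lead to coordinates divisible by 3, but only when 9 divides the number
    represented. Such numbers 9 n are treated separately: the representations come from an element
    of norm 9, and either conjugating that element pairs them off or dividing by it leads down to
    n. *)

Lemma card_bij (A B : Type) (f : A -> B) (l : list A) (l' : list B) :
  NoDup l -> NoDup l' ->
  (forall x, In x l -> In (f x) l') ->
  (forall x y, In x l -> In y l -> f x = f y -> x = y) ->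
  (forall y, In y l' -> exists x, In x l /\ f x = y) ->
  length l = length l'.
Proof.
  intros Hl Hl' Hf Hinj Hsurj.
  rewrite <- (length_map f l).
  apply Permutation_length, NoDup_Permutation; trivial.
  - clear Hf Hsurj Hl'. induction Hl as [|x l Hx Hl IH]; simpl; constructor.
    + intro H. apply in_map_iff in H. destruct H as (y & Hy & Hin).
      apply Hx. rewrite (Hinj x y); simpl; auto.
    + apply IH. intros; apply Hinj; simpl; auto.
  - intro y. rewrite in_map_iff. split.
    + intros (x & <- & Hx). auto.
    + intro Hy. destruct (Hsurj y Hy) as (x & Hx & E). eauto.
Qed.

(** Induction on the length, removing [x] and [f x] together. With its companion for one fixed
    point, this is the source of all parity counts below: the terms contributing to a coefficient
    are paired off and at most one survives. *)
Lemma involution_even (A : Type) (f : A -> A) (l : list A) :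
  NoDup l ->
  (forall x, In x l -> In (f x) l /\ f (f x) = x /\ f x <> x) ->
  Nat.odd (length l) = false.
Proof.
  remember (length l) as n eqn:Hn. revert l Hn.
  induction n as [n IH] using lt_wf_ind. intros l Hn Hl Hf.
  destruct l as [|x l]; [subst; reflexivity|].
  destruct (Hf x (or_introl eq_refl)) as (Hfx & Hffx & Hne).
  destruct Hfx as [E|Hfx]; [congruence|].
  apply in_split in Hfx. destruct Hfx as (l1 & l2 & ->).
  simpl in Hn. rewrite length_app in Hn. simpl in Hn.
  inversion_clear Hl as [|? ? Hx Hl'].
  assert (Hl2 := NoDup_remove_1 _ _ _ Hl').
  assert (Hl3 := NoDup_remove_2 _ _ _ Hl').
  replace n with (S (S (length (l1 ++ l2)))) by (rewrite length_app; lia).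
  rewrite Nat.odd_succ, Nat.even_succ.
  apply (IH (length (l1 ++ l2))) with (l := l1 ++ l2); trivial.
  - rewrite length_app; lia.
  - intros y Hy.
    assert (Hy' : In y (x :: l1 ++ f x :: l2)).
    { simpl. rewrite in_app_iff in *. simpl. tauto. }
    destruct (Hf y Hy') as (H1 & H2 & H3). repeat split; trivial.
    assert (Hyx : y <> f x) by (intros ->; auto).
    assert (Hyx' : y <> x).
    { intros ->. apply Hx. rewrite in_app_iff in *. simpl. tauto. }
    simpl in H1. rewrite in_app_iff in *. simpl in H1.
    destruct H1 as [H1|[H1|[H1|H1]]]; auto; exfalso.
    + apply Hyx. congruence.
    + apply Hyx'. congruence.
Qed.

Lemma involution_odd (A : Type) (f : A -> A) (l : list A) (x0 : A) :
  NoDup l -> In x0 l ->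
  (forall x, In x l -> In (f x) l /\ f (f x) = x /\ (f x = x <-> x = x0)) ->
  Nat.odd (length l) = true.
Proof.
  intros Hl H0 Hf. apply in_split in H0. destruct H0 as (l1 & l2 & ->).
  assert (Hl2 := NoDup_remove_1 _ _ _ Hl).
  assert (Hl3 := NoDup_remove_2 _ _ _ Hl).
  rewrite length_app. simpl. rewrite Nat.add_succ_r, <- length_app, Nat.odd_succ.
  rewrite <- Nat.negb_odd, (involution_even _ f (l1 ++ l2)); trivial.
  intros x Hx.
  assert (Hx' : In x (l1 ++ x0 :: l2)) by (rewrite in_app_iff in *; simpl; tauto).
  destruct (Hf x Hx') as (H1 & H2 & H3).
  assert (Hne : x <> x0) by (intros ->; auto).
  repeat split; trivial.
  - assert (f x <> x0).
    { intro E. destruct (Hf x0 ltac:(rewrite in_app_iff; simpl; tauto)) as (_ & _ & H4).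
      apply Hne. rewrite <- H2, E. apply H4; trivial. }
    rewrite in_app_iff in *. simpl in H1. intuition congruence.
  - rewrite H3. trivial.
Qed.

(** A sum modulo 2 is encoded as the parity of the number of its nonzero terms, so that bijections
    and involutions of finite sets apply to it directly. *)
Definition xsum {A : Type} (h : A -> bool) (l : list A) : bool :=
  Nat.odd (length (filter h l)).

Lemma xsum_cons (A : Type) (h : A -> bool) x l :
  xsum h (x :: l) = xorb (h x) (xsum h l).
Proof.
  unfold xsum. simpl. destruct (h x); trivial. simpl length.
  rewrite Nat.odd_succ, <- Nat.negb_odd. trivial.
Qed.

Lemma xsum_ext (A : Type) (h h' : A -> bool) l :
  (forall x, In x l -> h x = h' x) -> xsum h l = xsum h' l.
Proof. intro H. unfold xsum. f_equal. f_equal. apply filter_ext_in; trivial. Qed.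

Lemma xsum_app (A : Type) (h : A -> bool) l l' :
  xsum h (l ++ l') = xorb (xsum h l) (xsum h l').
Proof.
  induction l as [|x l IH]; [reflexivity|].
  simpl. rewrite !xsum_cons, IH. symmetry; apply xorb_assoc.
Qed.

Lemma xsum_map (A B : Type) (f : A -> B) (h : B -> bool) l :
  xsum h (map f l) = xsum (fun x => h (f x)) l.
Proof. induction l as [|x l IH]; [reflexivity|]. simpl. rewrite !xsum_cons, IH. trivial. Qed.

Lemma xsum_xorb (A : Type) (h h' : A -> bool) l :
  xsum (fun x => xorb (h x) (h' x)) l = xorb (xsum h l) (xsum h' l).
Proof.
  induction l as [|x l IH]; [reflexivity|]. rewrite !xsum_cons, IH.
  destruct (h x), (h' x), (xsum h l), (xsum h' l); reflexivity.
Qed.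

Lemma xsum_andb_l (A : Type) (b : bool) (h : A -> bool) l :
  xsum (fun x => b && h x) l = b && xsum h l.
Proof.
  induction l as [|x l IH]; [destruct b; reflexivity|]. rewrite !xsum_cons, IH.
  destruct b; reflexivity.
Qed.

Lemma xsum_prod (A B : Type) (h : A -> B -> bool) l l' :
  xsum (fun p => h (fst p) (snd p)) (list_prod l l') = xsum (fun i => xsum (h i) l') l.
Proof.
  induction l as [|x l IH]; [reflexivity|].
  simpl. rewrite xsum_app, xsum_map, xsum_cons, IH. reflexivity.
Qed.

Lemma xsum_bij (A B : Type) (f : A -> B) (h : A -> bool) (h' : B -> bool) l l' :
  NoDup l -> NoDup l' ->
  (forall x, In x l -> h x = true -> In (f x) l' /\ h' (f x) = true) ->
  (forall x y, In x l -> In y l -> h x = true -> h y = true -> f x = f y -> x = y) ->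
  (forall y, In y l' -> h' y = true -> exists x, In x l /\ h x = true /\ f x = y) ->
  xsum h l = xsum h' l'.
Proof.
  intros Hl Hl' H1 H2 H3. unfold xsum. f_equal.
  apply (card_bij _ _ f); auto using NoDup_filter.
  - intros x. rewrite !filter_In. intros []; auto.
  - intros x y. rewrite !filter_In. intros [] []; auto.
  - intros y. rewrite filter_In. intros [Hy Hy']. destruct (H3 y Hy Hy') as (x & ? & ? & ?).
    exists x. rewrite filter_In. auto.
Qed.

Lemma xsum_zero (A : Type) (h : A -> bool) l :
  (forall x, In x l -> h x = false) -> xsum h l = false.
Proof.
  intros Hl. rewrite (xsum_ext _ h (fun _ => false && true)) by auto.
  rewrite (xsum_andb_l _ false (fun _ => true)). trivial.
Qed.

Lemma xsum_single (A : Type) (h : A -> bool) l x0 :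
  NoDup l -> In x0 l -> (forall x, In x l -> x <> x0 -> h x = false) -> xsum h l = h x0.
Proof.
  intros Hl H0 H. apply in_split in H0. destruct H0 as (l1 & l2 & ->).
  assert (Hl3 := NoDup_remove_2 _ _ _ Hl). rewrite in_app_iff in Hl3.
  rewrite xsum_app, xsum_cons, (xsum_zero _ h l1), (xsum_zero _ h l2), xorb_false_r; trivial;
    intros x Hx; apply H; try (rewrite in_app_iff; simpl; tauto); intros ->; auto.
Qed.

Lemma NoDup_prod (A B : Type) (l : list A) (l' : list B) :
  NoDup l -> NoDup l' -> NoDup (list_prod l l').
Proof.
  intros Hl Hl'. induction Hl as [|x l Hx Hl IH]; simpl; [constructor|].
  apply NoDup_app; trivial.
  - apply NoDup_map_NoDup_ForallPairs; trivial. intros a b _ _ E. congruence.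
  - intros [a b] H1 H2. apply in_map_iff in H1. destruct H1 as (? & [= <- <-] & _).
    apply in_prod_iff in H2. tauto.
Qed.

Definition box (n : nat) : list (nat * nat) := list_prod (seq 0 (S n)) (seq 0 (S n)).

Lemma In_box n a b : In (a, b) (box n) <-> a <= n /\ b <= n.
Proof. unfold box. rewrite in_prod_iff, !in_seq. lia. Qed.

Lemma NoDup_box n : NoDup (box n).
Proof. apply NoDup_prod; apply seq_NoDup. Qed.

Lemma ps_mul_xsum f g n : ps_mul f g n = xsum (fun i => f i && g (n - i)) (seq 0 (S n)).
Proof.
  assert (H : forall (h : nat -> bool) l b, fold_left xorb (map h l) b = xorb b (xsum h l)).
  { intros h l; induction l as [|x l IH]; intro b; simpl.
    - symmetry; apply xorb_false_r.
    - rewrite IH, xsum_cons. apply xorb_assoc. }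
  unfold ps_mul. rewrite (H (fun i => f i && g (n - i))). apply xorb_false_l.
Qed.

Lemma ps_mulE f g n :
  ps_mul f g n = xsum (fun p => f (fst p) && g (snd p) && (fst p + snd p =? n)) (box n).
Proof.
  rewrite ps_mul_xsum.
  apply (xsum_bij _ _ (fun i => (i, n - i))).
  - apply seq_NoDup.
  - apply NoDup_box.
  - intros i Hi Hv. apply in_seq in Hi. simpl. split.
    + apply In_box. lia.
    + rewrite Hv. simpl. apply Nat.eqb_eq. lia.
  - congruence.
  - intros [i j] Hij. simpl. apply In_box in Hij.
    rewrite !andb_true_iff, Nat.eqb_eq. intros [[H1 H2] H3].
    exists i. rewrite in_seq. replace (n - i) with j by lia.
    rewrite H1, H2. repeat split; lia.
Qed.

(** Enlarging the range of the indices adds no terms. In a triple product all inner coefficients can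
    thus be taken over one common box. *)
Lemma ps_mulE' N f g n : n <= N ->
  ps_mul f g n = xsum (fun p => f (fst p) && g (snd p) && (fst p + snd p =? n)) (box N).
Proof.
  intro HN. rewrite ps_mulE. apply (xsum_bij _ _ (fun p => p)); auto using NoDup_box.
  - intros [i j] Hi Hv. cbn beta. rewrite In_box in *. split; trivial. lia.
  - intros [i j] Hi. cbn [fst snd]. rewrite In_box in Hi. intro Hv. exists (i, j).
    rewrite In_box. cbn [fst snd]. repeat split; trivial;
    rewrite !andb_true_iff, Nat.eqb_eq in Hv; lia.
Qed.

Lemma ps_mul_comm f g : ps_mul f g = ps_mul g f.
Proof.
  apply functional_extensionality; intro n. rewrite !ps_mulE.
  apply (xsum_bij _ _ (fun p => (snd p, fst p))); auto using NoDup_box.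
  - intros [i j]. rewrite !In_box. cbn [fst snd].
    rewrite !andb_true_iff, !Nat.eqb_eq. intuition lia.
  - intros [i j] [i' j']. cbn [fst snd]. congruence.
  - intros [i j]. rewrite In_box. cbn [fst snd]. intros H1 H2. exists (j, i). rewrite In_box. cbn [fst snd].
    rewrite !andb_true_iff, !Nat.eqb_eq in *. intuition lia.
Qed.

(** Both sides are the sum over triples [(a, b, c)] of total [n]. For the right-hand side the
    triples are rotated to [(c, (a, b))] and commutativity moves [h] to the front, after which the
    first computation repeats itself. *)
Lemma ps_mul_assoc f g h : ps_mul f (ps_mul g h) = ps_mul (ps_mul f g) h.
Proof.
  apply functional_extensionality; intro n. rewrite !ps_mulE.
  set (l := seq 0 (S n)).
  transitivity (xsum (fun p => f (fst p) && g (fst (snd p)) && h (snd (snd p))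
                 && (fst p + fst (snd p) + snd (snd p) =? n)) (list_prod l (box n))).
  - unfold box at 1. fold l.
    rewrite (xsum_prod _ _ (fun a b => f a && ps_mul g h b && (a + b =? n))).
    rewrite (xsum_prod _ _ (fun a q => f a && g (fst q) && h (snd q) && (a + fst q + snd q =? n))).
    apply xsum_ext. intros a Ha. unfold l in Ha. apply in_seq in Ha.
    rewrite (xsum_single _ _ l (n - a)).
    + replace (a + (n - a) =? n) with true by (symmetry; apply Nat.eqb_eq; lia).
      rewrite andb_true_r, (ps_mulE' n) by lia. rewrite <- xsum_andb_l. apply xsum_ext.
      intros [b c] _. cbn [fst snd]. rewrite !andb_assoc. f_equal.
      apply eq_true_iff_eq. rewrite !Nat.eqb_eq. lia.
    + apply seq_NoDup.
    + apply in_seq. lia.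
    + intros b _ Hb. replace (a + b =? n) with false by (symmetry; apply Nat.eqb_neq; lia).
      apply andb_false_r.
  - transitivity (xsum (fun p => h (fst p) && (f (fst (snd p)) && g (snd (snd p)))
                 && (fst p + fst (snd p) + snd (snd p) =? n)) (list_prod l (box n))).
    + apply (xsum_bij _ _ (fun p => (snd (snd p), (fst p, fst (snd p)))));
        try (apply NoDup_prod; auto using NoDup_box; apply seq_NoDup).
      * intros [a [b c]]. cbn [fst snd]. unfold l. rewrite !in_prod_iff, !In_box, !in_seq, !andb_true_iff, !Nat.eqb_eq.
        intuition lia.
      * intros [a [b c]] [a' [b' c']]; cbn [fst snd]; congruence.
      * intros [c [a b]]. cbn [fst snd]. unfold l. rewrite !in_prod_iff, !In_box, !in_seq, !andb_true_iff, !Nat.eqb_eq.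
        intros H1 H2. exists (a, (b, c)). cbn [fst snd].
        rewrite !in_prod_iff, !In_box, !in_seq, !andb_true_iff, !Nat.eqb_eq.
        intuition lia.
    + rewrite <- ps_mulE, ps_mul_comm, ps_mulE.
      unfold box at 2. fold l.
      rewrite (xsum_prod _ _ (fun a b => h a && ps_mul f g b && (a + b =? n))).
      rewrite (xsum_prod _ _ (fun a q => h a && (f (fst q) && g (snd q)) && (a + fst q + snd q =? n))).
      apply xsum_ext. intros a Ha. unfold l in Ha. apply in_seq in Ha.
      rewrite (xsum_single _ _ l (n - a)).
      * replace (a + (n - a) =? n) with true by (symmetry; apply Nat.eqb_eq; lia).
        rewrite andb_true_r, (ps_mulE' n) by lia. rewrite <- xsum_andb_l. apply xsum_ext.
        intros [b c] _. cbn [fst snd]. rewrite !andb_assoc. f_equal.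
        apply eq_true_iff_eq. rewrite !Nat.eqb_eq. lia.
      * apply seq_NoDup.
      * apply in_seq. lia.
      * intros b _ Hb. replace (a + b =? n) with false by (symmetry; apply Nat.eqb_neq; lia).
        apply andb_false_r.
Qed.

Lemma ps_mul_add_r f g h : ps_mul (ps_add f g) h = ps_add (ps_mul f h) (ps_mul g h).
Proof.
  apply functional_extensionality; intro n. unfold ps_add at 2. rewrite !ps_mulE, <- xsum_xorb.
  apply xsum_ext. intros [i j] _. unfold ps_add. simpl.
  destruct (f i), (g i), (h j), (i + j =? n); reflexivity.
Qed.

Lemma ps_mul_1_l f : ps_mul ps_one f = f.
Proof.
  apply functional_extensionality; intro n. rewrite ps_mulE.
  rewrite (xsum_single _ _ _ (0, n)).
  - simpl. rewrite Nat.eqb_refl. apply andb_true_r.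
  - apply NoDup_box.
  - apply In_box. lia.
  - intros [i j] _ H. simpl. unfold ps_one.
    destruct (Nat.eqb_spec i 0); trivial.
    destruct (Nat.eqb_spec (i + j) n); [|apply andb_false_r].
    exfalso. apply H. f_equal; lia.
Qed.

Definition ps_zero : ps2 := fun _ => false.

Lemma ps2_ring_theory :
  ring_theory ps_zero ps_one ps_add ps_mul ps_add (fun f => f) eq.
Proof.
  split; auto using ps_mul_comm, ps_mul_assoc, ps_mul_1_l, ps_mul_add_r;
    intros; apply functional_extensionality; intro n; unfold ps_add, ps_zero;
    auto using xorb_false_l, xorb_comm, xorb_nilpotent.
  symmetry; apply xorb_assoc.
Qed.

Lemma ps_pow_power_theory : power_theory ps_one ps_mul eq N.to_nat ps_pow.
Proof.
  split. intros f n. rewrite <- (N2Nat.id n) at 2. generalize (N.to_nat n). clear n.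
  induction n as [|n IH]; [reflexivity|].
  destruct n as [|n].
  - simpl. rewrite ps_mul_comm. apply ps_mul_1_l.
  - rewrite Nat2N.inj_succ. change (ps_pow f (S (S n))) with (ps_mul f (ps_pow f (S n))).
    rewrite IH. simpl. rewrite pow_pos_succ; trivial.
    + split; congruence.
    + intros ? ? -> ? ? ->; trivial.
    + apply ps_mul_assoc.
Qed.

Ltac ps_pow_tac t :=
  match isnatcst t with
  | true => constr:(N.of_nat t)
  | _ => constr:(InitialRing.NotConstant)
  end.

(* Coefficients in bool, so that [ring] knows that the characteristic is 2. *)
Definition ps_const (b : bool) : ps2 := if b then ps_one else ps_zero.

Lemma ps_const_morph :
  ring_morph ps_zero ps_one ps_add ps_mul ps_add (fun f => f) eq
    false true xorb andb xorb (fun b => b) Bool.eqb ps_const.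
Proof.
  assert (H0 : forall f, ps_add f f = ps_zero).
  { intro f. apply functional_extensionality; intro n. apply xorb_nilpotent. }
  assert (H1 : forall f, ps_mul ps_zero f = ps_zero).
  { intro f. rewrite <- (H0 ps_zero) at 1. rewrite ps_mul_add_r. apply H0. }
  split; try reflexivity.
  - intros [] []; apply functional_extensionality; intro n; unfold ps_const, ps_add, ps_zero;
      simpl; destruct (ps_one n); reflexivity.
  - intros [] []; apply functional_extensionality; intro n; unfold ps_const, ps_add, ps_zero;
      simpl; destruct (ps_one n); reflexivity.
  - intros [] []; simpl; rewrite ?H1, ?ps_mul_1_l; reflexivity.
  - intros [] []; trivial; discriminate.
Qed.

Ltac ps_cst t :=
  match t with
  | ps_zero => constr:(false)
  | ps_one => constr:(true)
  | _ => constr:(InitialRing.NotConstant)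
  end.

Add Ring ps2_ring : ps2_ring_theory
  (morphism ps_const_morph, constants [ps_cst], power_tac ps_pow_power_theory [ps_pow_tac]).

(** * Substitution of X^k for the variable X *)

Definition dilate (k : nat) (f : ps2) : ps2 :=
  fun n => if n mod k =? 0 then f (n / k) else false.

Lemma dilate_mult k f n : 0 < k -> dilate k f (k * n) = f n.
Proof.
  intro Hk. unfold dilate. rewrite Nat.mul_comm, Nat.Div0.mod_mul, Nat.div_mul by lia. trivial.
Qed.

Lemma dilate_nmult k f n : (forall m, n <> k * m) -> dilate k f n = false.
Proof.
  intro H. unfold dilate. destruct (Nat.eqb_spec (n mod k) 0) as [E|E]; trivial.
  exfalso. apply (H (n / k)). rewrite (Nat.div_mod_eq n k) at 1. lia.
Qed.

Lemma multiple_dec k n : 0 < k -> (exists m, n = k * m) \/ (forall m, n <> k * m).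
Proof.
  intro Hk. destruct (Nat.eq_dec (n mod k) 0) as [E|E].
  - left. exists (n / k). rewrite (Nat.div_mod_eq n k) at 1. lia.
  - right. intros m ->. apply E. rewrite Nat.mul_comm. apply Nat.Div0.mod_mul.
Qed.

Lemma dilate_unique k f g :
  0 < k -> (forall n, g (k * n) = f n) -> (forall n, (forall m, n <> k * m) -> g n = false) ->
  dilate k f = g.
Proof.
  intros Hk H1 H2. apply functional_extensionality; intro n.
  destruct (multiple_dec k n Hk) as [[m ->]|Hn].
  - rewrite dilate_mult, H1; trivial.
  - rewrite dilate_nmult, H2; trivial.
Qed.

Lemma dilate_inj k f g : 0 < k -> dilate k f = dilate k g -> f = g.
Proof.
  intros Hk E. apply functional_extensionality; intro n.
  rewrite <- (dilate_mult k f n), <- (dilate_mult k g n), E; trivial.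
Qed.

Lemma dilate_dilate k l f : 0 < k -> 0 < l -> dilate k (dilate l f) = dilate (k * l) f.
Proof.
  intros Hk Hl. symmetry. apply dilate_unique; [lia| |].
  - intro n. rewrite <- Nat.mul_assoc, !dilate_mult; trivial.
  - intros n Hn. destruct (multiple_dec k n Hk) as [[m ->]|Hm].
    + rewrite dilate_mult by trivial. apply dilate_nmult. intros m' ->. apply (Hn m'). lia.
    + apply dilate_nmult; trivial.
Qed.

Lemma dilate_add k f g : dilate k (ps_add f g) = ps_add (dilate k f) (dilate k g).
Proof.
  apply functional_extensionality; intro n. unfold dilate, ps_add.
  destruct (n mod k =? 0); trivial.
Qed.

Lemma dilate_mul k f g : 0 < k -> dilate k (ps_mul f g) = ps_mul (dilate k f) (dilate k g).
Proof.
  intro Hk. apply dilate_unique; trivial.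
  - intro n. rewrite !ps_mulE. symmetry.
    apply (xsum_bij _ _ (fun p => (k * fst p, k * snd p))); auto using NoDup_box.
    + intros [i j]. rewrite !In_box. cbn [fst snd]. rewrite !dilate_mult by trivial.
      rewrite !andb_true_iff, !Nat.eqb_eq. intros H [[H1 H2] H3]. repeat split; trivial; nia.
    + intros [i j] [i' j'] _ _ _ _. cbn [fst snd]. intros [= E1 E2]. f_equal; nia.
    + intros [i j]. rewrite In_box. cbn [fst snd]. rewrite !andb_true_iff, Nat.eqb_eq.
      intros H [[H1 H2] H3].
      destruct (multiple_dec k i Hk) as [[i' ->]|Hi]; [|rewrite dilate_nmult in H1 by trivial; discriminate].
      destruct (multiple_dec k j Hk) as [[j' ->]|Hj]; [|rewrite dilate_nmult in H2 by trivial; discriminate].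
      rewrite dilate_mult in H1, H2 by trivial.
      exists (i', j'). rewrite In_box. cbn [fst snd]. rewrite H1, H2. cbn [andb]. rewrite Nat.eqb_eq. repeat split; nia.
  - intros n Hn. rewrite ps_mulE. apply xsum_zero. intros [i j] _. cbn [fst snd].
    destruct (multiple_dec k i Hk) as [[i' ->]|Hi]; [|rewrite dilate_nmult; trivial].
    destruct (multiple_dec k j Hk) as [[j' ->]|Hj];
      [|rewrite (dilate_nmult k g j), andb_false_r; trivial].
    destruct (Nat.eqb_spec (k * i' + k * j') n) as [E|E]; [|apply andb_false_r].
    exfalso. apply (Hn (i' + j')). lia.
Qed.

(** The Frobenius map: exchanging the two factors pairs off the products of coefficients with
    distinct indices, and only the diagonal one remains. *)
Lemma ps_sqr f : ps_mul f f = dilate 2 f.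
Proof.
  symmetry. apply dilate_unique; [lia| |].
  - intro n. rewrite ps_mulE. unfold xsum. set (l := filter _ _).
    assert (Hl : NoDup l) by (apply NoDup_filter, NoDup_box).
    assert (Hin : forall i j, In (i, j) l <-> f i = true /\ f j = true /\ i + j = 2 * n).
    { intros i j. unfold l. rewrite filter_In, In_box. cbn [fst snd].
      rewrite !andb_true_iff, Nat.eqb_eq. intuition lia. }
    set (s := fun p : nat * nat => (snd p, fst p)).
    destruct (f n) eqn:Hf.
    + apply (involution_odd _ s _ (n, n)); trivial.
      * apply Hin. repeat split; trivial; lia.
      * intros [i j] H. unfold s. simpl. rewrite !Hin in *. repeat split; try tauto; try lia;
          intros [= E1 E2]; [f_equal; lia|congruence].
    + apply (involution_even _ s); trivial.
      intros [i j] H. unfold s. simpl. rewrite !Hin in *. repeat split; try tauto; try lia.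
      intros [= E1 E2]. subst. replace i with n in * by lia. destruct H. congruence.
  - intros n Hn. rewrite ps_mulE. unfold xsum. set (l := filter _ _).
    assert (Hl : NoDup l) by (apply NoDup_filter, NoDup_box).
    assert (Hin : forall i j, In (i, j) l <-> f i = true /\ f j = true /\ i + j = n).
    { intros i j. unfold l. rewrite filter_In, In_box. cbn [fst snd].
      rewrite !andb_true_iff, Nat.eqb_eq. intuition lia. }
    apply (involution_even _ (fun p : nat * nat => (snd p, fst p))); trivial.
    intros [i j] H. simpl. rewrite !Hin in *. repeat split; try tauto; try lia.
    intros [= E1 E2]. subst. apply (Hn i). lia.
Qed.

(** The coefficient of X^(n+1) in the product is that of X^n in [g] plus terms involving earlier
    coefficients of [g]. This is the cancellation law for series that begin with X. *)
Lemma ps_mul_eq_zero f g : f 0 = false -> f 1 = true -> ps_mul f g = ps_zero -> g = ps_zero.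
Proof.
  intros H0 H1 E. apply functional_extensionality; intro n. unfold ps_zero.
  induction n as [n IH] using lt_wf_ind.
  assert (En : ps_mul f g (S n) = false) by (rewrite E; trivial).
  rewrite ps_mulE, (xsum_single _ _ _ (1, n)) in En.
  - cbn [fst snd] in En. rewrite H1, Nat.eqb_refl, andb_true_r in En. trivial.
  - apply NoDup_box.
  - apply In_box. lia.
  - intros [i j] _ Hij. cbn [fst snd].
    destruct (Nat.eqb_spec (i + j) (S n)) as [E'|]; [|apply andb_false_r].
    destruct i as [|[|i]].
    + rewrite H0. trivial.
    + exfalso. apply Hij. f_equal. lia.
    + rewrite (IH j), andb_false_r by lia. trivial.
Qed.

(** The sum of X^(c m^2) over the m satisfying [p]. For positive [c] the exponents are distinct, so
    that existence of m is the same as the sum modulo 2, and m is at most c m^2, so that the search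
    may stop at [n]. *)
Definition theta (p : nat -> bool) (c : nat) : ps2 :=
  fun n => existsb (fun m => p m && (c * m * m =? n)) (seq 0 (S n)).

Lemma le_mul_sqr c m : 0 < c -> m <= c * m * m.
Proof.
  intro Hc. assert (m <= m * m) by (destruct m; lia).
  rewrite <- Nat.mul_assoc. apply Nat.le_trans with (1 * (m * m)); [lia|].
  apply Nat.mul_le_mono_r; trivial.
Qed.

Lemma mul_sqr_inj c a b : 0 < c -> c * a * a = c * b * b -> a = b.
Proof.
  intros Hc E. rewrite <- !Nat.mul_assoc in E. apply Nat.mul_cancel_l in E; [|lia].
  destruct (Nat.lt_trichotomy a b) as [H|[H|H]]; trivial; nia.
Qed.

Lemma thetaP p c n : 0 < c -> theta p c n = true <-> exists m, p m = true /\ c * m * m = n.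
Proof.
  intro Hc. unfold theta. rewrite existsb_exists. split.
  - intros (m & _ & Hm). rewrite andb_true_iff, Nat.eqb_eq in Hm. eauto.
  - intros (m & Hm & E). exists m. rewrite in_seq, Hm, E, Nat.eqb_refl. split; trivial.
    assert (H := le_mul_sqr c m Hc). lia.
Qed.

Lemma theta_dilate p c k : 0 < c -> 0 < k -> dilate k (theta p c) = theta p (k * c).
Proof.
  intros Hc Hk. apply dilate_unique; trivial.
  - intro n. apply eq_true_iff_eq. rewrite !thetaP by nia.
    split; intros (m & Hm & E); exists m; split; trivial; rewrite <- !Nat.mul_assoc in *;
      [apply Nat.mul_cancel_l in E; lia|rewrite E; trivial].
  - intros n Hn. apply not_true_is_false. rewrite thetaP by nia.
    intros (m & _ & <-). apply (Hn (c * m * m)). lia.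
Qed.

Lemma theta_mul p c p' c' n : 0 < c -> 0 < c' ->
  ps_mul (theta p c) (theta p' c') n =
  xsum (fun q => p (fst q) && p' (snd q) && (c * fst q * fst q + c' * snd q * snd q =? n)) (box n).
Proof.
  intros Hc Hc'. rewrite ps_mulE. symmetry.
  apply (xsum_bij _ _ (fun q => (c * fst q * fst q, c' * snd q * snd q))); auto using NoDup_box.
  - intros [a b]. rewrite !In_box. cbn [fst snd]. rewrite !andb_true_iff, !thetaP, !Nat.eqb_eq by trivial.
    intros _ [[H1 H2] H3]. repeat split; eauto; lia.
  - intros [a b] [a' b'] _ _ _ _. cbn [fst snd]. intros [= E1 E2].
    f_equal; eauto using mul_sqr_inj.
  - intros [i j]. rewrite In_box. cbn [fst snd]. rewrite !andb_true_iff, !thetaP, !Nat.eqb_eq by trivial.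
    intros _ [[(a & Ha & <-) (b & Hb & <-)] H]. exists (a, b).
    rewrite In_box. cbn [fst snd]. rewrite !andb_true_iff, Nat.eqb_eq.
    assert (H1 := le_mul_sqr c a Hc). assert (H2 := le_mul_sqr c' b Hc').
    repeat split; trivial; lia.
Qed.

Lemma Fser_theta : Fser = theta Nat.odd 1.
Proof.
  apply functional_extensionality; intro n. unfold Fser, theta.
  apply eq_true_iff_eq. rewrite !existsb_exists.
  split; intros (m & H1 & H2); exists m; split; trivial; rewrite Nat.mul_1_l in *; trivial.
Qed.

Lemma Gser_dilate : Gser = dilate 5 Fser.
Proof. reflexivity. Qed.

Local Ltac Zify.zify_post_hook ::= Z.to_euclidean_division_equations.

(** The series P of the overview is [theta coprime6 1]. *)
Definition coprime6 (a : nat) : bool := Nat.odd a && negb (a mod 3 =? 0).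

Lemma coprime6_abs (x : Z) :
  coprime6 (Z.abs_nat x) = true <-> (x mod 2 = 1 /\ x mod 3 <> 0)%Z.
Proof.
  unfold coprime6. rewrite andb_true_iff, negb_true_iff, Nat.eqb_neq, Nat.odd_spec.
  split.
  - intros [[k Hk] H]. split; lia.
  - intros [H1 H2]. split; [|lia].
    exists (Z.abs_nat x / 2). lia.
Qed.

Lemma odd_abs (x : Z) : Nat.odd (Z.abs_nat x) = true <-> (x mod 2 = 1)%Z.
Proof.
  rewrite Nat.odd_spec. split.
  - intros [k Hk]. lia.
  - intros H1. exists (Z.abs_nat x / 2). lia.
Qed.

Definition form_reps (p p' : nat -> bool) (c c' n : nat) : list (nat * nat) :=
  filter (fun q => p (fst q) && p' (snd q) && (c * fst q * fst q + c' * snd q * snd q =? n)) (box n).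

Lemma NoDup_form_reps p p' c c' n : NoDup (form_reps p p' c c' n).
Proof. apply NoDup_filter, NoDup_box. Qed.

(** Representations are counted up to the signs of the coordinates. Writing the coordinates as
    absolute values of integers leaves the signs free, so that they can be chosen to suit the
    congruences below. *)
Lemma In_form_reps p p' c c' n x y : 0 < c -> 0 < c' ->
  In (Z.abs_nat x, Z.abs_nat y) (form_reps p p' c c' n) <->
  p (Z.abs_nat x) = true /\ p' (Z.abs_nat y) = true /\
  (Z.of_nat c * x * x + Z.of_nat c' * y * y = Z.of_nat n)%Z.
Proof.
  intros Hc Hc'. unfold form_reps. rewrite filter_In, In_box. cbn [fst snd].
  rewrite !andb_true_iff, Nat.eqb_eq.
  assert (E : (c * Z.abs_nat x * Z.abs_nat x + c' * Z.abs_nat y * Z.abs_nat y = n <->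
            (Z.of_nat c * x * x + Z.of_nat c' * y * y = Z.of_nat n)%Z)).
  { rewrite <- Nat2Z.inj_iff, Nat2Z.inj_add, !Nat2Z.inj_mul, !Zabs2Nat.id_abs.
    replace (Z.of_nat c * Z.abs x * Z.abs x)%Z with (Z.of_nat c * x * x)%Z by lia.
    replace (Z.of_nat c' * Z.abs y * Z.abs y)%Z with (Z.of_nat c' * y * y)%Z by lia.
    tauto. }
  rewrite E. split; [tauto|]. intros (H1 & H2 & H3). apply E in H3 as H4.
  assert (H5 := le_mul_sqr c (Z.abs_nat x) Hc). assert (H6 := le_mul_sqr c' (Z.abs_nat y) Hc').
  repeat split; trivial; lia.
Qed.

(** * Theta identities from norm forms *)

(** The sign of [y] is chosen so that x = y + m t is congruent to y. In the coordinates (y, t) the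
    reflections below become integral linear maps. *)
Lemma abs_nat_pair (a b : nat) (m : Z) :
  (m <> 0 -> (Z.of_nat a - Z.of_nat b) mod m = 0 \/ (Z.of_nat a + Z.of_nat b) mod m = 0 ->
  exists y t : Z, a = Z.abs_nat (y + m * t) /\ b = Z.abs_nat y)%Z.
Proof.
  intros Hm [H|H].
  - exists (Z.of_nat b), ((Z.of_nat a - Z.of_nat b) / m)%Z.
    rewrite <- Z_div_exact_full_2 by trivial. lia.
  - exists (- Z.of_nat b)%Z, ((Z.of_nat a + Z.of_nat b) / m)%Z.
    rewrite <- Z_div_exact_full_2 by trivial. lia.
Qed.

(* The reflection of the form x^2 + 3y^2 that is integral on x = y mod 4, the sign
   of y being adjusted so as to satisfy this congruence. *)
Definition flip3 (q : nat * nat) : nat * nat :=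
  let x := Z.of_nat (fst q) in let y := Z.of_nat (snd q) in
  if ((x - y) mod 4 =? 0)%Z
  then (Z.abs_nat ((3 * y - x) / 2), Z.abs_nat ((x + y) / 2))
  else (Z.abs_nat ((3 * y + x) / 2), Z.abs_nat ((x - y) / 2)).

(** The reflection is (y, t) -> (y + 2 t, - t), visibly an involution. As y is odd, y and - y differ
    modulo 4, so that the test in [flip3] recovers the right sign. *)
Lemma flip3_abs y t : (y mod 2 = 1)%Z ->
  flip3 (Z.abs_nat (y + 4 * t), Z.abs_nat y) = (Z.abs_nat (y - 2 * t), Z.abs_nat (y + 2 * t)).
Proof.
  intros Hy. unfold flip3. cbn [fst snd]. rewrite !Zabs2Nat.id_abs.
  destruct (Z.eqb_spec ((Z.abs (y + 4 * t) - Z.abs y) mod 4) 0) as [E|E]; f_equal; lia.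
Qed.

(** The identity P(X^4) = P(X) F(X^3): the right-hand side counts n = x^2 + 3 y^2 with x prime to 6
    and y odd, and the fixed points of the reflection are the x = y = m, where n = 4 m^2. Modulo 3
    the new x agrees with the old one. *)
Lemma theta_quartic :
  theta coprime6 4 = ps_mul (theta coprime6 1) (theta Nat.odd 3).
Proof.
  apply functional_extensionality; intro n. rewrite theta_mul by lia.
  change (xsum _ _) with (Nat.odd (length (form_reps coprime6 Nat.odd 1 3 n))).
  assert (Hstep : forall q, In q (form_reps coprime6 Nat.odd 1 3 n) ->
    In (flip3 q) (form_reps coprime6 Nat.odd 1 3 n) /\ flip3 (flip3 q) = q /\
    (flip3 q = q <-> exists m, coprime6 m = true /\ q = (m, m) /\ n = 4 * m * m)).
  { intros [a b] Hab.
    destruct (abs_nat_pair a b 4) as (y & t & -> & ->); [lia| |].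
    { rewrite <- (Zabs2Nat.id a), <- (Zabs2Nat.id b) in Hab.
      rewrite In_form_reps, coprime6_abs, odd_abs in Hab by lia. lia. }
    rewrite In_form_reps, coprime6_abs, odd_abs in Hab by lia.
    destruct Hab as ((H1 & H2) & H3 & H4).
    rewrite flip3_abs by trivial. split; [|split; [|split]].
    - rewrite In_form_reps, coprime6_abs, odd_abs by lia. split; [split|split]; [lia| |lia|].
      + clear - H2. lia.
      + rewrite <- H4. lia.
    - replace (y - 2 * t)%Z with (y + 2 * t + 4 * - t)%Z by ring.
      rewrite flip3_abs by lia. f_equal; f_equal; ring.
    (* Fixed points up to sign are t = 0 and t = - y; the latter gives x = - 3 y, which is not prime
       to 3. *)
    - intros [E1 E2]%pair_equal_spec. assert (t = 0 \/ t = - y)%Z as [-> | ->] by lia; [|lia].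
      exists (Z.abs_nat y). rewrite coprime6_abs. repeat split; try lia.
      f_equal; lia.
    - intros (m & _ & [E1 E2]%pair_equal_spec & _). f_equal; lia. }
  destruct (theta coprime6 4 n) eqn:E.
  - apply thetaP in E; [|lia]. destruct E as (m & Hm & E). symmetry.
    apply (involution_odd _ flip3 _ (m, m)).
    + apply NoDup_form_reps.
    + rewrite <- (Zabs2Nat.id m) in *. rewrite In_form_reps by lia.
      rewrite coprime6_abs in *. rewrite odd_abs. repeat split; lia.
    + intros q Hq. destruct (Hstep q Hq) as (H1 & H2 & H3). rewrite H3.
      repeat split; trivial.
      * intros (m' & _ & -> & E'). rewrite <- E in E'.
        apply mul_sqr_inj in E'; [|lia]. congruence.
      * intros ->. eauto.
  - symmetry. apply (involution_even _ flip3); [apply NoDup_form_reps|].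
    intros q Hq. destruct (Hstep q Hq) as (H1 & H2 & H3). repeat split; trivial.
    rewrite H3. intros (m & Hm & _ & En).
    assert (Ht : theta coprime6 4 n = true) by (apply thetaP; eauto; lia).
    congruence.
Qed.

(* The reflection of the form x^2 + 5y^2 that is integral on x = y mod 3. *)
Definition flip5 (q : nat * nat) : nat * nat :=
  let x := Z.of_nat (fst q) in let y := Z.of_nat (snd q) in
  if ((x - y) mod 3 =? 0)%Z
  then (Z.abs_nat ((5 * y - 2 * x) / 3), Z.abs_nat ((x + 2 * y) / 3))
  else (Z.abs_nat ((5 * y + 2 * x) / 3), Z.abs_nat ((x - 2 * y) / 3)).

(** Here the reflection is (y, t) -> (y + t, - t). *)
Lemma flip5_abs y t : (y mod 3 <> 0)%Z ->
  flip5 (Z.abs_nat (y + 3 * t), Z.abs_nat y) = (Z.abs_nat (y - 2 * t), Z.abs_nat (y + t)).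
Proof.
  intros Hy. unfold flip5. cbn [fst snd]. rewrite !Zabs2Nat.id_abs.
  destruct (Z.eqb_spec ((Z.abs (y + 3 * t) - Z.abs y) mod 3) 0) as [E|E]; f_equal; lia.
Qed.

Local Notation reps5 := (form_reps coprime6 coprime6 1 5).

Lemma In_reps5 n x y :
  In (Z.abs_nat x, Z.abs_nat y) (reps5 n) <->
  (x mod 2 = 1 /\ x mod 3 <> 0 /\ y mod 2 = 1 /\ y mod 3 <> 0 /\
   x * x + 5 * (y * y) = Z.of_nat n)%Z.
Proof.
  rewrite In_form_reps, !coprime6_abs by lia.
  replace (Z.of_nat 1 * x * x + Z.of_nat 5 * y * y)%Z with (x * x + 5 * (y * y))%Z by lia.
  tauto.
Qed.

Lemma reps5_signs n a b : In (a, b) (reps5 n) ->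
  exists y t : Z, a = Z.abs_nat (y + 3 * t) /\ b = Z.abs_nat y.
Proof.
  intro Hab. apply abs_nat_pair; [lia|].
  rewrite <- (Zabs2Nat.id a), <- (Zabs2Nat.id b), In_reps5 in Hab. lia.
Qed.

(** Odd squares are 1 modulo 8, so the two sides would be 1 and 5. Hence the exponents of F(X^6) and
    F(X^30) never meet, and the sum of these series modulo 2 is a union. *)
Lemma square_ne_5_square m k :
  Nat.odd m = true -> Nat.odd k = true -> m * m <> 5 * (k * k).
Proof.
  rewrite !Nat.odd_spec. intros [m' ->] [k' ->] E.
  assert (H : m' * (m' + 1) = 5 * (k' * (k' + 1)) + 1) by nia.
  assert (Hpar : forall x, exists y, x * (x + 1) = 2 * y).
  { intro x. destruct (Nat.Even_or_Odd x) as [[z ->]|[z ->]].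
    - exists (z * (2 * z + 1)). ring.
    - exists ((2 * z + 1) * (z + 1)). ring. }
  destruct (Hpar m') as [u Hu], (Hpar k') as [v Hv]. lia.
Qed.

Definition sextic_theta : ps2 := ps_add (theta Nat.odd 6) (theta Nat.odd 30).

Lemma sextic_thetaP n :
  sextic_theta n = true <-> exists m, Nat.odd m = true /\ (6 * m * m = n \/ 30 * m * m = n).
Proof.
  unfold sextic_theta, ps_add.
  assert (H6 := thetaP Nat.odd 6 n ltac:(lia)). assert (H30 := thetaP Nat.odd 30 n ltac:(lia)).
  destruct (theta Nat.odd 6 n), (theta Nat.odd 30 n); simpl; split; intro H; trivial; try discriminate.
  - destruct H6 as [H6 _], H30 as [H30 _].
    destruct (H6 eq_refl) as (m & Hm & E), (H30 eq_refl) as (k & Hk & E').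
    exfalso. apply (square_ne_5_square m k); trivial. lia.
  - destruct H6 as [H6 _]. destruct (H6 eq_refl) as (m & Hm & E). eauto.
  - destruct H30 as [H30 _]. destruct (H30 eq_refl) as (m & Hm & E). eauto.
  - destruct H as (m & Hm & [E|E]); [apply H6|apply H30]; eauto.
Qed.

(** Only here is it certain that the reflection keeps both coordinates prime to 3: the new ones are
    y - 2 t and y + t, congruent to each other modulo 3, and if 3 divided them then 9 would divide
    n. *)
Lemma reps5_parity_base n : n mod 9 <> 0 -> Nat.odd (length (reps5 n)) = sextic_theta n.
Proof.
  intro Hn.
  assert (Hstep : forall q, In q (reps5 n) ->
    In (flip5 q) (reps5 n) /\ flip5 (flip5 q) = q /\
    (flip5 q = q <-> exists m, Nat.odd m = true /\
       (6 * m * m = n /\ q = (m, m) \/ 30 * m * m = n /\ q = (5 * m, m)))).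
  { intros [a b] Hab. destruct (reps5_signs n a b Hab) as (y & t & -> & ->).
    rewrite In_reps5 in Hab. destruct Hab as (H1 & H2 & H3 & H4 & H5).
    assert (H6 : ((y + t) mod 3 <> 0)%Z).
    { intro E. apply Hn. apply Nat2Z.inj. rewrite Nat2Z.inj_mod, <- H5.
      replace t with (3 * ((y + t) / 3) - y)%Z by lia. set (w := ((y + t) / 3)%Z).
      replace (_ + _)%Z with (0 + (y * y - 4 * (w * y) + 9 * (w * w)) * 9)%Z by ring.
      rewrite Z_mod_plus_full. reflexivity. }
    rewrite flip5_abs by trivial. split; [|split; [|split]].
    - rewrite In_reps5. repeat split; lia.
    - replace (y - 2 * t)%Z with (y + t + 3 * - t)%Z by ring.
      rewrite flip5_abs by lia. f_equal; f_equal; ring.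
    - intros [E1 E2]%pair_equal_spec. exists (Z.abs_nat y). rewrite odd_abs. split; trivial.
      (* The two kinds of fixed points are x = y, where n = 6 y^2, and x = - 5 y, where n = 30
         y^2. *)
      assert (t = 0 \/ t = -2 * y)%Z as [-> | ->] by lia; [left|right]; split; try lia;
        f_equal; lia.
    - intros (m & _ & [[_ [E1 E2]%pair_equal_spec]|[_ [E1 E2]%pair_equal_spec]]); f_equal; lia. }
  destruct (sextic_theta n) eqn:E.
  - apply sextic_thetaP in E. destruct E as (m & Hm & E).
    assert (Hm3 : m mod 3 <> 0).
    { intro E3. apply Hn. replace m with (3 * (m / 3)) in E by lia. lia. }
    assert (Huniq : forall m', 6 * m' * m' = n -> 6 * m * m = n -> m' = m).
    { intros m' E1 E2. rewrite <- E2 in E1. apply mul_sqr_inj in E1; lia. }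
    assert (Huniq' : forall m', 30 * m' * m' = n -> 30 * m * m = n -> m' = m).
    { intros m' E1 E2. rewrite <- E2 in E1. apply mul_sqr_inj in E1; lia. }
    assert (Hexcl : forall a b, Nat.odd a = true -> Nat.odd b = true ->
                6 * a * a = n -> 30 * b * b = n -> False).
    { intros a b Ha Hb E1 E2. apply (square_ne_5_square a b); trivial. lia. }
    rewrite <- (Zabs2Nat.id m), odd_abs in Hm.
    destruct E as [E|E].
    + apply (involution_odd _ flip5 _ (m, m)); [apply NoDup_form_reps| |].
      * rewrite <- (Zabs2Nat.id m), In_reps5. lia.
      * intros q Hq. destruct (Hstep q Hq) as (H1 & H2 & H3). rewrite H3.
        rewrite <- odd_abs, Zabs2Nat.id in Hm.
        split; [|split; [|split]]; trivial.
        -- intros (m' & Hm' & [[E' ->]|[E' _]]); [rewrite (Huniq m'); trivial|].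
           exfalso. eapply Hexcl; [exact Hm|exact Hm'| |]; trivial.
        -- intros ->. exists m. auto.
    + apply (involution_odd _ flip5 _ (5 * m, m)); [apply NoDup_form_reps| |].
      * replace (5 * m) with (Z.abs_nat (5 * Z.of_nat m)) by lia.
        rewrite <- (Zabs2Nat.id m) at 2. rewrite In_reps5. lia.
      * intros q Hq. destruct (Hstep q Hq) as (H1 & H2 & H3). rewrite H3.
        rewrite <- odd_abs, Zabs2Nat.id in Hm.
        split; [|split; [|split]]; trivial.
        -- intros (m' & Hm' & [[E' _]|[E' ->]]); [|rewrite (Huniq' m'); trivial].
           exfalso. eapply Hexcl; [exact Hm'|exact Hm| |]; trivial.
        -- intros ->. exists m. auto.
  - apply (involution_even _ flip5); [apply NoDup_form_reps|].
    intros q Hq. destruct (Hstep q Hq) as (H1 & H2 & H3). split; [|split]; trivial.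
    rewrite H3. intros (m & Hm & Hm').
    assert (Ht : sextic_theta n = true) by (apply sextic_thetaP; exists m; tauto).
    congruence.
Qed.

(* When 9 divides n, the representations of n are those of n/9 multiplied by an element
   of norm 9; [(u, v)] below is the quotient. *)
Definition lift5 (q : nat * nat) : nat * nat :=
  let u := Z.of_nat (fst q) in let v := Z.of_nat (snd q) in
  if ((u + v) mod 3 =? 0)%Z
  then (Z.abs_nat (5 * v - 2 * u), Z.abs_nat (u + 2 * v))
  else (Z.abs_nat (5 * v + 2 * u), Z.abs_nat (u - 2 * v)).

(** The passage to the quotient, inverse to [lift5]; the congruence decides which of 2 + sqrt(-5)
    and its conjugate to divide by. *)
Definition drop5 (q : nat * nat) : nat * nat :=
  let x := Z.of_nat (fst q) in let y := Z.of_nat (snd q) in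
  if ((x - y) mod 3 =? 0)%Z
  then (Z.abs_nat ((5 * y - 2 * x) / 9), Z.abs_nat ((x + 2 * y) / 9))
  else (Z.abs_nat ((5 * y + 2 * x) / 9), Z.abs_nat ((x - 2 * y) / 9)).

(** On the quotient this is v -> - v: up to signs, the multiplier 2 + sqrt(-5) of norm 9 is
    exchanged with its conjugate. *)
Definition conj5 (q : nat * nat) : nat * nat :=
  let x := Z.of_nat (fst q) in let y := Z.of_nat (snd q) in
  if ((x - y) mod 3 =? 0)%Z
  then let u := ((5 * y - 2 * x) / 9)%Z in let v := ((x + 2 * y) / 9)%Z in
       (Z.abs_nat (5 * v + 2 * u), Z.abs_nat (u - 2 * v))
  else let u := ((5 * y + 2 * x) / 9)%Z in let v := ((x - 2 * y) / 9)%Z in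
       (Z.abs_nat (5 * v - 2 * u), Z.abs_nat (u + 2 * v)).

Lemma lift5_abs u v : (v mod 3 <> 0 -> (u + v) mod 3 = 0 ->
  lift5 (Z.abs_nat u, Z.abs_nat v) = (Z.abs_nat (5 * v - 2 * u), Z.abs_nat (u + 2 * v)))%Z.
Proof.
  intros Hv Huv. unfold lift5. cbn [fst snd]. rewrite !Zabs2Nat.id_abs.
  destruct (Z.eqb_spec ((Z.abs u + Z.abs v) mod 3) 0) as [E|E]; f_equal; lia.
Qed.

Lemma drop5_abs u v : ((u - v) mod 3 <> 0)%Z ->
  drop5 (Z.abs_nat (5 * v - 2 * u), Z.abs_nat (u + 2 * v)) = (Z.abs_nat u, Z.abs_nat v).
Proof.
  intros Huv. unfold drop5. cbn [fst snd]. rewrite !Zabs2Nat.id_abs.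
  destruct (Z.eqb_spec ((Z.abs (5 * v - 2 * u) - Z.abs (u + 2 * v)) mod 3) 0) as [E|E];
    f_equal; lia.
Qed.

Lemma Zdiv_9 a q : (a = 9 * q -> a / 9 = q)%Z.
Proof. intros ->. rewrite Z.mul_comm. apply Z.div_mul. lia. Qed.

Lemma conj5_abs u v : ((u - v) mod 3 <> 0)%Z ->
  conj5 (Z.abs_nat (5 * v - 2 * u), Z.abs_nat (u + 2 * v)) =
  (Z.abs_nat (5 * v + 2 * u), Z.abs_nat (u - 2 * v)).
Proof.
  intros Huv. unfold conj5. cbn [fst snd]. rewrite !Zabs2Nat.id_abs.
  destruct (Z.abs_eq_or_opp (5 * v - 2 * u)) as [-> | ->],
    (Z.abs_eq_or_opp (u + 2 * v)) as [-> | ->];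
    match goal with |- context [(?a =? 0)%Z] => destruct (Z.eqb_spec a 0) as [E|E] end;
    try (exfalso; lia); clear.
  - rewrite (Zdiv_9 _ v), (Zdiv_9 _ u) by ring. trivial.
  - rewrite (Zdiv_9 _ v), (Zdiv_9 _ (- u)) by ring. f_equal; lia.
  - rewrite (Zdiv_9 _ (- v)), (Zdiv_9 _ u) by ring. f_equal; lia.
  - rewrite (Zdiv_9 _ (- v)), (Zdiv_9 _ (- u)) by ring. f_equal; lia.
Qed.

(** With x = y + 3 t the equation gives 3 | y (y + t), hence y + t = 3 w because y is prime to 3;
    then u = y - 2 w and v = w. Primality of the coordinates to 3 amounts to u - v being prime to 3;
    u or v alone may well be divisible by 3. *)
Lemma reps5_nine n a b : In (a, b) (reps5 (9 * n)) ->
  exists u v : Z, a = Z.abs_nat (5 * v - 2 * u) /\ b = Z.abs_nat (u + 2 * v) /\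
  (u mod 2 = 1 /\ v mod 2 = 1 /\ (u - v) mod 3 <> 0 /\ u * u + 5 * (v * v) = Z.of_nat n)%Z.
Proof.
  intros Hab. destruct (reps5_signs _ a b Hab) as (y & t & -> & ->).
  rewrite In_reps5 in Hab. destruct Hab as (H1 & H2 & H3 & H4 & H5).
  rewrite Nat2Z.inj_mul in H5.
  assert (H6 : ((y + t) mod 3 = 0)%Z).
  { assert (H6 : (3 | y * (y + t))%Z).
    { exists (y * (y + t) - Z.of_nat n + t * t)%Z. clear - H5. lia. }
    apply prime_mult in H6; [|apply prime_3].
    destruct H6 as [H6|H6]; apply Z.mod_divide in H6; lia. }
  set (w := ((y + t) / 3)%Z). assert (Ht : t = (3 * w - y)%Z) by (unfold w; lia).
  clearbody w. subst t.
  exists (y - 2 * w)%Z, w. repeat split; try lia; f_equal; lia.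
Qed.

Lemma reps5_nine_intro n (u v : Z) :
  ((u - v) mod 3 <> 0)%Z -> (u mod 2 = 1)%Z -> (v mod 2 = 1)%Z ->
  (u * u + 5 * (v * v) = Z.of_nat n)%Z ->
  In (Z.abs_nat (5 * v - 2 * u), Z.abs_nat (u + 2 * v)) (reps5 (9 * n)).
Proof.
  intros H1 H2 H3 H4. rewrite In_reps5, Nat2Z.inj_mul, <- H4. repeat split; try lia.
Qed.

(** As u^2 + 5 v^2 is congruent to (u + v)(u - v) modulo 3, both u - v and u + v are prime to 3, so
    that either multiplier yields an admissible representation. A fixed point of the exchange would
    force u v = 0, but u and v are odd. *)
Lemma reps5_parity_three n : n mod 3 <> 0 -> Nat.odd (length (reps5 (9 * n))) = false.
Proof.
  intro Hn. apply (involution_even _ conj5); [apply NoDup_form_reps|].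
  intros [a b] Hab. destruct (reps5_nine n a b Hab) as (u & v & -> & -> & H1 & H2 & H3 & H4).
  assert (H5 : ((u + v) mod 3 <> 0)%Z).
  { intro E. apply Hn. apply Nat2Z.inj. rewrite Nat2Z.inj_mod, <- H4.
    replace v with (3 * ((u + v) / 3) - u)%Z by lia. set (w := ((u + v) / 3)%Z).
    replace (_ + _)%Z with (0 + (2 * (u * u) - 10 * (w * u) + 15 * (w * w)) * 3)%Z by ring.
    rewrite Z_mod_plus_full. reflexivity. }
  assert (E1 : Z.abs_nat (5 * v + 2 * u) = Z.abs_nat (5 * - v - 2 * u)) by lia.
  assert (E2 : Z.abs_nat (u - 2 * v) = Z.abs_nat (u + 2 * - v)) by lia.
  rewrite conj5_abs by trivial. split; [|split].
  - rewrite E1, E2. apply reps5_nine_intro; lia.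
  - rewrite E1, E2, conj5_abs by lia. f_equal; lia.
  - intros [E3 E4]%pair_equal_spec. lia.
Qed.

(** Now 3 divides (u + v)(u - v) but not u - v, so u + v is divisible by 3 and u, v are prime to 3:
    the quotient is itself a representation of the restricted kind. Conversely the sign of v can be
    chosen so that 3 divides u + v, and [lift5] is a bijection. *)
Lemma reps5_descent n : n mod 3 = 0 -> length (reps5 n) = length (reps5 (9 * n)).
Proof.
  intro Hn.
  assert (Hdiv : forall u v : Z, (u * u + 5 * (v * v) = Z.of_nat n ->
             (u + v) mod 3 = 0 \/ (u - v) mod 3 = 0)%Z).
  { intros u v E. assert (H : (3 | (u + v) * (u - v))%Z).
    { exists (Z.of_nat (n / 3) - 2 * (v * v))%Z.
      replace n with (3 * (n / 3)) in E by lia. rewrite Nat2Z.inj_mul in E. clear - E. lia. }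
    apply prime_mult in H; [|apply prime_3].
    destruct H as [H|H]; apply Z.mod_divide in H; auto; lia. }
  assert (Hsign : forall a b, In (a, b) (reps5 n) -> exists u v,
    a = Z.abs_nat u /\ b = Z.abs_nat v /\ (u mod 2 = 1 /\ v mod 2 = 1 /\
      v mod 3 <> 0 /\ (u + v) mod 3 = 0 /\ u * u + 5 * (v * v) = Z.of_nat n)%Z).
  { intros a b Hab. rewrite <- (Zabs2Nat.id a), <- (Zabs2Nat.id b), In_reps5 in Hab.
    destruct Hab as (H1 & H2 & H3 & H4 & H5). destruct (Hdiv _ _ H5) as [H6|H6].
    - exists (Z.of_nat a), (Z.of_nat b). repeat split; trivial; lia.
    - exists (Z.of_nat a), (- Z.of_nat b)%Z. repeat split; trivial; lia. }
  apply (card_bij _ _ lift5); try apply NoDup_form_reps.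
  - intros [a b] Hab. destruct (Hsign a b Hab) as (u & v & -> & -> & H1 & H2 & H3 & H4 & H5).
    rewrite lift5_abs by trivial. apply reps5_nine_intro; trivial. lia.
  - assert (Hinv : forall q, In q (reps5 n) -> drop5 (lift5 q) = q).
    { intros [a b] Hab. destruct (Hsign a b Hab) as (u & v & -> & -> & H1 & H2 & H3 & H4 & H5).
      rewrite lift5_abs, drop5_abs by (trivial; lia). trivial. }
    intros q q' Hq Hq' E. rewrite <- (Hinv q), <- (Hinv q'), E; trivial.
  - intros [a b] Hab. destruct (reps5_nine n a b Hab) as (u & v & -> & -> & H1 & H2 & H3 & H4).
    destruct (Hdiv u v H4) as [H5|H5]; [|contradiction].
    exists (Z.abs_nat u, Z.abs_nat v). rewrite lift5_abs by lia. split; trivial.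
    rewrite In_reps5. repeat split; lia.
Qed.

(** If 9 n is 6 m^2 or 30 m^2, then 3 divides m. *)
Lemma sextic_theta_nine n : sextic_theta (9 * n) = sextic_theta n.
Proof.
  apply eq_true_iff_eq. rewrite !sextic_thetaP. split.
  - intros (m & Hm & E).
    assert (Hm3 : m mod 3 = 0).
    { assert (H : (3 | Z.of_nat m * Z.of_nat m)%Z).
      { destruct E as [E|E].
        - exists (Z.of_nat m * Z.of_nat m - Z.of_nat n)%Z. lia.
        - exists (Z.of_nat n - 3 * (Z.of_nat m * Z.of_nat m))%Z. lia. }
      apply prime_mult in H; [|apply prime_3].
      destruct H as [H|H]; apply Z.mod_divide in H; lia. }
    exists (m / 3). replace m with (3 * (m / 3)) in Hm, E by lia.
    rewrite Nat.odd_mul in Hm. split; [exact Hm|]. destruct E as [E|E]; [left|right]; lia.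
  - intros (m & Hm & E). exists (3 * m). rewrite Nat.odd_mul, Hm. split; trivial.
    destruct E as [E|E]; [left|right]; lia.
Qed.

(** Infinite descent by the factor 9. For n = 9 m with m prime to 3 both sides vanish, since 6 k^2
    and 30 k^2 are divisible by 3. *)
Lemma reps5_parity n : Nat.odd (length (reps5 n)) = sextic_theta n.
Proof.
  induction n as [n IH] using lt_wf_ind.
  destruct (Nat.eq_dec (n mod 9) 0) as [H9|H9]; [|apply reps5_parity_base; trivial].
  destruct (Nat.eq_dec n 0) as [->|Hn]; [reflexivity|].
  replace n with (9 * (n / 9)) by lia. set (m := n / 9) in *.
  rewrite sextic_theta_nine. assert (Hmn : m < n) by lia.
  destruct (Nat.eq_dec (m mod 3) 0) as [H3|H3].
  - rewrite <- reps5_descent by trivial. apply IH. trivial.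
  - rewrite reps5_parity_three by trivial. symmetry. apply not_true_is_false.
    rewrite sextic_thetaP. intros (k & _ & [E|E]); apply H3; rewrite <- E; lia.
Qed.

Lemma theta_quintic :
  ps_add (dilate 6 Fser) (dilate 30 Fser) =
  ps_mul (theta coprime6 1) (dilate 5 (theta coprime6 1)).
Proof.
  rewrite Fser_theta, !theta_dilate by lia.
  apply functional_extensionality; intro n.
  rewrite theta_mul by lia. symmetry. apply reps5_parity.
Qed.

(** By Frobenius P^4 = P(X^4), which is P F(X^3) by [theta_quartic] and [theta_quintic]-free
    algebra; cancel one factor P. *)
Lemma theta_coprime6_cube :
  ps_pow (theta coprime6 1) 3 = dilate 3 Fser.
Proof.
  set (P := theta coprime6 1).
  assert (H : ps_mul P (ps_add (ps_pow P 3) (dilate 3 Fser)) = ps_zero).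
  { transitivity (ps_add (ps_mul (ps_mul P P) (ps_mul P P)) (ps_mul P (dilate 3 Fser))); [ring|].
    rewrite Fser_theta, !ps_sqr, dilate_dilate by lia. unfold P.
    rewrite !theta_dilate by lia. simpl Nat.mul. rewrite <- theta_quartic. ring. }
  apply ps_mul_eq_zero in H; [|reflexivity|reflexivity].
  transitivity (ps_add (ps_add (ps_pow P 3) (dilate 3 Fser)) (dilate 3 Fser)); [ring|].
  rewrite H. ring.
Qed.

(** Compared after X -> X^3, because P^3 is a series in X^3. The cube of (F + G)(X^6) is the sixth
    power of (F + G)(X^3) by Frobenius, and the cube of P(X) P(X^5) is F(X^3) G(X^3). *)
Lemma FG_sextic : ps_pow (ps_add Fser Gser) 6 = ps_mul Fser Gser.
Proof.
  apply (dilate_inj 3); [lia|].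
  set (P := theta coprime6 1).
  transitivity (ps_pow (ps_mul P (dilate 5 P)) 3).
  - unfold P. rewrite <- theta_quintic.
    change 6 with (3 * 2) at 2. change 30 with (3 * (2 * 5)).
    rewrite <- !dilate_dilate by lia. rewrite <- dilate_add, <- dilate_add, <- Gser_dilate, <- ps_sqr.
    set (t := ps_add Fser Gser).
    transitivity (dilate 3 (ps_mul (ps_mul t t) (ps_mul (ps_mul t t) (ps_mul t t)))).
    + f_equal. ring.
    + rewrite (dilate_mul 3 (ps_mul t t)), (dilate_mul 3 (ps_mul t t) (ps_mul t t)) by lia. ring.
  - transitivity (ps_mul (ps_pow P 3) (ps_mul (dilate 5 P) (ps_mul (dilate 5 P) (dilate 5 P)))); [ring|].
    rewrite <- !dilate_mul by lia.
    replace (ps_mul P (ps_mul P P)) with (ps_pow P 3) by ring.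
    unfold P. rewrite theta_coprime6_cube, dilate_mul, dilate_dilate, Gser_dilate, dilate_dilate by lia.
    reflexivity.
Qed.

(** With S_c the sum of X^(c m^2) over m > 0, r = S_1 + S_2 + S_5 + S_10 and r^2 = S_2 + S_4 + S_10
    + S_20. The sum telescopes to (S_1 + S_4) + (S_5 + S_20), where S_1 + S_4 = F because adding S_4
    removes the even squares. *)
Lemma rser_artin_schreier : ps_add (ps_mul rser rser) rser = ps_add Fser Gser.
Proof.
  set (pos := Nat.ltb 0).
  assert (HF : Fser = ps_add (theta pos 1) (theta pos 4)).
  { rewrite Fser_theta. apply functional_extensionality; intro n. unfold ps_add.
    assert (H1 := thetaP Nat.odd 1 n ltac:(lia)). assert (H2 := thetaP pos 1 n ltac:(lia)).
    assert (H3 := thetaP pos 4 n ltac:(lia)). unfold pos in *. setoid_rewrite Nat.ltb_lt in H2.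
    setoid_rewrite Nat.ltb_lt in H3.
    destruct (theta Nat.odd 1 n) eqn:E1; destruct (theta (Nat.ltb 0) 1 n) eqn:E2;
      destruct (theta (Nat.ltb 0) 4 n) eqn:E3; trivial; exfalso.
    - destruct H1 as [H1 _], H3 as [H3 _].
      destruct (H1 eq_refl) as (m & Hm & Em), (H3 eq_refl) as (k & Hk & Ek).
      replace (4 * k * k) with (1 * (2 * k) * (2 * k)) in Ek by ring. rewrite <- Ek in Em.
      apply mul_sqr_inj in Em; [|lia]. subst. rewrite Nat.odd_mul in Hm. discriminate.
    - destruct H1 as [H1 _]. destruct (H1 eq_refl) as (m & Hm & Em).
      assert (false = true) by (apply H2; exists m; destruct m; [discriminate|lia]). discriminate.
    - destruct H2 as [H2 _]. destruct (H2 eq_refl) as (m & Hm & Em).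
      destruct (Nat.Even_or_Odd m) as [[k ->]|Ho].
      + assert (false = true) by (apply H3; exists k; lia). discriminate.
      + assert (false = true) by (apply H1; exists m; rewrite Nat.odd_spec; auto). discriminate.
    - destruct H3 as [H3 _]. destruct (H3 eq_refl) as (m & Hm & Em).
      assert (false = true) by (apply H2; exists (2 * m); lia). discriminate. }
  assert (Hr : rser = ps_add (ps_add (theta pos 1) (theta pos 2)) (ps_add (theta pos 5) (theta pos 10)))
    by reflexivity.
  clearbody pos.
  rewrite ps_sqr, Hr, !dilate_add, Gser_dilate, HF, !dilate_add, !theta_dilate by lia.
  simpl Nat.mul. ring.
Qed.

(** In characteristic 2, r^4 + (r + 1)^4 = 1, so that [A] and [B] have sum r^2 + r and product (r^2
    + r)^6. Hence (G + B)(G + A) = 0; since G begins with X^5 and B with X, the factor G + B can be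
    cancelled. *)
Lemma Gser_factor : Gser = ps_mul (ps_pow rser 5) (ps_add rser ps_one).
Proof.
  set (A := ps_mul (ps_pow rser 5) (ps_add rser ps_one)).
  set (B := ps_mul rser (ps_pow (ps_add rser ps_one) 5)).
  assert (HF : Fser = ps_add (ps_add (ps_mul rser rser) rser) Gser).
  { rewrite rser_artin_schreier. ring. }
  assert (H : ps_mul (ps_add Gser B) (ps_add Gser A) = ps_zero).
  { assert (H6 := FG_sextic). rewrite <- rser_artin_schreier, HF in H6.
    transitivity (ps_add (ps_pow (ps_add (ps_mul rser rser) rser) 6)
      (ps_mul (ps_add (ps_add (ps_mul rser rser) rser) Gser) Gser)).
    - assert (Hz : forall f, ps_add f f = ps_zero) by (intro; ring). unfold A, B. ring.
    - rewrite H6. ring. }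
  apply ps_mul_eq_zero in H; [|reflexivity|reflexivity].
  transitivity (ps_add (ps_add Gser A) A); [ring|]. rewrite H. ring.
Qed.

Lemma Fser_factor : Fser = ps_mul rser (ps_pow (ps_add rser ps_one) 5).
Proof.
  transitivity (ps_add (ps_add (ps_mul rser rser) rser) Gser).
  { rewrite rser_artin_schreier. ring. }
  rewrite Gser_factor. ring.
Qed.

(** * Complex series *)

Local Close Scope nat_scope.
Local Open Scope R_scope.

Lemma sum_n_nonneg_incr (a : nat -> R) n :
  (forall k, 0 <= a k) -> sum_n a n <= sum_n a (S n).
Proof. intro Ha. rewrite sum_Sn. unfold plus; simpl. specialize (Ha (S n)). lra. Qed.

Lemma ex_series_bounded (a : nat -> R) B :
  (forall k, 0 <= a k) -> (forall n, sum_n a n <= B) -> ex_series a /\ Series a <= B.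
Proof.
  intros Ha HB.
  assert (H : ex_finite_lim_seq (sum_n a)).
  { apply ex_finite_lim_seq_incr with B; auto using sum_n_nonneg_incr. }
  destruct H as [l Hl].
  assert (Hs : is_series a l) by exact Hl.
  split; [exists l; exact Hs|].
  rewrite (is_series_unique _ _ Hs).
  apply (is_lim_seq_le (sum_n a) (fun _ => B) l B); trivial. apply is_lim_seq_const.
Qed.

Lemma Series_ge_term (a : nat -> R) n :
  (forall k, 0 <= a k) -> ex_series a -> sum_n a n <= Series a.
Proof.
  intros Ha [l Hl]. rewrite (is_series_unique _ _ Hl).
  apply (is_lim_seq_incr_compare (sum_n a)); trivial.
  intro k. apply sum_n_nonneg_incr; trivial.
Qed.

Lemma sum_n_ge_last (a : nat -> R) n : (forall k, 0 <= a k) -> a n <= sum_n a n.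
Proof.
  intro Ha. destruct n as [|n].
  - rewrite sum_O. lra.
  - rewrite sum_Sn. unfold plus; simpl.
    assert (0 <= sum_n a n); [|lra].
    clear -Ha. induction n as [|n IH]; [rewrite sum_O; trivial|].
    eapply Rle_trans; [exact IH|apply sum_n_nonneg_incr; trivial].
Qed.

Lemma Series_nonneg (a : nat -> R) : (forall k, 0 <= a k) -> ex_series a -> 0 <= Series a.
Proof.
  intros Ha Hex. apply Rle_trans with (2 := Series_ge_term a 0 Ha Hex). rewrite sum_O. trivial.
Qed.

Lemma ex_series_ge0_le (a b : nat -> R) :
  (forall n, 0 <= a n <= b n) -> ex_series b -> ex_series a.
Proof.
  intros H. apply (@ex_series_le R_AbsRing R_CompleteNormedModule).
  intro n. unfold norm; simpl. unfold abs; simpl.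
  rewrite Rabs_pos_eq; apply H.
Qed.

Lemma Series_sum_n (u : nat -> nat -> R) N :
  (forall j, ex_series (fun i => u i j)) ->
  is_series (fun i => sum_n (u i) N) (sum_n (fun j => Series (fun i => u i j)) N).
Proof.
  intro H. induction N as [|N IH].
  - rewrite sum_O. apply is_series_ext with (fun i => u i O).
    + intro i. rewrite sum_O. trivial.
    + apply Series_correct, H.
  - rewrite sum_Sn. apply is_series_ext with (fun i => plus (sum_n (u i) N) (u i (S N))).
    + intro i. rewrite sum_Sn. trivial.
    + apply (@is_series_plus R_AbsRing R_NormedModule); trivial. apply Series_correct, H.
Qed.

(** Finitely many columns can be summed inside the sum over the rows, which bounds every partial
    sum. Only an inequality results; equality follows by applying this to the transposed matrix as
    well. *)
Lemma tonelli_le (u : nat -> nat -> R) :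
  (forall i j, 0 <= u i j) -> (forall i, ex_series (u i)) -> ex_series (fun i => Series (u i)) ->
  (forall j, ex_series (fun i => u i j)) /\
  ex_series (fun j => Series (fun i => u i j)) /\
  Series (fun j => Series (fun i => u i j)) <= Series (fun i => Series (u i)).
Proof.
  intros H0 H1 H2.
  assert (Hc : forall j, ex_series (fun i => u i j)).
  { intro j. apply ex_series_ge0_le with (fun i => Series (u i)); trivial.
    intro i. split; trivial. eapply Rle_trans; [|apply (Series_ge_term _ j); auto].
    apply (sum_n_ge_last (u i)); auto. }
  split; trivial.
  apply ex_series_bounded.
  - intro j. apply Series_nonneg; auto.
  - intro N. rewrite <- (is_series_unique _ _ (Series_sum_n u N Hc)).
    apply Series_le; trivial. intro i. split.
    + eapply Rle_trans; [|apply sum_n_ge_last; auto]. trivial.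
    + apply Series_ge_term; auto.
Qed.

Lemma tonelli (u : nat -> nat -> R) :
  (forall i j, 0 <= u i j) -> (forall i, ex_series (u i)) -> ex_series (fun i => Series (u i)) ->
  Series (fun j => Series (fun i => u i j)) = Series (fun i => Series (u i)).
Proof.
  intros H0 H1 H2. destruct (tonelli_le u H0 H1 H2) as (H3 & H4 & H5).
  apply Rle_antisym; trivial.
  apply (tonelli_le (fun j i => u i j)); auto.
Qed.

(** Reduction to nonnegative terms by splitting [u] into positive and negative parts. *)
Lemma fubini_R (u : nat -> nat -> R) :
  (forall i, ex_series (fun j => Rabs (u i j))) ->
  ex_series (fun i => Series (fun j => Rabs (u i j))) ->
  Series (fun j => Series (fun i => u i j)) = Series (fun i => Series (u i)).
Proof.
  intros H1 H2.
  set (p := fun i j => Rmax (u i j) 0). set (m := fun i j => Rmax (- u i j) 0).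
  assert (Hp : forall i j, 0 <= p i j <= Rabs (u i j)).
  { intros i j. unfold p, Rmax. destruct (Rle_dec _ _); unfold Rabs; destruct (Rcase_abs _); lra. }
  assert (Hm : forall i j, 0 <= m i j <= Rabs (u i j)).
  { intros i j. unfold m, Rmax. destruct (Rle_dec _ _); unfold Rabs; destruct (Rcase_abs _); lra. }
  assert (Hu : forall i j, u i j = p i j - m i j).
  { intros i j. unfold p, m, Rmax. destruct (Rle_dec _ _), (Rle_dec _ _); lra. }
  assert (Hdom : forall v : nat -> nat -> R, (forall i j, 0 <= v i j <= Rabs (u i j)) ->
     (forall i, ex_series (v i)) /\ ex_series (fun i => Series (v i))).
  { intros v Hv. split.
    - intro i. apply ex_series_ge0_le with (2 := H1 i). auto.
    - apply ex_series_ge0_le with (2 := H2). intro i. split.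
      + apply Series_nonneg; [apply Hv|]. apply ex_series_ge0_le with (2 := H1 i). auto.
      + apply Series_le; auto. }
  destruct (Hdom p Hp) as [Hp1 Hp2], (Hdom m Hm) as [Hm1 Hm2].
  destruct (tonelli_le p) as (Hp3 & Hp4 & _); auto; try apply Hp.
  destruct (tonelli_le m) as (Hm3 & Hm4 & _); auto; try apply Hm.
  transitivity (Series (fun j => Series (fun i => p i j) - Series (fun i => m i j))).
  - apply Series_ext. intro j. rewrite <- Series_minus by auto. apply Series_ext. intro; apply Hu.
  - rewrite Series_minus by auto.
    rewrite (tonelli p), (tonelli m); auto; try apply Hp; try apply Hm.
    rewrite <- Series_minus by auto. apply Series_ext. intro i.
    rewrite <- Series_minus by auto. apply Series_ext. intro j. rewrite Hu. trivial.
Qed.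

Local Notation is_Cseries := (@is_series C_AbsRing C_NormedModule).

(** A total function, so that sums can be rewritten without carrying convergence proofs; its value
    is meaningful for absolutely convergent series, the ones described by [summable]. *)
Definition Csum (a : nat -> C) : C :=
  (Series (fun n => Re (a n)), Series (fun n => Im (a n))).

Definition summable (a : nat -> C) : Prop := ex_series (fun n => Cmod (a n)).

Lemma Cmod_le_Re_Im (z : C) : Cmod z <= Rabs (Re z) + Rabs (Im z).
Proof.
  replace z with (Cplus (RtoC (Re z)) (Cmult (RtoC (Im z)) Ci)) at 1.
  - eapply Rle_trans; [apply Cmod_triangle|].
    rewrite Cmod_mult, !Cmod_R, Cmod_Ci. lra.
  - destruct z as [x y]. apply injective_projections; simpl; ring.
Qed.

Lemma Im_le_Cmod (z : C) : Rabs (Im z) <= Cmod z.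
Proof. apply Rle_trans with (2 := Rmax_Cmod z). apply Rmax_r. Qed.

Lemma summable_Re a : summable a -> ex_series (fun n => Rabs (Re (a n))).
Proof.
  intro H. apply ex_series_ge0_le with (2 := H).
  intro n. split; [apply Rabs_pos|apply re_le_Cmod].
Qed.

Lemma summable_Im a : summable a -> ex_series (fun n => Rabs (Im (a n))).
Proof.
  intro H. apply ex_series_ge0_le with (2 := H).
  intro n. split; [apply Rabs_pos|apply Im_le_Cmod].
Qed.

Lemma Re_sum_n (a : nat -> C) n : Re (sum_n a n) = sum_n (fun k => Re (a k)) n.
Proof. induction n as [|n IH]; [rewrite !sum_O|rewrite !sum_Sn, <- IH]; reflexivity. Qed.

Lemma Im_sum_n (a : nat -> C) n : Im (sum_n a n) = sum_n (fun k => Im (a k)) n.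
Proof. induction n as [|n IH]; [rewrite !sum_O|rewrite !sum_Sn, <- IH]; reflexivity. Qed.

Lemma is_Cseries_Csum a : summable a -> is_Cseries a (Csum a).
Proof.
  intro H.
  assert (HR := Series_correct _ (ex_series_Rabs _ (summable_Re a H))).
  assert (HI := Series_correct _ (ex_series_Rabs _ (summable_Im a H))).
  apply filterlim_locally. intro eps.
  assert (HR' := proj1 (filterlim_locally _ _) HR eps).
  assert (HI' := proj1 (filterlim_locally _ _) HI eps).
  destruct HR' as [N1 H1], HI' as [N2 H2].
  exists (max N1 N2). intros n Hn.
  specialize (H1 n ltac:(lia)). specialize (H2 n ltac:(lia)).
  split.
  - change (ball (Re (Csum a)) eps (Re (sum_n a n))). rewrite Re_sum_n. exact H1.
  - change (ball (Im (Csum a)) eps (Im (sum_n a n))). rewrite Im_sum_n. exact H2.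
Qed.

Lemma Csum_ext a b : (forall n, a n = b n) -> Csum a = Csum b.
Proof. intro H. unfold Csum. f_equal; apply Series_ext; intro n; rewrite H; trivial. Qed.

Lemma summable_ext a b : (forall n, a n = b n) -> summable a -> summable b.
Proof. intro H. apply ex_series_ext. intro n. rewrite H. trivial. Qed.

Lemma summable_le a b : (forall n, Cmod (a n) <= b n) -> ex_series b -> summable a.
Proof. intros H. apply ex_series_ge0_le. intro n. split; [apply Cmod_ge_0|trivial]. Qed.

Lemma ex_series_scal_R (c : R) a : ex_series a -> ex_series (fun n => c * a n).
Proof. apply (@ex_series_scal R_AbsRing R_NormedModule c a). Qed.

Lemma summable_scal c a : summable a -> summable (fun n => Cmult c (a n)).
Proof.
  intro H. apply ex_series_ext with (fun n => Cmod c * Cmod (a n)).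
  - intro n. symmetry; apply Cmod_mult.
  - apply ex_series_scal_R, H.
Qed.

Lemma summable_plus a b : summable a -> summable b -> summable (fun n => Cplus (a n) (b n)).
Proof.
  intros Ha Hb. apply summable_le with (fun n => Cmod (a n) + Cmod (b n)).
  - intro; apply Cmod_triangle.
  - apply (@ex_series_plus R_AbsRing R_NormedModule); trivial.
Qed.

Lemma Csum_plus a b : summable a -> summable b ->
  Csum (fun n => Cplus (a n) (b n)) = Cplus (Csum a) (Csum b).
Proof.
  intros Ha Hb. unfold Csum, Cplus; simpl. f_equal; apply Series_plus;
    apply ex_series_Rabs; auto using summable_Re, summable_Im.
Qed.

Lemma Csum_scal c a : summable a -> Csum (fun n => Cmult c (a n)) = Cmult c (Csum a).
Proof.
  intros Ha. unfold Csum. apply injective_projections; simpl.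
  - rewrite <- !Series_scal_l, <- Series_minus; trivial;
      apply ex_series_scal_R, ex_series_Rabs; auto using summable_Re, summable_Im.
  - rewrite <- !Series_scal_l, <- Series_plus; trivial;
      apply ex_series_scal_R, ex_series_Rabs; auto using summable_Re, summable_Im.
Qed.

Lemma summable_S a : summable a -> summable (fun n => a (S n)).
Proof. intro H. apply (ex_series_incr_1 (fun n => Cmod (a n))). exact H. Qed.

Lemma Csum_incr_1 a : summable a -> Csum a = Cplus (a O) (Csum (fun n => a (S n))).
Proof.
  intro H. unfold Csum, Cplus; simpl.
  f_equal; apply (Series_incr_1 (fun n => _ (a n))), ex_series_Rabs;
    auto using summable_Re, summable_Im.
Qed.

Lemma sum_n_C_S (a : nat -> C) n : sum_n a (S n) = Cplus (sum_n a n) (a (S n)).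
Proof. exact (sum_Sn a n). Qed.

Lemma Cmod_sum_n (a : nat -> C) n : Cmod (sum_n a n) <= sum_n (fun k => Cmod (a k)) n.
Proof.
  induction n as [|n IH]; [rewrite !sum_O; lra|]. rewrite !sum_Sn.
  eapply Rle_trans; [apply Cmod_triangle|]. apply Rplus_le_compat_r. exact IH.
Qed.

Lemma Cmod_Csum_le a : summable a -> Cmod (Csum a) <= Series (fun n => Cmod (a n)).
Proof.
  intro H. apply Rnot_lt_le. intro Hlt.
  set (d := Cmod (Csum a) - Series (fun n => Cmod (a n))).
  assert (Hd : 0 < d / 2) by (unfold d; lra).
  assert (Hs := proj1 (filterlim_locally_ball_norm _ _) (is_Cseries_Csum a H) (mkposreal _ Hd)).
  destruct Hs as [N HN]. specialize (HN N (le_n N)).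
  change (Cmod (minus (sum_n a N) (Csum a)) < d / 2) in HN.
  assert (H1 := Cmod_sum_n a N).
  assert (H2 := Series_ge_term _ N (fun k => Cmod_ge_0 (a k)) H).
  assert (H3 : Cmod (Csum a) <= Cmod (sum_n a N) + Cmod (minus (sum_n a N) (Csum a))).
  { rewrite <- (Cmod_opp (minus _ _)).
    eapply Rle_trans; [|apply Cmod_triangle]. right. f_equal.
    unfold minus, plus, opp; simpl. ring. }
  unfold d in HN. lra.
Qed.

Lemma Csum_bound a b : (forall n, Cmod (a n) <= b n) -> ex_series b -> Cmod (Csum a) <= Series b.
Proof.
  intros H Hb. eapply Rle_trans; [apply Cmod_Csum_le, summable_le with b; trivial|].
  apply Series_le; trivial. intro n. split; [apply Cmod_ge_0|trivial].
Qed.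

Lemma is_Cseries_unique a l : summable a -> is_Cseries a l -> l = Csum a.
Proof.
  intros Ha H. apply (@filterlim_locally_unique nat C_AbsRing C_NormedModule eventually _ (sum_n a) l (Csum a)); [exact H|].
  apply is_Cseries_Csum. trivial.
Qed.

Lemma fubini (u : nat -> nat -> C) :
  (forall i, summable (u i)) -> ex_series (fun i => Series (fun j => Cmod (u i j))) ->
  (forall j, summable (fun i => u i j)) /\
  ex_series (fun j => Series (fun i => Cmod (u i j))) /\
  Csum (fun i => Csum (u i)) = Csum (fun j => Csum (fun i => u i j)).
Proof.
  intros H1 H2.
  destruct (tonelli_le (fun i j => Cmod (u i j))) as (H3 & H4 & _); trivial.
  { intros; apply Cmod_ge_0. }
  split; [exact H3|split; [exact H4|]].
  unfold Csum; simpl.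
  f_equal; symmetry; apply fubini_R.
  - intro i. apply summable_Re, H1.
  - apply ex_series_ge0_le with (2 := H2). intro i. split.
    + apply Series_nonneg; [intro; apply Rabs_pos|apply summable_Re, H1].
    + apply Series_le; [|apply H1]. intro j. split; [apply Rabs_pos|apply re_le_Cmod].
  - intro i. apply summable_Im, H1.
  - apply ex_series_ge0_le with (2 := H2). intro i. split.
    + apply Series_nonneg; [intro; apply Rabs_pos|apply summable_Im, H1].
    + apply Series_le; [|apply H1]. intro j. split; [apply Rabs_pos|apply Im_le_Cmod].
Qed.

(** The form in which the hypotheses of [fubini] are verified throughout: a bound with separated
    variables. *)
Lemma summable_prod_bound (u : nat -> nat -> C) (b c : nat -> R) :
  (forall i j, Cmod (u i j) <= b i * c j) -> ex_series b -> ex_series c ->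
  (forall i, summable (u i)) /\ ex_series (fun i => Series (fun j => Cmod (u i j))).
Proof.
  intros H Hb Hc.
  assert (H1 : forall i, summable (u i)).
  { intro i. apply summable_le with (fun j => b i * c j); trivial. apply ex_series_scal_R, Hc. }
  split; trivial.
  apply ex_series_ge0_le with (fun i => Series c * b i).
  - intro i. split.
    + apply Series_nonneg; [intro; apply Cmod_ge_0|apply H1].
    + rewrite Rmult_comm, <- Series_scal_l. apply Series_le.
      * intro j. split; [apply Cmod_ge_0|trivial].
      * apply ex_series_scal_R, Hc.
  - apply ex_series_scal_R, Hb.
Qed.

Lemma summable_Csum (u : nat -> nat -> C) :
  (forall i, summable (u i)) -> ex_series (fun i => Series (fun j => Cmod (u i j))) ->
  summable (fun i => Csum (u i)).
Proof.
  intros H1 H2. apply summable_le with (2 := H2). intro i. apply Cmod_Csum_le, H1.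
Qed.

Lemma ex_series_finite (a : nat -> R) N : (forall n, (N < n)%nat -> a n = 0) -> ex_series a.
Proof.
  intro H. apply (ex_series_incr_n a (S N)). exists 0.
  apply is_series_ext with (fun _ => 0).
  - intro n. rewrite H by lia. trivial.
  - apply (is_series_Reals (fun _ => 0)). intros eps Heps. exists O. intros n _.
    rewrite sum_eq_R0 by trivial. unfold R_dist. rewrite Rminus_0_r, Rabs_R0. exact Heps.
Qed.

Lemma Csum_finite (a : nat -> C) N :
  (forall n, (N < n)%nat -> a n = RtoC 0) -> Csum a = sum_n a N.
Proof.
  intro H. symmetry. apply is_Cseries_unique.
  - apply (ex_series_finite _ N). intros n Hn. rewrite H, Cmod_0; trivial.
  - assert (E : forall n, (N <= n)%nat -> @eq C (sum_n a N) (sum_n a n)).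
    { intros n Hn. induction Hn as [|n Hn IH]; trivial.
      rewrite sum_n_C_S, <- IH, (H (S n)) by lia. symmetry; apply Cplus_0_r. }
    apply filterlim_ext_loc with (fun _ => sum_n a N); [|apply filterlim_const].
    exists N. intros n Hn. exact (E n Hn).
Qed.

Lemma Csum_single (a : nat -> C) N :
  (forall n, n <> N -> a n = RtoC 0) -> Csum a = a N.
Proof.
  intro H. rewrite (Csum_finite a N); [|intros n Hn; apply H; lia].
  destruct N as [|N]; [apply (sum_O a)|]. rewrite sum_n_C_S.
  replace (sum_n a N) with (RtoC 0); [apply Cplus_0_l|].
  assert (Hk : forall k, (k <= N)%nat -> sum_n a k = RtoC 0); [|symmetry; apply Hk; lia].
  induction k as [|k IH]; intro Hk.
  - rewrite sum_O. apply H. lia.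
  - change (@eq C (sum_n a (S k)) 0). rewrite sum_n_C_S, IH, H by lia. apply Cplus_0_l.
Qed.

(* Regard the reindexed sum as the row sums of a matrix with one nonzero entry in each row
   and each column. *)
Lemma Csum_reindex (phi : nat -> nat) (a : nat -> C) :
  (forall i j, phi i = phi j -> i = j) -> (forall n, (forall i, phi i <> n) -> a n = RtoC 0) ->
  summable (fun i => a (phi i)) ->
  summable a /\ Csum (fun i => a (phi i)) = Csum a.
Proof.
  intros Hinj Hsupp Hs.
  set (u := fun i n => if Nat.eqb n (phi i) then a n else RtoC 0).
  assert (Hu : forall i, Csum (u i) = a (phi i)).
  { intro i. rewrite (Csum_single (u i) (phi i)); unfold u.
    - rewrite Nat.eqb_refl. trivial.
    - intros n Hn. apply Nat.eqb_neq in Hn. rewrite Hn. trivial. }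
  assert (Hrow : forall i, summable (u i)).
  { intro i. apply (ex_series_finite _ (phi i)). intros n Hn. unfold u.
    replace (Nat.eqb n (phi i)) with false by (symmetry; apply Nat.eqb_neq; lia). apply Cmod_0. }
  assert (Hmod : forall i, Series (fun n => Cmod (u i n)) = Cmod (a (phi i))).
  { intro i. transitivity (Re (Csum (fun n => RtoC (Cmod (u i n))))); [reflexivity|].
    rewrite (Csum_single _ (phi i)); unfold u.
    - rewrite Nat.eqb_refl. trivial.
    - intros n Hn. apply Nat.eqb_neq in Hn. rewrite Hn, Cmod_0. trivial. }
  destruct (fubini u Hrow) as (H1 & H2 & H3).
  { apply ex_series_ext with (fun i => Cmod (a (phi i))); trivial.
    intro i. symmetry; apply Hmod. }
  assert (Hcol : forall n, Csum (fun i => u i n) = a n).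
  { intro n. destruct (classic (exists i, phi i = n)) as [[i <-]|Hn].
    - rewrite (Csum_single _ i); unfold u.
      + rewrite Nat.eqb_refl. trivial.
      + intros j Hj. destruct (Nat.eqb_spec (phi i) (phi j)); trivial. elim Hj. auto.
    - rewrite (Csum_single _ O); unfold u.
      + rewrite Hsupp; [destruct (Nat.eqb _ _); trivial|]. intros i Hi. apply Hn; eauto.
      + intros j _. rewrite Hsupp; [destruct (Nat.eqb _ _); trivial|]. intros i Hi. apply Hn; eauto. }
  split.
  - apply summable_le with (2 := H2). intro n. rewrite <- Hcol at 1. apply Cmod_Csum_le, H1.
  - rewrite <- (Csum_ext _ _ Hu), H3. apply Csum_ext, Hcol.
Qed.

(** The sparse matrix of the reindexing argument, read the other way round: its row sums are now
    dominated by [a], and its column sums form the subsequence. *)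
Lemma ex_series_subseq (phi : nat -> nat) (a : nat -> R) :
  (forall i j, phi i = phi j -> i = j) -> (forall n, 0 <= a n) ->
  ex_series a -> ex_series (fun i => a (phi i)).
Proof.
  intros Hinj Ha Hs.
  set (u := fun n i => if Nat.eqb n (phi i) then a n else 0).
  assert (Hrow : forall n, ex_series (u n) /\ 0 <= Series (u n) <= a n).
  { intro n. destruct (classic (exists i, phi i = n)) as [[i Hi]|Hn].
    - assert (H1 : forall j, j <> i -> u n j = 0).
      { intros j Hj. unfold u. destruct (Nat.eqb_spec n (phi j)); trivial.
        elim Hj. apply Hinj. congruence. }
      assert (H2 : Series (u n) = a n).
      { transitivity (Re (Csum (fun j => RtoC (u n j)))); [reflexivity|].
        rewrite (Csum_single _ i).
        - unfold u. rewrite <- Hi, Nat.eqb_refl. trivial.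
        - intros j Hj. rewrite H1; trivial. }
      rewrite H2. split; [|split; [apply Ha|lra]].
      apply (ex_series_finite _ i). intros j Hj. apply H1. lia.
    - assert (H1 : forall j, u n j = 0).
      { intros j. unfold u. destruct (Nat.eqb_spec n (phi j)); trivial. elim Hn; eauto. }
      split; [apply (ex_series_finite _ O); auto|].
      assert (H2 : Series (u n) = 0); [|rewrite H2; split; [lra|apply Ha]].
      transitivity (Re (Csum (fun j => RtoC (u n j)))); [reflexivity|].
      rewrite (Csum_single _ O); rewrite ?H1; trivial. intros j _. rewrite H1; trivial. }
  destruct (tonelli_le u) as (_ & H & _).
  - intros n i. unfold u. destruct (Nat.eqb _ _); [apply Ha|lra].
  - apply Hrow.
  - apply ex_series_ge0_le with (2 := Hs). apply Hrow.
  - apply ex_series_ext with (2 := H). intro i.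
    transitivity (Re (Csum (fun n => RtoC (u n i)))); [reflexivity|].
    rewrite (Csum_single _ (phi i)); unfold u.
    + rewrite Nat.eqb_refl. trivial.
    + intros n Hn. apply Nat.eqb_neq in Hn. rewrite Hn. trivial.
Qed.

Lemma summable_subseq phi a : (forall i j, phi i = phi j -> i = j) -> summable a ->
  summable (fun i => a (phi i)).
Proof.
  intros Hinj. apply (ex_series_subseq phi (fun n => Cmod (a n))); trivial.
  intro; apply Cmod_ge_0.
Qed.

Lemma Csum_even_odd (a : nat -> C) : summable a ->
  Csum a = Cplus (Csum (fun k => a (2 * k)%nat)) (Csum (fun k => a (2 * k + 1)%nat)).
Proof.
  intro Ha.
  set (ev := fun n => if Nat.even n then a n else RtoC 0).
  set (od := fun n => if Nat.even n then RtoC 0 else a n).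
  destruct (Csum_reindex (fun k => (2 * k)%nat) ev) as [Hev Eev].
  { intros; lia. }
  { intros n Hn. unfold ev. destruct (Nat.even n) eqn:E; trivial.
    apply Nat.even_spec in E. destruct E as [k Hk]. elim (Hn k); auto. }
  { apply summable_ext with (fun k => a (2 * k)%nat).
    - intro k. unfold ev. rewrite Nat.even_mul. trivial.
    - apply (summable_subseq (fun k => (2 * k)%nat)); trivial. intros; lia. }
  destruct (Csum_reindex (fun k => (2 * k + 1)%nat) od) as [Hod Eod].
  { intros; lia. }
  { intros n Hn. unfold od. destruct (Nat.even n) eqn:E; trivial.
    rewrite <- Nat.negb_odd in E. destruct (Nat.odd n) eqn:E'; [|discriminate].
    apply Nat.odd_spec in E'. destruct E' as [k Hk]. elim (Hn k); auto. }
  { apply summable_ext with (fun k => a (2 * k + 1)%nat).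
    - intro k. unfold od. rewrite Nat.even_add, Nat.even_mul. trivial.
    - apply (summable_subseq (fun k => (2 * k + 1)%nat)); trivial. intros; lia. }
  transitivity (Cplus (Csum ev) (Csum od)).
  - rewrite <- Csum_plus by trivial. apply Csum_ext. intro n. unfold ev, od.
    destruct (Nat.even n); ring.
  - rewrite <- Eev, <- Eod. f_equal; apply Csum_ext; intro k; unfold ev, od.
    + rewrite Nat.even_mul. trivial.
    + rewrite Nat.even_add, Nat.even_mul. trivial.
Qed.

(** * The series of k^p s^k *)

Lemma nat_mul_pow_bound r n : 0 <= r < 1 -> INR n * r ^ n <= / (1 - r).
Proof.
  intros Hr.
  (* That is, n r^n is at most 1 + r + ... + r^(n-1). *)
  assert (H : forall n, INR n * r ^ n * (1 - r) <= 1 - r ^ n).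
  { clear n. induction n as [|n IH].
    - simpl. lra.
    - rewrite S_INR. simpl pow.
      assert (H0 := pow_le r n ltac:(lra)).
      assert (H1 := pow_incr r 1 n ltac:(lra)). rewrite pow1 in H1.
      assert (H2 : r * (INR n * r ^ n * (1 - r)) <= r * (1 - r ^ n)).
      { apply Rmult_le_compat_l; lra. }
      assert (H3 : 0 <= (1 - r) * (1 - r * r ^ n)) by (apply Rmult_le_pos; nra). lra. }
  apply Rmult_le_reg_r with (1 - r); [lra|].
  rewrite Rinv_l by lra. assert (H0 := pow_le r n ltac:(lra)). specialize (H n). lra.
Qed.

(** Write r = t^2. One power t^n absorbs a factor n, the other one is left for the induction on
    [p]. *)
Lemma ex_series_poly_geom p r : 0 <= r < 1 -> ex_series (fun n => INR n ^ p * r ^ n).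
Proof.
  revert r. induction p as [|p IH]; intros r Hr.
  - apply ex_series_ext with (fun n => r ^ n).
    + intro n. simpl. ring.
    + apply ex_series_geom. rewrite Rabs_pos_eq; lra.
  - set (t := sqrt r).
    assert (Ht : 0 <= t < 1).
    { split; [apply sqrt_pos|]. rewrite <- sqrt_1. apply sqrt_lt_1; lra. }
    assert (Htt : r = t * t) by (symmetry; apply sqrt_sqrt; lra).
    apply ex_series_ge0_le with (fun n => / (1 - t) * (INR n ^ p * t ^ n)).
    + intro n. rewrite Htt, Rpow_mult_distr. simpl.
      assert (H1 := nat_mul_pow_bound t n Ht).
      assert (H2 : 0 <= INR n ^ p * t ^ n).
      { apply Rmult_le_pos; apply pow_le; [apply pos_INR|lra]. }
      assert (H3 : 0 <= INR n * t ^ n).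
      { apply Rmult_le_pos; [apply pos_INR|apply pow_le; lra]. }
      replace (INR n * INR n ^ p * (t ^ n * t ^ n))
        with ((INR n * t ^ n) * (INR n ^ p * t ^ n)) by ring.
      split; [apply Rmult_le_pos; trivial|apply Rmult_le_compat_r; trivial].
    + apply ex_series_scal_R, IH, Ht.
Qed.

Lemma Cmod_INR n : Cmod (RtoC (INR n)) = INR n.
Proof. rewrite Cmod_R. apply Rabs_pos_eq, pos_INR. Qed.

(** The polylogarithm of order - p, with a term for k = 0 that is 1 if [p] is 0 and vanishes
    otherwise. The series P of the Eisenstein expansions is [polylog 3]. *)
Definition polylog (p : nat) (s : C) : C :=
  Csum (fun k => Cmult (RtoC (INR k ^ p)) (Cpow s k)).

Lemma Cmod_polylog_term p s k :
  Cmod (Cmult (RtoC (INR k ^ p)) (Cpow s k)) = INR k ^ p * Cmod s ^ k.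
Proof.
  rewrite Cmod_mult, Cmod_pow, Cmod_R, Rabs_pos_eq; trivial. apply pow_le, pos_INR.
Qed.

Lemma summable_polylog p s : Cmod s < 1 ->
  summable (fun k => Cmult (RtoC (INR k ^ p)) (Cpow s k)).
Proof.
  intro Hs. apply ex_series_ext with (fun n => INR n ^ p * Cmod s ^ n).
  - intro k. symmetry. apply Cmod_polylog_term.
  - apply ex_series_poly_geom. split; [apply Cmod_ge_0|trivial].
Qed.

Lemma polylog_0 s : Cmod s < 1 -> Cmult (polylog 0 s) (Cminus 1 s) = 1.
Proof.
  intro Hs. assert (H := summable_polylog 0 s Hs).
  assert (E : polylog 0 s = Cplus 1 (Cmult s (polylog 0 s))).
  { unfold polylog at 1. rewrite Csum_incr_1 by trivial. simpl INR. f_equal; [simpl; ring|].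
    unfold polylog. rewrite <- Csum_scal by trivial. apply Csum_ext. intro n.
    rewrite Cpow_S. simpl pow. ring. }
  transitivity (Cminus (polylog 0 s) (Cmult s (polylog 0 s))); [ring|].
  rewrite E at 1. ring.
Qed.

(** Expanding (n + 1)^(p+1) by the binomial theorem turns this into a recursion on [p], carried out
    up to 3 below. *)
Lemma polylog_shift p s : Cmod s < 1 ->
  polylog (S p) s = Cmult s (Csum (fun n => Cmult (RtoC (INR (S n) ^ S p)) (Cpow s n))).
Proof.
  intro Hs. unfold polylog. assert (H := summable_polylog (S p) s Hs).
  rewrite Csum_incr_1 by trivial.
  replace (RtoC (INR 0 ^ S p)) with (RtoC 0) by (f_equal; simpl; ring).
  rewrite Cmult_0_l, Cplus_0_l.
  destruct (Ceq_dec s 0) as [->|Hs0].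
  - rewrite Cmult_0_l. rewrite (Csum_finite _ O).
    + rewrite sum_O. rewrite Cpow_S. ring.
    + intros n _. rewrite Cpow_S. ring.
  - rewrite <- Csum_scal.
    + apply Csum_ext. intro n. rewrite Cpow_S. ring.
    + apply summable_ext with (fun n => Cmult (/ s) (Cmult (RtoC (INR (S n) ^ S p)) (Cpow s (S n)))).
      * intro n. rewrite Cpow_S. field. trivial.
      * apply summable_scal. apply (summable_S _ H).
Qed.

Lemma polylog_1 s : Cmod s < 1 -> Cmult (polylog 1 s) (Cminus 1 s) = Cmult s (polylog 0 s).
Proof.
  intro Hs.
  assert (E : polylog 1 s = Cmult s (Cplus (polylog 1 s) (polylog 0 s))).
  { rewrite polylog_shift at 1 by trivial. f_equal. unfold polylog.
    rewrite <- Csum_plus by (apply summable_polylog; trivial).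
    apply Csum_ext. intro n. rewrite S_INR. simpl pow.
    rewrite !RtoC_mult, !RtoC_plus. ring. }
  transitivity (Cminus (polylog 1 s) (Cmult s (polylog 1 s))); [ring|].
  rewrite E at 1. ring.
Qed.

Lemma polylog_2 s : Cmod s < 1 ->
  Cmult (polylog 2 s) (Cminus 1 s) = Cmult s (Cplus (Cmult 2 (polylog 1 s)) (polylog 0 s)).
Proof.
  intro Hs.
  assert (E : polylog 2 s = Cmult s (Cplus (Cplus (polylog 2 s) (Cmult 2 (polylog 1 s))) (polylog 0 s))).
  { rewrite polylog_shift at 1 by trivial. f_equal. unfold polylog.
    assert (H := fun p => summable_polylog p s Hs).
    rewrite <- Csum_scal, <- !Csum_plus by auto using summable_scal, summable_plus.
    apply Csum_ext. intro n. rewrite S_INR. simpl pow.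
    rewrite !RtoC_mult, !RtoC_plus. ring. }
  transitivity (Cminus (polylog 2 s) (Cmult s (polylog 2 s))); [ring|].
  rewrite E at 1. ring.
Qed.

Lemma polylog_3 s : Cmod s < 1 ->
  Cmult (polylog 3 s) (Cminus 1 s) =
  Cmult s (Cplus (Cplus (Cmult 3 (polylog 2 s)) (Cmult 3 (polylog 1 s))) (polylog 0 s)).
Proof.
  intro Hs.
  assert (E : polylog 3 s = Cmult s (Cplus (Cplus (Cplus (polylog 3 s) (Cmult 3 (polylog 2 s)))
      (Cmult 3 (polylog 1 s))) (polylog 0 s))).
  { rewrite polylog_shift at 1 by trivial. f_equal. unfold polylog.
    assert (H := fun p => summable_polylog p s Hs).
    rewrite <- !Csum_scal, <- !Csum_plus by auto using summable_scal, summable_plus.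
    apply Csum_ext. intro n. rewrite S_INR. simpl pow.
    rewrite !RtoC_mult, !RtoC_plus. ring. }
  transitivity (Cminus (polylog 3 s) (Cmult s (polylog 3 s))); [ring|].
  rewrite E at 1. ring.
Qed.

Lemma one_minus_neq_0 s : Cmod s < 1 -> Cminus 1 s <> 0.
Proof.
  intros Hs E. assert (H : s = 1).
  { transitivity (Cminus 1 (Cminus 1 s)); [ring|]. rewrite E. ring. }
  rewrite H, Cmod_1 in Hs. lra.
Qed.

(** The coefficients 1, 4, 1 are Eulerian numbers. The rational function exhibits the pole of order
    4 at s = 1 and reduces the duplication formula to algebra. *)
Lemma polylog_closed s : Cmod s < 1 ->
  polylog 3 s = Cdiv (Cplus (Cplus s (Cmult 4 (Cpow s 2))) (Cpow s 3)) (Cpow (Cminus 1 s) 4).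
Proof.
  intro Hs. assert (Hne := one_minus_neq_0 s Hs).
  assert (H0 := polylog_0 s Hs). assert (H1 := polylog_1 s Hs).
  assert (H2 := polylog_2 s Hs). assert (H3 := polylog_3 s Hs).
  set (d := Cminus 1 s) in *.
  assert (Hd : s = Cminus 1 d) by (unfold d; ring).
  apply (f_equal (fun x => Cmult x (/ d))) in H0, H1, H2, H3.
  assert (Hinv : forall x, Cmult (Cmult x d) (/ d) = x) by (intro x; field; trivial).
  rewrite Hinv in H0, H1, H2, H3. rewrite H3, H2, H1, H0. clearbody d. subst s. field. trivial.
Qed.

(** * The exponential *)

(** This is e^(pi i w), so that [cexp z] is the s of the overview and its square is x. *)
Definition cexp (w : C) : C :=
  (exp (- PI * Im w) * cos (PI * Re w), exp (- PI * Im w) * sin (PI * Re w)).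

Lemma cexp_plus w v : cexp (Cplus w v) = Cmult (cexp w) (cexp v).
Proof.
  unfold cexp, Cplus, Cmult; simpl. unfold Re, Im; simpl.
  rewrite !Rmult_plus_distr_l, exp_plus, cos_plus, sin_plus. f_equal; ring.
Qed.

Lemma cexp_0 : cexp 0 = 1.
Proof. unfold cexp; simpl. rewrite !Rmult_0_r, exp_0, cos_0, sin_0. unfold RtoC. f_equal; ring. Qed.

Lemma cexp_1 : cexp 1 = Copp 1.
Proof.
  unfold cexp; simpl. rewrite Rmult_0_r, Rmult_1_r, exp_0, cos_PI, sin_PI.
  unfold Copp, RtoC; simpl. f_equal; ring.
Qed.

Lemma cexp_nat_mult n w : cexp (Cmult (RtoC (INR n)) w) = Cpow (cexp w) n.
Proof.
  induction n as [|n IH].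
  - simpl INR. rewrite Cmult_0_l, cexp_0. reflexivity.
  - rewrite Cpow_S, <- IH, <- cexp_plus, S_INR, RtoC_plus. f_equal. ring.
Qed.

Lemma Cmod_cexp w : Cmod (cexp w) = exp (- PI * Im w).
Proof.
  unfold Cmod, cexp; simpl fst; simpl snd.
  replace (_ + _) with ((exp (- PI * Im w))² * ((sin (PI * Re w))² + (cos (PI * Re w))²))
    by (unfold Rsqr; ring).
  rewrite sin2_cos2, Rmult_1_r. apply sqrt_Rsqr. left. apply exp_pos.
Qed.

Lemma Cmod_cexp_lt_1 w : 0 < Im w -> Cmod (cexp w) < 1.
Proof.
  intro H. rewrite Cmod_cexp, <- exp_0. apply exp_increasing.
  assert (Hp := PI_RGT_0). nra.
Qed.

Lemma Rabs_exp_minus_1 a : Rabs a <= PI -> Rabs (exp a - 1) <= exp PI * Rabs a.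
Proof.
  intro Ha. destruct (MVT_gen exp 0 a exp) as (c & Hc & E).
  - intros x _. apply is_derive_Reals. apply derivable_pt_lim_exp.
  - intros x _. apply derivable_continuous_pt, derivable_pt_exp.
  - rewrite exp_0, Rminus_0_r in E. rewrite E, Rabs_mult.
    apply Rmult_le_compat_r; [apply Rabs_pos|].
    rewrite Rabs_pos_eq by (left; apply exp_pos).
    assert (Hcp : c <= PI).
    { apply Rle_trans with (1 := proj2 Hc). apply Rmax_lub; [left; apply PI_RGT_0|].
      apply Rle_trans with (2 := Ha). apply Rle_abs. }
    destruct Hcp as [Hcp|Hcp]; [left; apply exp_increasing; trivial|rewrite Hcp; lra].
Qed.

Lemma Rabs_between c a : Rmin 0 a <= c <= Rmax 0 a -> Rabs c <= Rabs a.
Proof.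
  unfold Rmin, Rmax. intros H. destruct (Rle_dec 0 a);
    unfold Rabs; destruct (Rcase_abs c), (Rcase_abs a); lra.
Qed.

Lemma Rabs_exp_taylor a : Rabs a <= PI -> Rabs (exp a - 1 - a) <= exp PI * (a * a).
Proof.
  intro Ha. destruct (MVT_gen (fun x => exp x - x) 0 a (fun x => exp x - 1)) as (c & Hc & E).
  - intros x _. auto_derive; trivial. ring.
  - intros x _. apply continuity_pt_minus.
    + apply derivable_continuous_pt, derivable_pt_exp.
    + apply derivable_continuous_pt, derivable_pt_id.
  - rewrite exp_0, !Rminus_0_r in E. replace (exp a - 1 - a) with (exp a - a - 1) by ring.
    rewrite E, Rabs_mult. apply Rabs_between in Hc.
    replace (a * a) with (Rabs a * Rabs a) by (rewrite <- Rabs_mult; apply Rabs_pos_eq; nra).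
    rewrite <- Rmult_assoc. apply Rmult_le_compat_r; [apply Rabs_pos|].
    apply Rle_trans with (1 := Rabs_exp_minus_1 c ltac:(lra)).
    apply Rmult_le_compat_l; [left; apply exp_pos|trivial].
Qed.

Lemma Rabs_sin_le x : Rabs (sin x) <= Rabs x.
Proof.
  destruct (MVT_gen sin 0 x cos) as (c & Hc & E).
  - intros y _. apply is_derive_Reals, derivable_pt_lim_sin.
  - intros y _. apply derivable_continuous_pt, derivable_pt_sin.
  - rewrite sin_0, !Rminus_0_r in E. rewrite E, Rabs_mult.
    assert (Hb := COS_bound c). assert (Rabs (cos c) <= 1) by (apply Rabs_le; lra).
    assert (H0 := Rabs_pos x). nra.
Qed.

Lemma Rabs_cos_minus_1 x : Rabs (cos x - 1) <= Rabs x * Rabs x.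
Proof.
  replace x with (2 * (x / 2)) at 1 by field. rewrite cos_2a_sin.
  replace (1 - 2 * sin (x / 2) * sin (x / 2) - 1) with (- (2 * (sin (x / 2) * sin (x / 2)))) by ring.
  rewrite Rabs_Ropp, !Rabs_mult, (Rabs_pos_eq 2) by lra.
  assert (H := Rabs_sin_le (x / 2)). unfold Rdiv in *. rewrite Rabs_mult, (Rabs_pos_eq (/ 2)) in H by lra.
  assert (H0 := Rabs_pos (sin (x * / 2))). assert (H1 := Rabs_pos x). nra.
Qed.

Lemma Rabs_sin_taylor x : Rabs x <= PI -> Rabs (sin x - x) <= PI * (Rabs x * Rabs x).
Proof.
  intro Hx. destruct (MVT_gen (fun x => sin x - x) 0 x (fun x => cos x - 1)) as (c & Hc & E).
  - intros y _. auto_derive; trivial. ring.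
  - intros y _. apply continuity_pt_minus.
    + apply derivable_continuous_pt, derivable_pt_sin.
    + apply derivable_continuous_pt, derivable_pt_id.
  - rewrite sin_0, !Rminus_0_r in E. rewrite E, Rabs_mult. apply Rabs_between in Hc.
    assert (H := Rabs_cos_minus_1 c). assert (H0 := Rabs_pos c). assert (H1 := Rabs_pos x).
    assert (Hp := PI_RGT_0).
    assert (H2 : Rabs c * Rabs c <= PI * Rabs x) by nra. nra.
Qed.

(** With a = - pi Im w and b = pi Re w the remainder has real part (e^a - 1 - a) + e^a (cos b - 1)
    and imaginary part e^a (sin b - b) + (e^a - 1) b. Of the four terms, three are at most e^pi pi^2
    |w|^2 and the one with the sine at most pi times that, whence the constant. *)
Lemma cexp_taylor : exists K, 0 < K /\ forall w, Cmod w <= 1 ->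
  Cmod (Cminus (Cminus (cexp w) 1) (Cmult (Cmult (RtoC PI) Ci) w)) <= K * (Cmod w * Cmod w).
Proof.
  assert (Hp := PI_RGT_0). assert (He := exp_pos PI).
  assert (He1 : 1 <= exp PI) by (assert (H := exp_ineq1_le PI); lra).
  exists (exp PI * (PI * PI * (3 + PI))). split; [apply Rmult_lt_0_compat; trivial; nra|].
  intros w Hw. set (m := Cmod w) in *.
  set (a := - PI * Im w). set (b := PI * Re w).
  assert (Hm : 0 <= m) by apply Cmod_ge_0.
  assert (Ha : Rabs a <= PI * m).
  { unfold a. rewrite Rabs_mult, Rabs_Ropp, (Rabs_pos_eq PI) by lra.
    apply Rmult_le_compat_l; [lra|apply Im_le_Cmod]. }
  assert (Hb : Rabs b <= PI * m).
  { unfold b. rewrite Rabs_mult, (Rabs_pos_eq PI) by lra.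
    apply Rmult_le_compat_l; [lra|apply re_le_Cmod]. }
  assert (Hm1 : PI * m <= PI) by nra.
  eapply Rle_trans; [apply Cmod_le_Re_Im|].
  replace (Re _) with ((exp a - 1 - a) + exp a * (cos b - 1)).
  2: { unfold cexp, a, b, Re, Im; simpl; ring. }
  replace (Im _) with (exp a * (sin b - b) + (exp a - 1) * b).
  2: { unfold cexp, a, b, Re, Im; simpl; ring. }
  assert (Hea : 0 < exp a <= exp PI).
  { split; [apply exp_pos|]. destruct (Rle_lt_or_eq_dec a PI) as [H|H].
    - apply Rle_trans with (2 := Hm1). apply Rle_trans with (2 := Ha). apply Rle_abs.
    - left; apply exp_increasing; trivial.
    - rewrite H; lra. }
  assert (H1 := Rabs_exp_taylor a ltac:(lra)).
  assert (H2 := Rabs_cos_minus_1 b). assert (H3 := Rabs_sin_taylor b ltac:(lra)).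
  assert (H4 := Rabs_exp_minus_1 a ltac:(lra)).
  assert (Hb0 := Rabs_pos b). assert (Ha0 := Rabs_pos a).
  assert (Hbb : Rabs b * Rabs b <= PI * PI * (m * m)).
  { replace (PI * PI * (m * m)) with ((PI * m) * (PI * m)) by ring. apply Rmult_le_compat; trivial. }
  assert (Haa : a * a <= PI * PI * (m * m)).
  { replace (PI * PI * (m * m)) with ((PI * m) * (PI * m)) by ring.
    apply Rle_trans with (Rabs a * Rabs a); [|apply Rmult_le_compat; trivial].
    rewrite <- Rabs_mult. apply Rle_abs. }
  assert (Hab : Rabs a * Rabs b <= PI * PI * (m * m)).
  { replace (PI * PI * (m * m)) with ((PI * m) * (PI * m)) by ring. apply Rmult_le_compat; trivial. }
  set (M := PI * PI * (m * m)) in *.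
  assert (HM : 0 <= M) by (unfold M; nra).
  assert (T1 : Rabs (exp a - 1 - a) <= exp PI * M).
  { eapply Rle_trans; [exact H1|]. apply Rmult_le_compat_l; lra. }
  assert (T2 : Rabs (exp a * (cos b - 1)) <= exp PI * M).
  { rewrite Rabs_mult, (Rabs_pos_eq (exp a)) by lra.
    apply Rmult_le_compat; [lra|apply Rabs_pos|lra|lra]. }
  assert (T3 : Rabs (exp a * (sin b - b)) <= exp PI * (PI * M)).
  { rewrite Rabs_mult, (Rabs_pos_eq (exp a)) by lra.
    apply Rmult_le_compat; [lra|apply Rabs_pos|lra|nra]. }
  assert (T4 : Rabs ((exp a - 1) * b) <= exp PI * M).
  { rewrite Rabs_mult. apply Rle_trans with (exp PI * Rabs a * Rabs b).
    - apply Rmult_le_compat_r; trivial.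
    - rewrite Rmult_assoc. apply Rmult_le_compat_l; lra. }
  replace (exp PI * (PI * PI * (3 + PI)) * (m * m))
    with (exp PI * M + exp PI * M + (exp PI * (PI * M) + exp PI * M)) by (unfold M; ring).
  apply Rplus_le_compat; (eapply Rle_trans; [apply Rabs_triang|apply Rplus_le_compat; trivial]).
Qed.

(** * Complex derivatives *)

(** A quadratic bound on the remainder, which all the functions below satisfy explicitly, beats eps
    |h| as soon as |h| is at most eps / (|K| + 1). *)
Lemma is_C_derive_quadratic (f : C -> C) (z l : C) (delta K : R) :
  0 < delta ->
  (forall h, Cmod h < delta ->
     Cmod (Cminus (Cminus (f (Cplus z h)) (f z)) (Cmult h l)) <= K * (Cmod h * Cmod h)) ->
  @is_derive C_AbsRing C_NormedModule f z l.
Proof.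
  intros Hd H. split.
  - apply is_linear_scal_l.
  - intros x Hx.
    assert (E := @is_filter_lim_locally_unique C_AbsRing (AbsRing_NormedModule C_AbsRing) z x Hx).
    subst x. clear Hx.
    intro eps.
    set (d := Rmin delta (eps / (Rabs K + 1))).
    assert (HK := Rabs_pos K). assert (Heps := cond_pos eps).
    assert (Hd' : 0 < d).
    { apply Rmin_pos; trivial. apply Rdiv_lt_0_compat; lra. }
    exists (mkposreal d Hd'). intros y Hy.
    change (Cmod (Cminus y z) < d) in Hy.
    change (Cmod (Cminus (Cminus (f y) (f z)) (Cmult (Cminus y z) l)) <= eps * Cmod (Cminus y z)).
    set (h := Cminus y z) in *.
    replace y with (Cplus z h) by (unfold h; ring).
    assert (Hh := Cmod_ge_0 h).
    eapply Rle_trans; [apply H; apply Rlt_le_trans with (1 := Hy); apply Rmin_l|].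
    rewrite <- Rmult_assoc. apply Rmult_le_compat_r; trivial.
    apply Rle_trans with ((Rabs K + 1) * Cmod h).
    + apply Rmult_le_compat_r; trivial. assert (HK' := Rle_abs K). lra.
    + assert (H1 : Cmod h <= eps / (Rabs K + 1)).
      { left. apply Rlt_le_trans with (1 := Hy). apply Rmin_r. }
      apply Rmult_le_compat_l with (r := Rabs K + 1) in H1; [|lra].
      replace ((Rabs K + 1) * (eps / (Rabs K + 1))) with (pos eps) in H1 by (field; lra). trivial.
Qed.

(** * The Lipschitz formula *)

(** Telescoping: 1/(n+1)^2 is at most 1/n - 1/(n+1). *)
Lemma ex_series_inv_sqr : ex_series (fun k => / (INR (S k)) ^ 2).
Proof.
  apply (ex_series_bounded _ 2).
  - intro k. left. apply Rinv_0_lt_compat, pow_lt, lt_0_INR. lia.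
  - assert (H : forall n, sum_n (fun k => / (INR (S k)) ^ 2) n <= 2 - / INR (S n)).
    { induction n as [|n IH].
      - rewrite sum_O. simpl. rewrite !Rmult_1_r, Rinv_1. lra.
      - rewrite sum_Sn. change plus with Rplus.
        assert (H1 : 0 < INR (S n)) by (apply lt_0_INR; lia).
        assert (H2 : / INR (S (S n)) ^ 2 <= / INR (S n) - / INR (S (S n))); [|lra].
        rewrite (S_INR (S n)). set (x := INR (S n)) in *.
        replace (/ x - / (x + 1)) with (/ (x * (x + 1))) by (field; lra).
        apply Rinv_le_contravar; nra. }
    intro n. specialize (H n). assert (0 < / INR (S n)); [|lra].
    apply Rinv_0_lt_compat, lt_0_INR. lia.
Qed.

Definition inv4 (w : C) : C := Cinv (Cpow w 4).

Lemma Cmod_inv4 (w : C) : w <> 0 -> Cmod (inv4 w) = / Cmod w ^ 4.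
Proof. intro H. unfold inv4. rewrite Cmod_inv, Cmod_pow; trivial. apply Cpow_nz; trivial. Qed.

Lemma inv4_opp w : inv4 (Copp w) = inv4 w.
Proof. unfold inv4. f_equal. ring. Qed.

Lemma Im_lin z (a b : R) : Im (Cplus (Cmult (RtoC a) z) (RtoC b)) = a * Im z.
Proof. destruct z as [x y]. unfold Im; simpl. ring. Qed.

Lemma Im_neq_0 (z : C) : Im z <> 0 -> z <> 0.
Proof. intros H E. apply H. rewrite E. reflexivity. Qed.

(** Let w = a z + b and y = Im z. The imaginary parts of w and of w times the conjugate of z are a y
    and - b y; hence |w| is at least |a| y and |w| |z| at least |b| y. Multiplying the squares
    separates the variables, so that double sums converge without any count of lattice points. *)
Lemma inv4_lattice_bound z : 0 < Im z -> exists K, 0 <= K /\ forall a b : R, a <> 0 -> b <> 0 ->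
  Cmod (inv4 (Cplus (Cmult (RtoC a) z) (RtoC b))) <= K * (/ a ^ 2 * / b ^ 2).
Proof.
  intro Hy. assert (Hz : 0 < Cmod z) by (apply Cmod_gt_0, Im_neq_0; lra).
  set (y := Im z) in *. exists (Cmod z ^ 2 / y ^ 4). split.
  { apply Rmult_le_pos; [apply pow_le; lra|]. left. apply Rinv_0_lt_compat, pow_lt; trivial. }
  intros a b Ha Hb. set (w := Cplus _ _).
  assert (Hw : Im w = a * y) by apply Im_lin.
  assert (Ha2 : 0 < a ^ 2) by (simpl; nra). assert (Hb2 : 0 < b ^ 2) by (simpl; nra).
  assert (H1 : a ^ 2 * y ^ 2 <= Cmod w ^ 2).
  { rewrite <- Rpow_mult_distr, <- Hw, <- (pow2_abs (Im w)). apply pow_incr.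
    split; [apply Rabs_pos|apply Im_le_Cmod]. }
  assert (H2 : b ^ 2 * y ^ 2 <= Cmod w ^ 2 * Cmod z ^ 2).
  { rewrite <- !Rpow_mult_distr, <- (Cmod_conj z), <- Cmod_mult.
    replace (b * y) with (- Im (Cmult w (Cconj z))).
    - rewrite <- (pow2_abs (- _)), Rabs_Ropp. apply pow_incr.
      split; [apply Rabs_pos|apply Im_le_Cmod].
    - unfold w, y. destruct z as [p q]. unfold Im; simpl. ring. }
  assert (Hw0 : w <> 0) by (apply Im_neq_0; rewrite Hw; apply Rmult_integral_contrapositive; lra).
  rewrite Cmod_inv4 by trivial.
  assert (Hw4 : a ^ 2 * b ^ 2 * y ^ 4 <= Cmod w ^ 4 * Cmod z ^ 2).
  { replace (a ^ 2 * b ^ 2 * y ^ 4) with ((a ^ 2 * y ^ 2) * (b ^ 2 * y ^ 2)) by ring.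
    replace (Cmod w ^ 4 * Cmod z ^ 2) with (Cmod w ^ 2 * (Cmod w ^ 2 * Cmod z ^ 2)) by ring.
    apply Rmult_le_compat; trivial; apply Rmult_le_pos; try lra; apply pow_le; lra. }
  assert (Hy4 : 0 < y ^ 4) by (apply pow_lt; trivial).
  assert (Hz2 : 0 < Cmod z ^ 2) by (apply pow_lt; trivial).
  assert (Hp : 0 < a ^ 2 * b ^ 2 * y ^ 4) by (apply Rmult_lt_0_compat; [apply Rmult_lt_0_compat|]; trivial).
  assert (Hwp : 0 < Cmod w ^ 4) by (apply pow_lt, Cmod_gt_0; trivial).
  apply Rmult_le_reg_l with (Cmod w ^ 4); trivial.
  rewrite Rinv_r by lra.
  replace (Cmod w ^ 4 * (Cmod z ^ 2 / y ^ 4 * (/ a ^ 2 * / b ^ 2)))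
    with ((Cmod w ^ 4 * Cmod z ^ 2) / (a ^ 2 * b ^ 2 * y ^ 4)) by (field; lra).
  apply Rmult_le_reg_r with (a ^ 2 * b ^ 2 * y ^ 4); trivial.
  replace (Cmod w ^ 4 * Cmod z ^ 2 / (a ^ 2 * b ^ 2 * y ^ 4) * (a ^ 2 * b ^ 2 * y ^ 4))
    with (Cmod w ^ 4 * Cmod z ^ 2) by (field; lra).
  lra.
Qed.

Definition pair4 (w : C) (n : nat) : C :=
  Cplus (inv4 (Cplus w (RtoC (INR n)))) (inv4 (Cminus w (RtoC (INR n)))).

(* The sums of (w + n)^(-4) over the even, respectively odd, integers n. *)
Definition even_sum (w : C) : C := Cplus (inv4 w) (Csum (fun k => pair4 w (2 * k + 2))).
Definition odd_sum (w : C) : C := Csum (fun k => pair4 w (2 * k + 1)).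

Lemma summable_inv4 w (phi : nat -> nat) : 0 < Im w -> (forall k, (k < phi k)%nat) ->
  summable (fun k => inv4 (Cplus w (RtoC (INR (phi k))))) /\
  summable (fun k => inv4 (Cminus w (RtoC (INR (phi k))))).
Proof.
  intros Hw Hphi. destruct (inv4_lattice_bound w Hw) as (K & HK & H).
  assert (Hle : forall k, K * / INR (phi k) ^ 2 <= K * / INR (S k) ^ 2).
  { intro k. apply Rmult_le_compat_l; trivial. apply Rinv_le_contravar.
    - apply pow_lt, lt_0_INR. lia.
    - apply pow_incr. split; [apply pos_INR|apply le_INR, Hphi]. }
  assert (Hne : forall k, INR (phi k) <> 0).
  { intros k E. apply (INR_eq _ 0) in E. specialize (Hphi k). lia. }
  split; apply summable_le with (fun k => K * / INR (S k) ^ 2);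
    try (apply ex_series_scal_R, ex_series_inv_sqr); intro k;
    apply Rle_trans with (2 := Hle k).
  - specialize (H 1 (INR (phi k)) ltac:(lra) (Hne k)).
    rewrite Cmult_1_l in H. replace (/ 1 ^ 2 * / INR (phi k) ^ 2) with (/ INR (phi k) ^ 2) in H; trivial.
    field. apply Hne.
  - specialize (H 1 (- INR (phi k)) ltac:(lra) ltac:(specialize (Hne k); lra)).
    rewrite Cmult_1_l, RtoC_opp in H.
    replace (/ 1 ^ 2 * / (- INR (phi k)) ^ 2) with (/ INR (phi k) ^ 2) in H; trivial.
    field. apply Hne.
Qed.

Lemma summable_pair4 w (phi : nat -> nat) : 0 < Im w -> (forall k, (k < phi k)%nat) ->
  summable (fun k => pair4 w (phi k)).
Proof. intros Hw Hphi. destruct (summable_inv4 w phi); trivial. apply summable_plus; trivial. Qed.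

(** The pairs of n and - n must be broken up, since shifting by 1 matches each half with a different
    pair; this is legitimate because both halves are absolutely convergent. *)
Lemma odd_sum_shift w : 0 < Im w ->
  odd_sum w = even_sum (Cplus w 1) /\ odd_sum w = even_sum (Cminus w 1).
Proof.
  intro Hw.
  destruct (summable_inv4 w (fun k => 2 * k + 1)%nat Hw ltac:(intro; cbn beta; lia)) as [Hb Hc].
  set (b := fun k => inv4 (Cplus w (RtoC (INR (2 * k + 1))))) in *.
  set (c := fun k => inv4 (Cminus w (RtoC (INR (2 * k + 1))))) in *.
  assert (E : odd_sum w = Cplus (Csum b) (Csum c)) by (apply (Csum_plus b c); trivial).
  rewrite E. unfold even_sum. split.
  - rewrite (Csum_incr_1 b) by trivial.
    rewrite (Csum_ext (fun k => pair4 (Cplus w 1) (2 * k + 2)) (fun k => Cplus (b (S k)) (c k))).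
    + rewrite Csum_plus by (trivial; apply summable_S; trivial).
      unfold b at 1. simpl INR. ring.
    + intro k. unfold pair4, b, c. f_equal; f_equal;
        rewrite !plus_INR, !mult_INR, ?S_INR; simpl INR;
        rewrite !RtoC_plus, !RtoC_mult, ?RtoC_plus; ring.
  - rewrite (Csum_incr_1 c) by trivial.
    rewrite (Csum_ext (fun k => pair4 (Cminus w 1) (2 * k + 2)) (fun k => Cplus (b k) (c (S k)))).
    + rewrite Csum_plus by (trivial; apply summable_S; trivial).
      unfold c at 1. simpl INR. ring.
    + intro k. unfold pair4, b, c. f_equal; f_equal;
        rewrite !plus_INR, !mult_INR, ?S_INR; simpl INR;
        rewrite !RtoC_plus, !RtoC_mult, ?RtoC_plus; ring.
Qed.

Lemma even_sum_period w : 0 < Im w -> even_sum (Cplus w 2) = even_sum w.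
Proof.
  intro Hw.
  assert (Hw1 : 0 < Im (Cplus w 1)) by (destruct w; unfold Im in *; simpl in *; lra).
  destruct (odd_sum_shift _ Hw1) as [E1 E2].
  replace (Cplus w 2) with (Cplus (Cplus w 1) 1).
  - rewrite <- E1, E2. f_equal. ring.
  - replace (RtoC 2) with (Cplus 1 1) by (rewrite <- RtoC_plus; f_equal; ring). ring.
Qed.

Lemma Im_scal (c : R) w : Im (Cmult (RtoC c) w) = c * Im w.
Proof. destruct w. unfold Im; simpl. ring. Qed.

(** The left side runs over all integers n, and (w + n)^(-4) = 16 (2 w + 2 n)^(-4). *)
Lemma even_odd_duplication w : 0 < Im w ->
  Cplus (even_sum w) (odd_sum w) = Cmult 16 (even_sum (Cmult 2 w)).
Proof.
  intro Hw.
  assert (Hw2 : 0 < Im (Cmult 2 w)) by (rewrite Im_scal; lra).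
  assert (Hall := summable_pair4 w S Hw ltac:(intro; lia)).
  assert (E : Csum (fun k => pair4 w (S k)) =
      Cplus (odd_sum w) (Csum (fun k => pair4 w (2 * k + 2)))).
  { rewrite Csum_even_odd by trivial. unfold odd_sum.
    f_equal; apply Csum_ext; intro k; f_equal; lia. }
  unfold even_sum at 1. rewrite <- Cplus_assoc, (Cplus_comm (Csum _)), <- E.
  unfold even_sum. rewrite Cmult_plus_distr_l. f_equal.
  - unfold inv4. assert (Hne : w <> 0) by (apply Im_neq_0; lra). field. trivial.
  - rewrite <- Csum_scal by (apply summable_pair4; trivial; intro; lia).
    apply Csum_ext. intro k. unfold pair4, inv4.
    assert (E2 : RtoC (INR (2 * k + 2)) = Cmult 2 (RtoC (INR (S k)))).
    { rewrite <- RtoC_mult, S_INR, plus_INR, mult_INR. simpl INR. f_equal. ring. }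
    rewrite E2.
    assert (H1 : Cplus w (RtoC (INR (S k))) <> 0).
    { apply Im_neq_0. destruct w; unfold Im in *; simpl in *; lra. }
    assert (H2 : Cminus w (RtoC (INR (S k))) <> 0).
    { apply Im_neq_0. destruct w; unfold Im in *; simpl in *; lra. }
    assert (H0 : RtoC 2 <> 0) by (intro E3; apply RtoC_inj in E3; lra).
    replace (Cplus (Cmult 2 w) (Cmult 2 (RtoC (INR (S k)))))
      with (Cmult 2 (Cplus w (RtoC (INR (S k))))) by ring.
    replace (Cminus (Cmult 2 w) (Cmult 2 (RtoC (INR (S k)))))
      with (Cmult 2 (Cminus w (RtoC (INR (S k))))) by ring.
    set (p := Cplus w _) in *. set (q := Cminus w _) in *. clearbody p q. field. auto.
Qed.

(** In this strip 0 is the only pole: for k >= 1 the real parts of w + 2 k and w - 2 k are at least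
    2 k - 1 >= k in absolute value. *)
Lemma even_sum_strip_bound : exists K, 0 <= K /\ forall w, 0 < Im w -> Rabs (Re w) <= 1 ->
  Cmod (Cminus (even_sum w) (inv4 w)) <= K.
Proof.
  exists (2 * Series (fun k => / INR (S k) ^ 2)).
  assert (Hpos : forall k, 0 < INR (S k)) by (intro; apply lt_0_INR; lia).
  split.
  { apply Rmult_le_pos; [lra|]. apply Series_nonneg; [|apply ex_series_inv_sqr].
    intro k. left. apply Rinv_0_lt_compat, pow_lt, Hpos. }
  intros w Hw Hre.
  replace (Cminus (even_sum w) (inv4 w)) with (Csum (fun k => pair4 w (2 * k + 2)))
    by (unfold even_sum; ring).
  rewrite <- Series_scal_l. apply Csum_bound; [|apply ex_series_scal_R, ex_series_inv_sqr].
  intro k.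
  assert (Hb : forall v : C, v <> 0 -> INR (S k) <= Rabs (Re v) -> Cmod (inv4 v) <= / INR (S k) ^ 2).
  { intros v Hv Hk. rewrite Cmod_inv4 by trivial.
    assert (Hm : INR (S k) <= Cmod v) by (apply Rle_trans with (1 := Hk), re_le_Cmod).
    apply Rinv_le_contravar; [apply pow_lt, Hpos|].
    apply Rle_trans with (INR (S k) ^ 4).
    - apply Rle_pow; [|lia]. rewrite <- INR_1. apply le_INR. lia.
    - apply pow_incr. split; [left; apply Hpos|trivial]. }
  assert (Hk : INR (2 * k + 2) = 2 * INR (S k)).
  { rewrite S_INR, plus_INR, mult_INR. simpl INR. ring. }
  assert (Hk1 : 1 <= INR (S k)) by (rewrite <- INR_1; apply le_INR; lia).
  apply Rabs_le_between in Hre.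
  unfold pair4. eapply Rle_trans; [apply Cmod_triangle|].
  replace (2 * / INR (S k) ^ 2) with (/ INR (S k) ^ 2 + / INR (S k) ^ 2) by ring.
  rewrite Hk. apply Rplus_le_compat; apply Hb.
  - apply Im_neq_0. destruct w; unfold Im in *; simpl in *; lra.
  - change (INR (S k) <= Rabs (Re w + 2 * INR (S k))).
    apply Rle_trans with (2 := Rle_abs _). lra.
  - apply Im_neq_0. destruct w; unfold Im in *; simpl in *; lra.
  - change (INR (S k) <= Rabs (Re w - 2 * INR (S k))).
    rewrite <- Rabs_Ropp. apply Rle_trans with (2 := Rle_abs _). lra.
Qed.

(** The value (pi i)^4 / 3! of the constant in Lipschitz' formula for the lattice of even
    integers. *)
Definition lip_const : R := PI ^ 4 / 6.

Lemma lip_const_pos : 0 < lip_const.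
Proof. unfold lip_const. apply Rdiv_lt_0_compat; [apply pow_lt, PI_RGT_0|lra]. Qed.

Lemma Cmod_minus_ge (a b : C) : Cmod a - Cmod b <= Cmod (Cminus a b).
Proof.
  assert (H := Cmod_triangle (Cminus a b) b).
  replace (Cplus (Cminus a b) b) with a in H by ring. lra.
Qed.

Lemma Cmod_plus_ge (a b : C) : Cmod a - Cmod b <= Cmod (Cplus a b).
Proof.
  rewrite <- (Cmod_opp b). replace (Cplus a b) with (Cminus a (Copp b)) by ring.
  apply Cmod_minus_ge.
Qed.

Lemma Cmod_one_minus_cexp_sqr w :
  Cmod (Cminus 1 (cexp w)) ^ 2 =
  (1 - Cmod (cexp w)) ^ 2 + 4 * Cmod (cexp w) * sin (PI * Re w / 2) ^ 2.
Proof.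
  rewrite Cmod2_alt, Cmod_cexp. unfold cexp, Re, Im; simpl fst; simpl snd.
  set (r := exp _). set (x := PI * fst w).
  replace (cos x) with (1 - 2 * sin (x / 2) * sin (x / 2))
    by (rewrite <- cos_2a_sin; f_equal; field).
  assert (E : (0 + - (r * sin x)) ^ 2 = r ^ 2 * (1 - cos x ^ 2)).
  { assert (H := sin2_cos2 x). unfold Rsqr in H.
    replace (1 - cos x ^ 2) with (sin x * sin x) by (simpl; lra). ring. }
  rewrite E. replace (cos x) with (1 - 2 * sin (x / 2) * sin (x / 2))
    by (rewrite <- cos_2a_sin; f_equal; field). ring.
Qed.

(** Away from 0 either Im w >= delta/2, so that |e^(pi i w)| stays below 1, or |Re w| >= delta/2, so
    that the sine in the formula for |1 - e^(pi i w)|^2 stays away from 0; in the strip its argument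
    does not leave [- pi/2, pi/2]. *)
Lemma one_minus_cexp_lower delta : 0 < delta <= 1 -> exists c, 0 < c /\
  forall w, 0 < Im w -> Rabs (Re w) <= 1 -> delta <= Cmod w -> c <= Cmod (Cminus 1 (cexp w)).
Proof.
  intro Hd. assert (Hp := PI_RGT_0).
  set (r := exp (- PI * (delta / 2))). set (t := sin (PI * delta / 4)).
  assert (Hr : 0 < r < 1).
  { split; [apply exp_pos|]. rewrite <- exp_0. apply exp_increasing. nra. }
  assert (Ht : 0 < t).
  { apply sin_gt_0; nra. }
  exists (Rmin (1 - r) (2 * r * t)). split.
  { apply Rmin_pos; [lra|]. apply Rmult_lt_0_compat; lra. }
  intros w Hy Hx Hw.
  destruct (Rle_or_lt (delta / 2) (Im w)) as [H|H].
  - apply Rle_trans with (1 := Rmin_l _ _).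
    apply Rle_trans with (Cmod 1 - Cmod (cexp w)); [|apply Cmod_minus_ge].
    rewrite Cmod_1, Cmod_cexp. apply Rplus_le_compat_l, Ropp_le_contravar. unfold r.
    destruct H as [H|H]; [left; apply exp_increasing; nra|rewrite H; lra].
  - apply Rle_trans with (1 := Rmin_r _ _).
    assert (Hre : delta / 2 <= Rabs (Re w)).
    { assert (H1 := Cmod_le_Re_Im w). rewrite (Rabs_pos_eq (Im w)) in H1 by lra. lra. }
    assert (Hsin : t ^ 2 <= sin (PI * Re w / 2) ^ 2).
    { replace (sin (PI * Re w / 2) ^ 2) with (sin (PI * Rabs (Re w) / 2) ^ 2).
      - apply pow_incr. split; [lra|]. apply sin_incr_1; nra.
      - unfold Rabs. destruct (Rcase_abs _); trivial.
        replace (PI * - Re w / 2) with (- (PI * Re w / 2)) by field. rewrite sin_neg. ring. }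
    assert (Hrho : r <= Cmod (cexp w) < 1).
    { split; [|apply Cmod_cexp_lt_1; trivial].
      rewrite Cmod_cexp. left. apply exp_increasing. nra. }
    apply Rsqr_incr_0_var; [|apply Cmod_ge_0]. rewrite !Rsqr_pow2, Cmod_one_minus_cexp_sqr.
    assert (H2 : 0 <= (1 - Cmod (cexp w)) ^ 2) by (apply pow2_ge_0).
    assert (H3 : r ^ 2 * t ^ 2 <= Cmod (cexp w) * sin (PI * Re w / 2) ^ 2).
    { apply Rmult_le_compat; trivial; try apply pow2_ge_0. simpl. nra. }
    replace ((2 * r * t) ^ 2) with (4 * (r ^ 2 * t ^ 2)) by ring. lra.
Qed.

Lemma Cmod_polylog3_le s : Cmod s < 1 -> Cmod (polylog 3 s) <= 6 * / Cmod (Cminus 1 s) ^ 4.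
Proof.
  intro Hs. assert (Hne := one_minus_neq_0 s Hs).
  rewrite polylog_closed by trivial.
  rewrite Cmod_div, Cmod_pow by (apply Cpow_nz; trivial).
  apply Rmult_le_compat_r.
  { left. apply Rinv_0_lt_compat, pow_lt, Cmod_gt_0. trivial. }
  assert (H0 := Cmod_ge_0 s).
  eapply Rle_trans; [apply Cmod_triangle|].
  assert (H1 := Cmod_triangle s (Cmult 4 (Cpow s 2))).
  rewrite Cmod_mult, !Cmod_pow, Cmod_R, Rabs_pos_eq in * by lra.
  assert (Cmod s ^ 2 <= 1) by (simpl; nra). assert (Cmod s ^ 3 <= 1) by (simpl in *; nra). lra.
Qed.

(** It suffices to cancel the leading pole. The duplication formula carries a factor 16 = 2^4, so a
    singularity of order 3 already shrinks under it, whereas one of order 4 would not. *)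
Lemma lipschitz_singular_part : exists delta K, 0 < delta <= 1 /\ 0 <= K /\
  forall w, 0 < Im w -> Cmod w < delta ->
  Cmod (Cminus (Cmult (RtoC lip_const) (polylog 3 (cexp w))) (inv4 w)) <= K * / Cmod w ^ 3.
Proof.
  destruct cexp_taylor as (K & HK & Htay). assert (Hp := PI_RGT_0).
  (* Writing 1 - s = - pi i w (1 + eta), this radius ensures |eta| <= 1/2, and 16 bounds |1 +
     eta|^(-4). The summands in the second factor are the contributions of 1 - s and of eta to
     [br]. *)
  exists (Rmin 1 (PI / (2 * K))), (16 * (3 * PI + 15 * (K / PI))).
  assert (Hd : 0 < PI / (2 * K)) by (apply Rdiv_lt_0_compat; lra).
  assert (HKP : 0 < K / PI) by (apply Rdiv_lt_0_compat; lra).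
  split; [split; [apply Rmin_pos; lra|apply Rmin_l]|]. split; [lra|].
  intros w Hy Hw.
  assert (Hw1 : Cmod w < 1) by (apply Rlt_le_trans with (1 := Hw), Rmin_l).
  assert (Hw2 : Cmod w < PI / (2 * K)) by (apply Rlt_le_trans with (1 := Hw), Rmin_r).
  assert (Hw0 : w <> 0) by (apply Im_neq_0; lra).
  assert (Hwp : 0 < Cmod w) by (apply Cmod_gt_0; trivial).
  specialize (Htay w ltac:(lra)).
  assert (Hs := Cmod_cexp_lt_1 w Hy). rewrite polylog_closed by trivial.
  set (s := cexp w) in *.
  assert (HPI0 : RtoC PI <> 0) by (intro E; apply RtoC_inj in E; lra).
  assert (HCi : Cmult Ci Ci = Copp 1) by (unfold Ci, Cmult, Copp, RtoC; simpl; f_equal; ring).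
  assert (HCi0 : Ci <> 0) by (intro E; rewrite E in HCi; apply (f_equal Re) in HCi;
     unfold Re in HCi; simpl in HCi; lra).
  set (D := Copp (Cmult (Cmult (RtoC PI) Ci) w)).
  assert (HD0 : D <> 0).
  { intro E. apply (f_equal Copp) in E. unfold D in E.
    replace (Copp (Copp (Cmult (Cmult (RtoC PI) Ci) w))) with (Cmult (Cmult (RtoC PI) Ci) w) in E by ring.
    revert E. replace (Copp 0) with (RtoC 0) by ring. repeat apply Cmult_neq_0; trivial. }
  assert (HDmod : Cmod D = PI * Cmod w).
  { unfold D. rewrite Cmod_opp, !Cmod_mult, Cmod_R, Cmod_Ci, Rabs_pos_eq by lra. ring. }
  set (eta := Cdiv (Cminus (Cminus 1 s) D) D).
  assert (Hd1 : Cminus 1 s = Cmult D (Cplus 1 eta)) by (unfold eta; field; trivial).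
  assert (Heta : Cmod eta <= K / PI * Cmod w).
  { unfold eta. rewrite Cmod_div, HDmod by trivial.
    replace (Cminus (Cminus 1 s) D) with (Copp (Cminus (Cminus s 1) (Cmult (Cmult (RtoC PI) Ci) w)))
      by (unfold D; ring).
    rewrite Cmod_opp. apply Rmult_le_reg_r with (PI * Cmod w); [nra|].
    replace (K / PI * Cmod w * (PI * Cmod w)) with (K * (Cmod w * Cmod w)) by (field; lra).
    unfold Rdiv. rewrite Rmult_assoc, Rinv_l, Rmult_1_r by nra. exact Htay. }
  assert (Heta2 : Cmod eta <= 1 / 2).
  { apply Rle_trans with (1 := Heta). apply Rle_trans with (K / PI * (PI / (2 * K))).
    - apply Rmult_le_compat_l; lra.
    - right. field. lra. }
  assert (Heta1 : 1 / 2 <= Cmod (Cplus 1 eta)).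
  { assert (H := Cmod_plus_ge 1 eta). rewrite Cmod_1 in H. lra. }
  assert (Hne : Cplus 1 eta <> 0) by (apply Cmod_gt_0; lra).
  (* This vanishes to first order at w = 0: at eta = 0 the second term is 1, and s^3 + 4 s^2 + s - 6
     = (s - 1)(s^2 + 5 s + 6). *)
  set (br := Cminus (Cdiv (Cplus (Cplus s (Cmult 4 (Cpow s 2))) (Cpow s 3)) 6) (Cpow (Cplus 1 eta) 4)).
  replace (Cminus _ _) with (Cmult (Cmult (inv4 w) (inv4 (Cplus 1 eta))) br).
  2: { rewrite Hd1. unfold br, lip_const, inv4, D. rewrite RtoC_div, RtoC_pow by lra.
       replace (Cpow (Cmult (Copp (Cmult (Cmult (RtoC PI) Ci) w)) (Cplus 1 eta)) 4)
         with (Cmult (Cmult (Cmult (Cmult Ci Ci) (Cmult Ci Ci)) (Cpow (RtoC PI) 4))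
                (Cpow (Cmult w (Cplus 1 eta)) 4)) by ring.
       rewrite HCi. field. repeat split; trivial; intro E; apply RtoC_inj in E; lra. }
  assert (Hbr : Cmod br <= (3 * PI + 15 * (K / PI)) * Cmod w).
  { replace br with (Cplus (Cmult (Cminus 1 s) (Cdiv (Copp (Cplus (Cplus (Cpow s 2) (Cmult 5 s)) 6)) 6))
        (Cmult eta (Copp (Cplus (Cplus (Cplus 4 (Cmult 6 eta)) (Cmult 4 (Cpow eta 2))) (Cpow eta 3))))).
    2: { unfold br. field. }
    eapply Rle_trans; [apply Cmod_triangle|]. rewrite !Cmod_mult.
    assert (H0 := Cmod_ge_0 s). assert (H0' := Cmod_ge_0 eta).
    assert (H1 : Cmod (Cminus 1 s) <= 3 / 2 * PI * Cmod w).
    { rewrite Hd1, Cmod_mult, HDmod.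
      assert (Cmod (Cplus 1 eta) <= 3 / 2).
      { eapply Rle_trans; [apply Cmod_triangle|]. rewrite Cmod_1. lra. }
      assert (0 <= PI * Cmod w) by nra.
      replace (3 / 2 * PI * Cmod w) with (PI * Cmod w * (3 / 2)) by ring.
      apply Rmult_le_compat_l; trivial. }
    assert (H2 : Cmod (Cdiv (Copp (Cplus (Cplus (Cpow s 2) (Cmult 5 s)) 6)) 6) <= 2).
    { rewrite Cmod_div by (intro E; apply RtoC_inj in E; lra).
      rewrite Cmod_opp, (Cmod_R 6), (Rabs_pos_eq 6) by lra.
      assert (Cmod (Cplus (Cplus (Cpow s 2) (Cmult 5 s)) 6) <= 12); [|lra].
      eapply Rle_trans; [apply Cmod_triangle|]. rewrite (Cmod_R 6), (Rabs_pos_eq 6) by lra.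
      assert (H := Cmod_triangle (Cpow s 2) (Cmult 5 s)).
      rewrite Cmod_mult, Cmod_pow, (Cmod_R 5), (Rabs_pos_eq 5) in H by lra.
      assert (Cmod s ^ 2 <= 1) by (simpl; nra). lra. }
    assert (H3 : Cmod (Copp (Cplus (Cplus (Cplus 4 (Cmult 6 eta)) (Cmult 4 (Cpow eta 2))) (Cpow eta 3))) <= 15).
    { rewrite Cmod_opp.
      eapply Rle_trans; [apply Cmod_triangle|].
      assert (E1 := Cmod_triangle (Cplus 4 (Cmult 6 eta)) (Cmult 4 (Cpow eta 2))).
      assert (E2 := Cmod_triangle 4 (Cmult 6 eta)).
      rewrite !Cmod_mult, !Cmod_pow, !Cmod_R, !Rabs_pos_eq in * by lra.
      assert (Cmod eta ^ 2 <= 1) by (simpl; nra). assert (Cmod eta ^ 3 <= 1) by (simpl in *; nra). lra. }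
    rewrite Rmult_plus_distr_r. apply Rplus_le_compat.
    - replace (3 * PI * Cmod w) with (3 / 2 * PI * Cmod w * 2) by field.
      apply Rmult_le_compat; trivial; apply Cmod_ge_0.
    - replace (15 * (K / PI) * Cmod w) with (K / PI * Cmod w * 15) by ring.
      apply Rmult_le_compat; trivial; apply Cmod_ge_0. }
  rewrite !Cmod_mult, !Cmod_inv4 by trivial.
  assert (H16 : / Cmod (Cplus 1 eta) ^ 4 <= 16).
  { replace 16 with (/ (1 / 2) ^ 4) by field. apply Rinv_le_contravar; [lra|]. apply pow_incr. lra. }
  replace (16 * (3 * PI + 15 * (K / PI)) * / Cmod w ^ 3)
    with (/ Cmod w ^ 4 * 16 * ((3 * PI + 15 * (K / PI)) * Cmod w)) by (field; lra).
  assert (0 < / Cmod w ^ 4) by (apply Rinv_0_lt_compat, pow_lt; trivial).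
  assert (0 < / Cmod (Cplus 1 eta) ^ 4) by (apply Rinv_0_lt_compat, pow_lt; lra).
  apply Rmult_le_compat; trivial; try apply Cmod_ge_0.
  - apply Rmult_le_pos; lra.
  - apply Rmult_le_compat_l; lra.
Qed.

Definition lip_diff (w : C) : C :=
  Cminus (even_sum w) (Cmult (RtoC lip_const) (polylog 3 (cexp w))).

(** Within [delta] of 0 the leading poles cancel; further away 1 - e^(pi i w) is bounded below, so
    each ingredient is bounded on its own. *)
Lemma lip_diff_bound : exists K, 0 <= K /\ forall w, 0 < Im w -> Rabs (Re w) <= 1 ->
  Cmod (lip_diff w) <= K * (1 + / Cmod w ^ 3).
Proof.
  destruct lipschitz_singular_part as (delta & K1 & Hd & HK1 & H1).
  destruct even_sum_strip_bound as (K2 & HK2 & H2).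
  destruct (one_minus_cexp_lower delta Hd) as (c & Hc & H3).
  assert (Hl := lip_const_pos).
  set (K3 := lip_const * (6 * / c ^ 4) + / delta ^ 4).
  assert (Hc4 : 0 < / c ^ 4) by (apply Rinv_0_lt_compat, pow_lt; trivial).
  assert (Hd4 : 0 < / delta ^ 4) by (apply Rinv_0_lt_compat, pow_lt; lra).
  assert (HK3 : 0 <= K3) by (unfold K3; nra).
  exists (K2 + K1 + K3). split; [lra|].
  intros w Hy Hx.
  assert (Hw0 : w <> 0) by (apply Im_neq_0; lra).
  assert (Hwp : 0 < Cmod w) by (apply Cmod_gt_0; trivial).
  assert (Hw3 : 0 < / Cmod w ^ 3) by (apply Rinv_0_lt_compat, pow_lt; trivial).
  replace (lip_diff w) with (Cplus (Cminus (even_sum w) (inv4 w))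
    (Copp (Cminus (Cmult (RtoC lip_const) (polylog 3 (cexp w))) (inv4 w)))) by (unfold lip_diff; ring).
  eapply Rle_trans; [apply Cmod_triangle|]. rewrite Cmod_opp.
  specialize (H2 w Hy Hx).
  assert (H : Cmod (Cminus (Cmult (RtoC lip_const) (polylog 3 (cexp w))) (inv4 w))
              <= K1 * / Cmod w ^ 3 + K3); [|nra].
  destruct (Rlt_or_le (Cmod w) delta) as [Hw|Hw].
  - specialize (H1 w Hy Hw). lra.
  - assert (Cmod (Cminus (Cmult (RtoC lip_const) (polylog 3 (cexp w))) (inv4 w)) <= K3); [|nra].
    unfold Cminus. eapply Rle_trans; [apply Cmod_triangle|].
    rewrite Cmod_opp, Cmod_mult, Cmod_R, Rabs_pos_eq, Cmod_inv4 by (trivial; lra).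
    apply Rplus_le_compat.
    + apply Rmult_le_compat_l; [lra|].
      eapply Rle_trans; [apply Cmod_polylog3_le, Cmod_cexp_lt_1; trivial|].
      apply Rmult_le_compat_l; [lra|].
      apply Rinv_le_contravar; [apply pow_lt; trivial|]. apply pow_incr. split; [lra|auto].
    + apply Rinv_le_contravar; [apply pow_lt; lra|]. apply pow_incr. lra.
Qed.

Lemma cexp_plus_1 w : cexp (Cplus w 1) = Copp (cexp w).
Proof. rewrite cexp_plus, cexp_1. ring. Qed.

Lemma lip_diff_period w : 0 < Im w -> lip_diff (Cplus w 2) = lip_diff w.
Proof.
  intro Hw. unfold lip_diff. rewrite even_sum_period by trivial.
  replace (Cplus w 2) with (Cplus (Cplus w 1) 1).
  - rewrite !cexp_plus_1. do 3 f_equal. ring.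
  - replace (RtoC 2) with (Cplus 1 1) by (rewrite <- RtoC_plus; f_equal; ring). ring.
Qed.

Lemma polylog3_duplication s : Cmod s < 1 ->
  Cplus (polylog 3 s) (polylog 3 (Copp s)) = Cmult 16 (polylog 3 (Cmult s s)).
Proof.
  intro Hs. assert (H0 := Cmod_ge_0 s).
  assert (Hs2 : Cmod (Cmult s s) < 1) by (rewrite Cmod_mult; nra).
  assert (Hs' : Cmod (Copp s) < 1) by (rewrite Cmod_opp; trivial).
  rewrite !polylog_closed by trivial.
  assert (H1 := one_minus_neq_0 _ Hs). assert (H2 := one_minus_neq_0 _ Hs').
  assert (H3 := one_minus_neq_0 _ Hs2).
  replace (Cminus 1 (Cmult s s)) with (Cmult (Cminus 1 s) (Cminus 1 (Copp s))) in * by ring.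
  field. auto.
Qed.

Lemma lip_diff_duplication w : 0 < Im w ->
  Cplus (lip_diff w) (lip_diff (Cplus w 1)) = Cmult 16 (lip_diff (Cmult 2 w)).
Proof.
  intro Hw. unfold lip_diff. rewrite cexp_plus_1.
  destruct (odd_sum_shift w Hw) as [<- _].
  replace (cexp (Cmult 2 w)) with (Cmult (cexp w) (cexp w)).
  - transitivity (Cminus (Cplus (even_sum w) (odd_sum w))
      (Cmult (RtoC lip_const) (Cplus (polylog 3 (cexp w)) (polylog 3 (Copp (cexp w)))))); [ring|].
    rewrite even_odd_duplication, polylog3_duplication by (trivial; apply Cmod_cexp_lt_1; trivial). ring.
  - rewrite <- cexp_plus. f_equal.
    replace (RtoC 2) with (Cplus 1 1) by (rewrite <- RtoC_plus; f_equal; ring). ring.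
Qed.

(* Herglotz' trick: of the two arguments v and v + 1 in the duplication formula at most one
   is close to the pole, so that a bound of this shape improves itself. *)
Lemma lip_diff_contract K : 0 <= K ->
  (forall w, 0 < Im w -> Rabs (Re w) <= 1 -> Cmod (lip_diff w) <= K * (1 + / Cmod w ^ 3)) ->
  (forall w, 0 < Im w -> Rabs (Re w) <= 1 -> Cmod (lip_diff w) <= 5 / 8 * K * (1 + / Cmod w ^ 3)).
Proof.
  intros HK H w Hy Hx.
  assert (Hw0 : w <> 0) by (apply Im_neq_0; lra).
  assert (Hwp : 0 < Cmod w) by (apply Cmod_gt_0; trivial).
  set (v := Cmult (RtoC (/ 2)) w).
  assert (Ev : Cmult 2 v = w).
  { unfold v. rewrite Cmult_assoc, <- RtoC_mult. replace (2 * / 2) with 1 by field. ring. }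
  assert (Hvi : Im v = Im w / 2) by (unfold v; rewrite Im_scal; field).
  assert (Hvr : Re v = Re w / 2) by (unfold v; destruct w; unfold Re; simpl; field).
  assert (Hvm : Cmod v = Cmod w / 2) by (unfold v; rewrite Cmod_mult, Cmod_R, Rabs_pos_eq by lra; field).
  apply Rabs_le_between in Hx.
  assert (H1 : Cmod (lip_diff v) <= K * (1 + 8 * / Cmod w ^ 3)).
  { replace (8 * / Cmod w ^ 3) with (/ Cmod v ^ 3) by (rewrite Hvm; field; lra).
    apply H; [lra|]. apply Rabs_le_between. lra. }
  assert (Hfar : forall u, 0 < Im u -> / 2 <= Rabs (Re u) <= 1 -> Cmod (lip_diff u) <= K * 9).
  { intros u Hu Hur. eapply Rle_trans; [apply H; tauto|].
    apply Rmult_le_compat_l; trivial.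
    assert (/ Cmod u ^ 3 <= / (/ 2) ^ 3).
    { apply Rinv_le_contravar; [apply pow_lt; lra|]. apply pow_incr. split; [lra|].
      apply Rle_trans with (1 := proj1 Hur), re_le_Cmod. }
    replace (/ (/ 2) ^ 3) with 8 in * by field. lra. }
  assert (H2 : Cmod (lip_diff (Cplus v 1)) <= K * 9).
  { destruct (Rle_or_lt (Re w) 0) as [Hs|Hs].
    - apply Hfar; [destruct v; unfold Im in *; simpl in *; lra|].
      replace (Re (Cplus v 1)) with (Re v + 1) by reflexivity. rewrite Rabs_pos_eq; lra.
    - replace (lip_diff (Cplus v 1)) with (lip_diff (Cminus v 1)).
      + apply Hfar; [destruct v; unfold Im in *; simpl in *; lra|].
        replace (Re (Cminus v 1)) with (Re v - 1) by reflexivity. rewrite Rabs_left; lra.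
      + rewrite <- lip_diff_period by (destruct v; unfold Im in *; simpl in *; lra). f_equal.
        replace (RtoC 2) with (Cplus 1 1) by (rewrite <- RtoC_plus; f_equal; ring). ring. }
  assert (Hd := lip_diff_duplication v ltac:(lra)). rewrite Ev in Hd.
  assert (H3 : 16 * Cmod (lip_diff w) <= Cmod (lip_diff v) + Cmod (lip_diff (Cplus v 1))).
  { replace 16 with (Cmod 16) by (rewrite Cmod_R; apply Rabs_pos_eq; lra).
    rewrite <- Cmod_mult, <- Hd. apply Cmod_triangle. }
  assert (0 < / Cmod w ^ 3) by (apply Rinv_0_lt_compat, pow_lt; trivial). nra.
Qed.

(** The contraction can be iterated. Its factor 5/8 is 10/16: the argument near the pole contributes
    K (1 + 8 |w|^(-3)) and the far one 9 K, against the factor 16 of the duplication formula. *)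
Lemma lip_diff_strip w : 0 < Im w -> Rabs (Re w) <= 1 -> lip_diff w = 0.
Proof.
  intros Hy Hx. destruct lip_diff_bound as (K & HK & H).
  assert (Hn : forall n w, 0 < Im w -> Rabs (Re w) <= 1 ->
     Cmod (lip_diff w) <= (5 / 8) ^ n * K * (1 + / Cmod w ^ 3)).
  { induction n as [|n IH]; intros u Hu Hu'.
    - simpl. rewrite Rmult_1_l. auto.
    - replace ((5 / 8) ^ S n * K) with (5 / 8 * ((5 / 8) ^ n * K)) by (simpl; ring).
      apply lip_diff_contract; trivial. apply Rmult_le_pos; trivial. apply pow_le; lra. }
  apply Cmod_eq_0. apply Rle_antisym; [|apply Cmod_ge_0].
  apply Rnot_lt_le. intro Hpos.
  set (B := K * (1 + / Cmod w ^ 3)).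
  assert (HB : 0 < B + 1).
  { assert (Hwp : 0 < Cmod w) by (apply Cmod_gt_0, Im_neq_0; lra).
    assert (0 < / Cmod w ^ 3) by (apply Rinv_0_lt_compat, pow_lt; trivial). unfold B. nra. }
  destruct (pow_lt_1_zero (5 / 8) ltac:(rewrite Rabs_pos_eq; lra) (Cmod (lip_diff w) / (B + 1)))
    as [N HN]; [apply Rdiv_lt_0_compat; trivial|].
  specialize (HN N (le_n N)). rewrite Rabs_pos_eq in HN by (apply pow_le; lra).
  specialize (Hn N w Hy Hx). rewrite Rmult_assoc in Hn. fold B in Hn.
  apply Rmult_lt_compat_r with (r := B + 1) in HN; trivial.
  replace (Cmod (lip_diff w) / (B + 1) * (B + 1)) with (Cmod (lip_diff w)) in HN by (field; lra).
  assert (0 <= (5 / 8) ^ N) by (apply pow_le; lra). nra.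
Qed.

Lemma lip_diff_period_nat n w : 0 < Im w -> lip_diff (Cplus w (RtoC (2 * INR n))) = lip_diff w.
Proof.
  revert w. induction n as [|n IH]; intros w Hw.
  - simpl INR. rewrite Rmult_0_r, Cplus_0_r. trivial.
  - rewrite S_INR. replace (Cplus w (RtoC (2 * (INR n + 1)))) with (Cplus (Cplus w (RtoC (2 * INR n))) 2).
    + rewrite lip_diff_period; auto. destruct w; unfold Im in *; simpl in *; lra.
    + rewrite Rmult_plus_distr_l, Rmult_1_r, RtoC_plus. ring.
Qed.

Lemma lipschitz_even w : 0 < Im w ->
  even_sum w = Cmult (RtoC lip_const) (polylog 3 (cexp w)).
Proof.
  intro Hw.
  assert (H : lip_diff w = 0).
  (* Translation by the even integer - 2 k brings w into the strip. *)
  { set (k := Int_part ((Re w + 1) / 2)).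
    assert (Hk := base_Int_part ((Re w + 1) / 2)). fold k in Hk.
    set (v := Cplus w (RtoC (- (2 * IZR k)))).
    assert (Hv : lip_diff v = 0).
    { apply lip_diff_strip; [unfold v; destruct w; unfold Im in *; simpl in *; lra|].
      replace (Re v) with (Re w + - (2 * IZR k)) by reflexivity. apply Rabs_le_between. lra. }
    rewrite <- Hv. destruct (Z_le_gt_dec 0 k) as [Hk0|Hk0].
    - rewrite <- (lip_diff_period_nat (Z.to_nat k) v)
        by (unfold v; destruct w; unfold Im in *; simpl in *; lra).
      rewrite INR_IZR_INZ, Z2Nat.id by trivial. unfold v. f_equal.
      rewrite RtoC_opp. ring.
    - unfold v. replace (- (2 * IZR k)) with (2 * INR (Z.to_nat (- k))).
      + rewrite lip_diff_period_nat; trivial.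
      + rewrite INR_IZR_INZ, Z2Nat.id by lia. rewrite opp_IZR. ring. }
  unfold lip_diff in H. apply Ceq_minus. exact H.
Qed.

Lemma lipschitz_odd w : 0 < Im w ->
  odd_sum w = Cmult (RtoC lip_const) (polylog 3 (Copp (cexp w))).
Proof.
  intro Hw. destruct (odd_sum_shift w Hw) as [-> _].
  rewrite lipschitz_even, cexp_plus_1; trivial. destruct w; unfold Im in *; simpl in *; lra.
Qed.

Lemma inv4_Cinv w : w <> RtoC 0 -> inv4 w = Cpow (Cinv w) 4.
Proof. intro H. unfold inv4. symmetry. apply Cpow_inv. trivial. Qed.

(** With p = 1/a and r = 1/m, p^4 - r^4 = (p - r)(p^3 + p^2 r + p r^2 + r^3) and p - r = (m - a) p
    r. The factor p r gives 1/m^2; the four terms of the other factor are at most 1 each. *)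
Lemma inv4_near (a : C) (m y : R) : 1 <= m -> 0 <= y -> m <= Cmod a -> Cmod (Cminus a (RtoC m)) <= y ->
  Cmod (Cminus (inv4 a) (inv4 (RtoC m))) <= 4 * y * / m ^ 2.
Proof.
  intros Hm Hy Ha Ham.
  assert (Ha0 : a <> 0) by (apply Cmod_gt_0; lra).
  assert (Hm0 : RtoC m <> 0) by (intro E; apply RtoC_inj in E; lra).
  rewrite !inv4_Cinv by trivial. set (p := Cinv a). set (r := Cinv (RtoC m)).
  assert (Hp : Cmod p <= / m) by (unfold p; rewrite Cmod_inv by trivial; apply Rinv_le_contravar; lra).
  assert (Hr : Cmod r = / m) by (unfold r; rewrite Cmod_inv, Cmod_R, Rabs_pos_eq by (trivial; lra); trivial).
  assert (Hm1 : 0 < / m <= 1).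
  { split; [apply Rinv_0_lt_compat; lra|]. rewrite <- Rinv_1. apply Rinv_le_contravar; lra. }
  replace (Cminus (Cpow p 4) (Cpow r 4)) with
    (Cmult (Cmult (Copp (Cminus a (RtoC m))) (Cmult p r))
       (Cplus (Cplus (Cpow p 3) (Cmult (Cpow p 2) r)) (Cplus (Cmult p (Cpow r 2)) (Cpow r 3)))).
  2: { unfold p, r. field. auto. }
  rewrite !Cmod_mult, Cmod_opp. assert (Hp0 := Cmod_ge_0 p).
  assert (H1 : Cmod p * Cmod r <= / m ^ 2).
  { rewrite Hr. replace (/ m ^ 2) with (/ m * / m) by (field; lra). apply Rmult_le_compat_r; lra. }
  assert (H2 : Cmod (Cplus (Cplus (Cpow p 3) (Cmult (Cpow p 2) r)) (Cplus (Cmult p (Cpow r 2)) (Cpow r 3))) <= 4).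
  { eapply Rle_trans; [apply Cmod_triangle|].
    assert (E1 := Cmod_triangle (Cpow p 3) (Cmult (Cpow p 2) r)).
    assert (E2 := Cmod_triangle (Cmult p (Cpow r 2)) (Cpow r 3)).
    rewrite !Cmod_mult, !Cmod_pow, Hr in *.
    assert (Hpow : forall x n, 0 <= x <= 1 -> 0 <= x ^ n <= 1).
    { intros x n Hx. split; [apply pow_le; lra|]. rewrite <- (pow1 n). apply pow_incr. lra. }
    assert (P3 := Hpow (Cmod p) 3%nat ltac:(lra)). assert (P2 := Hpow (Cmod p) 2%nat ltac:(lra)).
    assert (R3 := Hpow (/ m) 3%nat ltac:(lra)). assert (R2 := Hpow (/ m) 2%nat ltac:(lra)).
    assert (Cmod p ^ 2 * / m <= 1 * 1) by (apply Rmult_le_compat; lra).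
    assert (Cmod p * (/ m) ^ 2 <= 1 * 1) by (apply Rmult_le_compat; lra). lra. }
  replace (4 * y * / m ^ 2) with (y * / m ^ 2 * 4) by ring.
  apply Rmult_le_compat; trivial; try apply Cmod_ge_0.
  - apply Rmult_le_pos; [apply Cmod_ge_0|]. apply Rmult_le_pos; apply Cmod_ge_0.
  - apply Rmult_le_compat; trivial; try apply Cmod_ge_0. apply Rmult_le_pos; apply Cmod_ge_0.
Qed.

(** Half the part of the lattice sum with first index 0; it provides the constant term of
    [gamma]. *)
Definition odd_zeta4 : C := Csum (fun k => inv4 (RtoC (INR (2 * k + 1)))).

Lemma summable_odd_zeta4 : summable (fun k => inv4 (RtoC (INR (2 * k + 1)))).
Proof.
  apply summable_le with (2 := ex_series_inv_sqr). intro k.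
  assert (H : 1 <= INR (S k)) by (rewrite <- INR_1; apply le_INR; lia).
  assert (H1 : INR (S k) <= INR (2 * k + 1)) by (apply le_INR; lia).
  rewrite Cmod_inv4 by (intro E; apply RtoC_inj in E; lra).
  rewrite Cmod_R, Rabs_pos_eq by lra.
  apply Rinv_le_contravar; [apply pow_lt; lra|].
  apply Rle_trans with (INR (S k) ^ 4); [apply Rle_pow; trivial; lia|apply pow_incr; lra].
Qed.

Lemma odd_sum_near_0 y : 0 < y ->
  Cmod (Cminus (odd_sum (0, y)) (Cmult 2 odd_zeta4)) <= 8 * y * Series (fun k => / INR (S k) ^ 2).
Proof.
  intro Hy.
  assert (H1 : summable (fun k => pair4 (0, y) (2 * k + 1))).
  { apply (summable_pair4 (0, y) (fun k => 2 * k + 1)%nat); [exact Hy|intro; cbn beta; lia]. }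
  assert (H2 := summable_odd_zeta4).
  replace (Cminus (odd_sum (0, y)) (Cmult 2 odd_zeta4))
    with (Csum (fun k => Cplus (pair4 (0, y) (2 * k + 1)) (Cmult (-2) (inv4 (RtoC (INR (2 * k + 1))))))).
  2: { rewrite Csum_plus, Csum_scal by auto using summable_scal. unfold odd_sum, odd_zeta4.
       replace (RtoC (-2)) with (Copp 2) by (rewrite <- RtoC_opp; f_equal). ring. }
  rewrite <- Series_scal_l. apply Csum_bound; [|apply ex_series_scal_R, ex_series_inv_sqr].
  intro k. set (m := INR (2 * k + 1)).
  assert (H : 1 <= INR (S k)) by (rewrite <- INR_1; apply le_INR; lia).
  assert (Hm : INR (S k) <= m) by (apply le_INR; lia).
  unfold pair4. fold m.
  replace (Cplus _ _) with (Cplus (Cminus (inv4 (Cplus (0, y) (RtoC m))) (inv4 (RtoC m)))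
    (Cminus (inv4 (Cminus (RtoC m) (0, y))) (inv4 (RtoC m)))).
  2: { rewrite <- (inv4_opp (Cminus (0, y) (RtoC m))).
       replace (Copp (Cminus (0, y) (RtoC m))) with (Cminus (RtoC m) (0, y)) by ring.
       replace (RtoC (-2)) with (Copp 2) by (rewrite <- RtoC_opp; f_equal). ring. }
  assert (Hle : 4 * y * / m ^ 2 <= 4 * y * / INR (S k) ^ 2).
  { apply Rmult_le_compat_l; [lra|]. apply Rinv_le_contravar; [apply pow_lt; lra|apply pow_incr; lra]. }
  assert (Hy' : Cmod (0, y) <= y).
  { eapply Rle_trans; [apply Cmod_le_Re_Im|]. unfold Re, Im; simpl. rewrite Rabs_R0, Rabs_pos_eq; lra. }
  eapply Rle_trans; [apply Cmod_triangle|].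
  replace (8 * y * / INR (S k) ^ 2) with (4 * y * / INR (S k) ^ 2 + 4 * y * / INR (S k) ^ 2) by ring.
  apply Rplus_le_compat; apply Rle_trans with (2 := Hle); apply inv4_near; try lra.
  - apply Rle_trans with (2 := re_le_Cmod _). change (m <= Rabs (0 + m)).
    rewrite Rplus_0_l. apply Rle_abs.
  - replace (Cminus (Cplus (0, y) (RtoC m)) (RtoC m)) with (RtoC 0 + (0, y))%C by ring.
    rewrite Cplus_0_l. trivial.
  - apply Rle_trans with (2 := re_le_Cmod _). change (m <= Rabs (m + - 0)).
    replace (m + - 0) with m by ring. apply Rle_abs.
  - replace (Cminus (Cminus (RtoC m) (0, y)) (RtoC m)) with (Copp (0, y)) by ring.
    rewrite Cmod_opp. trivial.
Qed.

(** At s = -1 the closed form takes the value (-1 + 4 - 1)/16 = 1/8. *)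
Lemma polylog3_near_minus_1 rho : 0 <= rho < 1 ->
  Cmod (Cminus (polylog 3 (RtoC (- rho))) (RtoC (1 / 8))) <= 2 * (1 - rho).
Proof.
  intro Hr.
  rewrite polylog_closed by (rewrite Cmod_R, Rabs_Ropp, Rabs_pos_eq; lra).
  replace (Cminus _ _) with (RtoC (- ((1 - rho) ^ 2 * (1 + 14 * rho + rho ^ 2) / (8 * (1 + rho) ^ 4)))).
  - rewrite Cmod_R, Rabs_Ropp.
    assert (H4 : 1 <= (1 + rho) ^ 4) by (apply pow_R1_Rle; lra).
    rewrite Rabs_pos_eq.
    + apply Rmult_le_reg_r with (8 * (1 + rho) ^ 4); [lra|].
      replace ((1 - rho) ^ 2 * (1 + 14 * rho + rho ^ 2) / (8 * (1 + rho) ^ 4) * (8 * (1 + rho) ^ 4))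
        with ((1 - rho) ^ 2 * (1 + 14 * rho + rho ^ 2)) by (field; lra).
      assert (H5 : (1 - rho) ^ 2 * (1 + 14 * rho + rho ^ 2) <= (1 - rho) * 16).
      { replace ((1 - rho) ^ 2) with ((1 - rho) * (1 - rho)) by ring. rewrite Rmult_assoc.
        apply Rmult_le_compat_l; nra. }
      nra.
    + apply Rmult_le_pos; [apply Rmult_le_pos; [apply pow2_ge_0|nra]|].
      left; apply Rinv_0_lt_compat; lra.
  - assert (H8 : 1 + rho <> 0) by lra.
    assert (Hne : RtoC (1 + rho) <> 0) by (intro E; apply RtoC_inj in E; lra).
    replace (Cminus 1 (RtoC (- rho))) with (RtoC (1 + rho)) by (rewrite RtoC_plus, RtoC_opp; ring).
    rewrite !RtoC_opp, !RtoC_div, !RtoC_mult, !RtoC_pow, !RtoC_plus, RtoC_minus, !RtoC_mult, RtoC_pow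
      by (try apply Rmult_integral_contrapositive; try split; try apply pow_nonzero; lra).
    rewrite RtoC_plus in Hne. field. trivial.
Qed.

(** Lipschitz' formula over the odd integers at w = i y, with y tending to 0: the left side tends to
    2 [odd_zeta4] and the right side to [lip_const] / 8. The value is pi^4/96. *)
Lemma odd_zeta4_value : odd_zeta4 = RtoC (lip_const / 16).
Proof.
  set (D := Cmod (Cminus (Cmult 2 odd_zeta4) (RtoC (lip_const / 8)))).
  assert (Hl := lip_const_pos). assert (Hp := PI_RGT_0).
  set (S2 := Series (fun k => / INR (S k) ^ 2)).
  assert (HS : 0 <= S2).
  { apply Series_nonneg; [|apply ex_series_inv_sqr]. intro k. left.
    apply Rinv_0_lt_compat, pow_lt, lt_0_INR. lia. }
  set (B := 8 * S2 + lip_const * (2 * PI)).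
  assert (HD : forall y, 0 < y -> D <= B * y).
  { intros y Hy. set (rho := exp (- PI * y)).
    assert (Hrho : 0 <= rho < 1).
    { split; [left; apply exp_pos|]. rewrite <- exp_0. apply exp_increasing. nra. }
    assert (H1 := odd_sum_near_0 y Hy). fold S2 in H1.
    rewrite lipschitz_odd in H1 by exact Hy.
    assert (Ec : cexp (0, y) = RtoC rho).
    { unfold cexp, Re, Im, RtoC; simpl. rewrite Rmult_0_r, cos_0, sin_0. unfold rho. f_equal; ring. }
    rewrite Ec, <- RtoC_opp in H1.
    assert (H2 := polylog3_near_minus_1 rho Hrho).
    assert (H3 : 1 - rho <= PI * y).
    { unfold rho. assert (H := exp_ineq1_le (- PI * y)). lra. }
    unfold D.
    replace (Cminus (Cmult 2 odd_zeta4) (RtoC (lip_const / 8))) with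
      (Cminus (Cmult (RtoC lip_const) (Cminus (polylog 3 (RtoC (- rho))) (RtoC (1 / 8))))
         (Cminus (Cmult (RtoC lip_const) (polylog 3 (RtoC (- rho)))) (Cmult 2 odd_zeta4))).
    2: { replace (lip_const / 8) with (lip_const * (1 / 8)) by field. rewrite RtoC_mult. ring. }
    unfold Cminus at 1. eapply Rle_trans; [apply Cmod_triangle|].
    rewrite Cmod_opp, Cmod_mult, Cmod_R, Rabs_pos_eq by lra.
    unfold B. assert (lip_const * Cmod (Cminus (polylog 3 (RtoC (- rho))) (RtoC (1 / 8)))
      <= lip_const * (2 * (PI * y))) by (apply Rmult_le_compat_l; lra). lra. }
  assert (HD0 : D = 0).
  { apply Rle_antisym; [|apply Cmod_ge_0]. apply Rnot_lt_le. intro Hpos.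
    assert (HB : 0 <= B) by (unfold B; nra).
    (* [D <= B * y] holds for all positive [y]; this choice makes the right side at most D/2. *)
    specialize (HD (D / (2 * (B + 1))) ltac:(apply Rdiv_lt_0_compat; lra)).
    assert (E : B * (D / (2 * (B + 1))) <= D / 2).
    { replace (B * (D / (2 * (B + 1)))) with (D / 2 * (B / (B + 1))) by (field; lra).
      rewrite <- (Rmult_1_r (D / 2)) at 2. apply Rmult_le_compat_l; [lra|].
      apply Rmult_le_reg_r with (B + 1); [lra|]. unfold Rdiv. rewrite Rmult_assoc, Rinv_l by lra. lra. }
    lra. }
  apply Cmod_eq_0 in HD0. apply Ceq_minus in HD0.
  assert (H2 : RtoC 2 <> 0) by (intro E; apply RtoC_inj in E; lra).
  transitivity (Cmult (/ 2) (Cmult 2 odd_zeta4)); [field; trivial|].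
  rewrite HD0, <- RtoC_inv, <- RtoC_mult by lra. f_equal. field.
Qed.

(** * Modularity *)

Definition odd_lambert (s : C) : C := Csum (fun i => polylog 3 (Cpow s (2 * i + 1))).
Definition full_lambert (q : C) : C := Csum (fun j => polylog 3 (Copp (Cpow q (j + 1)))).

Definition alpha (z : C) : C := odd_lambert (cexp z).
Definition beta (z : C) : C := odd_lambert (Copp (cexp z)).
Definition gamma (z : C) : C := Cplus 1 (Cmult 16 (full_lambert (Cpow (cexp z) 2))).

Lemma Copp_pow_odd (s : C) i : Cpow (Copp s) (2 * i + 1) = Copp (Cpow s (2 * i + 1)).
Proof.
  replace (2 * i + 1)%nat with (S (i * 2)) by lia. rewrite !Cpow_S, (Nat.mul_comm i 2), !Cpow_mult_r.
  replace (Cpow (Copp s) 2) with (Cpow s 2) by ring. ring.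
Qed.

Lemma Im_nat_pos n z : (0 < n)%nat -> 0 < Im z -> 0 < Im (Cmult (RtoC (INR n)) z).
Proof. intros Hn Hz. rewrite Im_scal. apply Rmult_lt_0_compat; [apply lt_0_INR|]; trivial. Qed.

Lemma alpha_even_sum z : 0 < Im z ->
  (forall i, even_sum (Cmult (RtoC (INR (2 * i + 1))) z) =
     Cmult (RtoC lip_const) (polylog 3 (Cpow (cexp z) (2 * i + 1)))).
Proof.
  intros Hz i. rewrite lipschitz_even, cexp_nat_mult; trivial. apply Im_nat_pos; trivial. lia.
Qed.

Lemma beta_odd_sum z : 0 < Im z ->
  (forall i, odd_sum (Cmult (RtoC (INR (2 * i + 1))) z) =
     Cmult (RtoC lip_const) (polylog 3 (Cpow (Copp (cexp z)) (2 * i + 1)))).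
Proof.
  intros Hz i. rewrite lipschitz_odd, cexp_nat_mult, Copp_pow_odd; trivial. apply Im_nat_pos; trivial. lia.
Qed.

Lemma gamma_odd_sum z : 0 < Im z ->
  (forall j, odd_sum (Cmult (RtoC (INR (2 * j + 2))) z) =
     Cmult (RtoC lip_const) (polylog 3 (Copp (Cpow (Cpow (cexp z) 2) (j + 1))))).
Proof.
  intros Hz i. rewrite lipschitz_odd, cexp_nat_mult, <- Cpow_mult_r; trivial.
  - do 4 f_equal. lia.
  - apply Im_nat_pos; trivial. lia.
Qed.

Lemma Im_neg_inv z : 0 < Im z -> 0 < Im (Copp (Cinv z)).
Proof.
  intro Hz. destruct z as [x y]. unfold Im in *; simpl in *.
  replace (- (- y / (x * (x * 1) + y * (y * 1)))) with (y / (x * x + y * y)) by (field; nra).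
  apply Rdiv_lt_0_compat; nra.
Qed.

(** Under z -> -1/z the indices m and n of the lattice change places, since - m/z + n = (n z -
    m)/z. *)
Lemma pair4_neg_inv z m n : 0 < Im z -> (0 < m)%nat -> (0 < n)%nat ->
  pair4 (Cmult (RtoC (INR m)) (Copp (Cinv z))) n =
  Cmult (Cpow z 4) (pair4 (Cmult (RtoC (INR n)) z) m).
Proof.
  intros Hz Hm Hn. assert (Hz0 : z <> 0) by (apply Im_neq_0; lra).
  assert (Hn0 : 0 < INR n) by (apply lt_0_INR; trivial).
  unfold pair4.
  assert (H1 : Cplus (Cmult (RtoC (INR n)) z) (RtoC (INR m)) <> 0).
  { apply Im_neq_0. rewrite Im_lin. nra. }
  assert (H2 : Cminus (Cmult (RtoC (INR n)) z) (RtoC (INR m)) <> 0).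
  { apply Im_neq_0. unfold Cminus. rewrite <- RtoC_opp, Im_lin. nra. }
  replace (Cplus (Cmult (RtoC (INR m)) (Copp (Cinv z))) (RtoC (INR n)))
    with (Cmult (Cinv z) (Cminus (Cmult (RtoC (INR n)) z) (RtoC (INR m)))) by (field; trivial).
  replace (Cminus (Cmult (RtoC (INR m)) (Copp (Cinv z))) (RtoC (INR n)))
    with (Cmult (Copp (Cinv z)) (Cplus (Cmult (RtoC (INR n)) z) (RtoC (INR m)))) by (field; trivial).
  set (p := Cplus _ (RtoC (INR m))) in *. set (q := Cminus _ (RtoC (INR m))) in *. clearbody p q.
  unfold inv4. field. auto.
Qed.

(** Absolute convergence, for interchanging the two summations. The value [c] = 2 serves [alpha] and
    [gamma], and [c] = 1 serves [beta]. *)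
Lemma pair4_double_sum z (c : nat) : 0 < Im z -> (0 < c)%nat ->
  (forall i, summable (fun k => pair4 (Cmult (RtoC (INR (2 * k + c))) z) (2 * i + 1))) /\
  ex_series (fun i => Series (fun k => Cmod (pair4 (Cmult (RtoC (INR (2 * k + c))) z) (2 * i + 1)))).
Proof.
  intros Hz Hc. destruct (inv4_lattice_bound z Hz) as (K & HK & H).
  apply summable_prod_bound with (b := fun i => 2 * K * / INR (S i) ^ 2) (c := fun k => / INR (S k) ^ 2).
  2: apply ex_series_scal_R, ex_series_inv_sqr.
  2: apply ex_series_inv_sqr.
  intros i k.
  assert (Hinv : forall a m, (S a <= m)%nat -> 0 < / INR m ^ 2 <= / INR (S a) ^ 2).
  { intros a m Ham. assert (0 < INR (S a)) by (apply lt_0_INR; lia).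
    assert (INR (S a) <= INR m) by (apply le_INR; trivial).
    split; [apply Rinv_0_lt_compat, pow_lt; lra|].
    apply Rinv_le_contravar; [apply pow_lt; lra|apply pow_incr; lra]. }
  assert (H1 := Hinv i (2 * i + 1)%nat ltac:(lia)). assert (H2 := Hinv k (2 * k + c)%nat ltac:(lia)).
  assert (Hm : INR (2 * i + 1) <> 0) by (apply not_0_INR; lia).
  assert (Hn : INR (2 * k + c) <> 0) by (apply not_0_INR; lia).
  set (m := INR (2 * i + 1)) in *. set (n := INR (2 * k + c)) in *.
  assert (H3 := H n m Hn Hm). assert (H4 := H n (- m) Hn ltac:(lra)).
  replace ((- m) ^ 2) with (m ^ 2) in H4 by ring. rewrite RtoC_opp in H4.
  unfold pair4. fold m. eapply Rle_trans; [apply Cmod_triangle|].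
  assert (H5 : K * (/ n ^ 2 * / m ^ 2) <= K * (/ INR (S k) ^ 2 * / INR (S i) ^ 2)).
  { apply Rmult_le_compat_l; trivial. apply Rmult_le_compat; lra. }
  unfold Cminus. lra.
Qed.

Lemma summable_unscale (c : C) (f g : nat -> C) : c <> 0 ->
  (forall i, g i = Cmult c (f i)) -> summable g -> summable f.
Proof.
  intros Hc E H. apply summable_ext with (fun i => Cmult (Cinv c) (g i)).
  - intro i. rewrite E. field. trivial.
  - apply summable_scal, H.
Qed.

Lemma lip_const_neq_0 : RtoC lip_const <> 0.
Proof. intro E. apply RtoC_inj in E. assert (H := lip_const_pos). lra. Qed.

(** Transposition takes (odd, even) indices to (even, odd) ones. The column n = 0, which is the
    separate term of [even_sum], becomes the row of index 0 and contributes [odd_zeta4]; the factor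
    16 is the ratio of [lip_const] to it. *)
Lemma alpha_neg_inv z : 0 < Im z ->
  Cmult 16 (alpha (Copp (Cinv z))) = Cmult (Cpow z 4) (gamma z).
Proof.
  intro Hz. assert (Hz' := Im_neg_inv z Hz). assert (Hl := lip_const_neq_0).
  assert (Hz0 : z <> 0) by (apply Im_neq_0; lra).
  destruct (pair4_double_sum z 2 Hz ltac:(lia)) as [H1 H2].
  destruct (fubini _ H1 H2) as (H3 & H4 & H5).
  assert (Hrows := summable_Csum _ H1 H2).
  assert (Hcols : summable (fun k => odd_sum (Cmult (RtoC (INR (2 * k + 2))) z))).
  { apply summable_le with (2 := H4). intro k. apply Cmod_Csum_le, H3. }
  assert (Hg : summable (fun j => polylog 3 (Copp (Cpow (Cpow (cexp z) 2) (j + 1)))))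
    by exact (summable_unscale _ _ _ Hl (gamma_odd_sum z Hz) Hcols).
  assert (Hev : forall i, even_sum (Cmult (RtoC (INR (2 * i + 1))) (Copp (Cinv z))) =
    Cmult (Cpow z 4) (Cplus (inv4 (RtoC (INR (2 * i + 1))))
       (Csum (fun k => pair4 (Cmult (RtoC (INR (2 * k + 2))) z) (2 * i + 1))))).
  { intro i. unfold even_sum. rewrite Cmult_plus_distr_l. f_equal.
    - assert (Hm : RtoC (INR (2 * i + 1)) <> 0).
      { intro E. apply RtoC_inj in E. apply (INR_eq _ 0) in E. lia. }
      unfold inv4. field. auto.
    - rewrite <- Csum_scal by apply H1. apply Csum_ext. intro k. apply pair4_neg_inv; trivial; lia. }
  assert (Ha : Cmult (RtoC lip_const) (alpha (Copp (Cinv z))) =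
    Cmult (Cpow z 4) (Cplus odd_zeta4 (Cmult (RtoC lip_const) (full_lambert (Cpow (cexp z) 2))))).
  { assert (Hsum : summable (fun i => Cplus (inv4 (RtoC (INR (2 * i + 1))))
       (Csum (fun k => pair4 (Cmult (RtoC (INR (2 * k + 2))) z) (2 * i + 1))))).
    { apply summable_plus; trivial. apply summable_odd_zeta4. }
    unfold alpha, odd_lambert, full_lambert. rewrite <- !Csum_scal; trivial.
    - rewrite (Csum_ext _ _ (fun i => eq_sym (alpha_even_sum _ Hz' i))), (Csum_ext _ _ Hev).
      rewrite Csum_scal by trivial. f_equal.
      rewrite Csum_plus by (trivial; apply summable_odd_zeta4). unfold odd_zeta4. f_equal.
      rewrite H5. apply Csum_ext. intro k. apply gamma_odd_sum. trivial.
    - apply (summable_unscale _ _ _ Hl (alpha_even_sum _ Hz')).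
      apply summable_ext with (1 := fun i => eq_sym (Hev i)). apply summable_scal, Hsum. }
  rewrite odd_zeta4_value in Ha. unfold gamma.
  rewrite RtoC_div in Ha by lra.
  transitivity (Cmult (Cdiv 16 (RtoC lip_const)) (Cmult (RtoC lip_const) (alpha (Copp (Cinv z))))).
  - field. trivial.
  - rewrite Ha. field. trivial.
Qed.

(** Pairs of odd indices are preserved by transposition, and no index is 0. *)
Lemma beta_neg_inv z : 0 < Im z ->
  beta (Copp (Cinv z)) = Cmult (Cpow z 4) (beta z).
Proof.
  intro Hz. assert (Hz' := Im_neg_inv z Hz). assert (Hl := lip_const_neq_0).
  assert (Hz0 : z <> 0) by (apply Im_neq_0; lra).
  destruct (pair4_double_sum z 1 Hz ltac:(lia)) as [H1 H2].
  destruct (fubini _ H1 H2) as (H3 & H4 & H5).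
  assert (Hrows := summable_Csum _ H1 H2).
  assert (Hcols : summable (fun k => odd_sum (Cmult (RtoC (INR (2 * k + 1))) z))).
  { apply summable_le with (2 := H4). intro k. apply Cmod_Csum_le, H3. }
  assert (Hb : summable (fun j => polylog 3 (Cpow (Copp (cexp z)) (2 * j + 1))))
    by exact (summable_unscale _ _ _ Hl (beta_odd_sum z Hz) Hcols).
  assert (Hod : forall i, odd_sum (Cmult (RtoC (INR (2 * i + 1))) (Copp (Cinv z))) =
    Cmult (Cpow z 4) (Csum (fun k => pair4 (Cmult (RtoC (INR (2 * k + 1))) z) (2 * i + 1)))).
  { intro i. unfold odd_sum.
    rewrite <- Csum_scal by apply H1. apply Csum_ext. intro k. apply pair4_neg_inv; trivial; lia. }
  assert (Ha : Cmult (RtoC lip_const) (beta (Copp (Cinv z))) =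
    Cmult (Cpow z 4) (Cmult (RtoC lip_const) (beta z))).
  { transitivity (Cmult (Cpow z 4) (Csum (fun k => odd_sum (Cmult (RtoC (INR (2 * k + 1))) z)))).
    - unfold beta, odd_lambert. rewrite <- Csum_scal.
      + rewrite (Csum_ext _ _ (fun i => eq_sym (beta_odd_sum _ Hz' i))), (Csum_ext _ _ Hod).
        rewrite Csum_scal by trivial. rewrite H5. reflexivity.
      + apply (summable_unscale _ _ _ Hl (beta_odd_sum _ Hz')).
        apply summable_ext with (1 := fun i => eq_sym (Hod i)). apply summable_scal. trivial.
    - f_equal. unfold beta, odd_lambert. rewrite <- Csum_scal by trivial.
      apply Csum_ext, beta_odd_sum. trivial. }
  transitivity (Cmult (Cinv (RtoC lip_const)) (Cmult (RtoC lip_const) (beta (Copp (Cinv z))))).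
  - field. trivial.
  - rewrite Ha. field. trivial.
Qed.

(** As [alpha] begins with s and [beta] with - s, the sign makes the expansion begin with + x. *)
Definition cusp_form (z : C) : C := Copp (Cmult (Cmult (alpha z) (beta z)) (gamma z)).

(** Since [alpha] and [gamma] are exchanged, the factors 16 and 1/16 cancel and each of the three
    series contributes z^4. *)
Lemma cusp_form_neg_inv z : 0 < Im z ->
  cusp_form (Copp (Cinv z)) = Cmult (Cpow z 12) (cusp_form z).
Proof.
  intro Hz. assert (Hz' := Im_neg_inv z Hz).
  assert (Hz0 : z <> 0) by (apply Im_neq_0; lra).
  assert (E1 := alpha_neg_inv z Hz). assert (E2 := alpha_neg_inv _ Hz').
  replace (Copp (Cinv (Copp (Cinv z)))) with z in E2 by (field; trivial).
  unfold cusp_form. rewrite beta_neg_inv by trivial.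
  assert (E3 : gamma (Copp (Cinv z)) = Cmult (Cpow z 4) (Cmult 16 (alpha z))).
  { rewrite E2. field. trivial. }
  assert (E4 : alpha (Copp (Cinv z)) = Cdiv (Cmult (Cpow z 4) (gamma z)) 16).
  { rewrite <- E1. field. }
  rewrite E3, E4. field.
Qed.

(** * Power series with integer coefficients *)

Definition zsum (f : nat -> Z) (n : nat) : Z := fold_right Z.add 0%Z (map f (seq 0 n)).

Lemma zsum_S f n : zsum f (S n) = (zsum f n + f n)%Z.
Proof.
  unfold zsum. rewrite seq_S, map_app, fold_right_app. simpl.
  generalize (map f (seq 0 n)) as l. intro l. rewrite Z.add_0_r.
  induction l as [|x l IH]; simpl; [ring|]. rewrite IH. ring.
Qed.

Lemma zsum_ext f g n : (forall i, (i < n)%nat -> f i = g i) -> zsum f n = zsum g n.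
Proof.
  intro H. unfold zsum. f_equal. apply map_ext_in. intros i Hi. apply H.
  apply in_seq in Hi. lia.
Qed.

Lemma zsum_opp f n : zsum (fun i => - f i)%Z n = (- zsum f n)%Z.
Proof. induction n as [|n IH]; [reflexivity|]. rewrite !zsum_S, IH. ring. Qed.

Lemma zsum_rev f n : zsum (fun i => f (n - i)%nat) (S n) = zsum f (S n).
Proof.
  assert (H : forall n f, zsum f (S n) = (f O + zsum (fun i => f (S i)) n)%Z).
  { intros k g. induction k as [|k IH]; [unfold zsum; simpl; ring|].
    rewrite zsum_S, IH, zsum_S. ring. }
  induction n as [|n IH]; [reflexivity|].
  rewrite (H (S n)), (zsum_S f), Nat.sub_0_r, Z.add_comm, <- IH. reflexivity.
Qed.

Lemma ZtoC_plus a b : ZtoC (a + b) = Cplus (ZtoC a) (ZtoC b).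
Proof. unfold ZtoC. rewrite plus_IZR. apply RtoC_plus. Qed.

Lemma ZtoC_mult a b : ZtoC (a * b) = Cmult (ZtoC a) (ZtoC b).
Proof. unfold ZtoC. rewrite mult_IZR. apply RtoC_mult. Qed.

Lemma ZtoC_opp a : ZtoC (- a) = Copp (ZtoC a).
Proof. unfold ZtoC. rewrite opp_IZR. apply RtoC_opp. Qed.

Lemma Cmod_ZtoC a : Cmod (ZtoC a) = Rabs (IZR a).
Proof. apply Cmod_R. Qed.

Lemma sum_n_zsum (f : nat -> Z) (c : C) n :
  @eq C (sum_n (fun i => Cmult (ZtoC (f i)) c) n) (Cmult (ZtoC (zsum f (S n))) c).
Proof.
  induction n as [|n IH].
  - unfold zsum; simpl. rewrite Z.add_0_r. apply (sum_O (fun i => Cmult (ZtoC (f i)) c)).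
  - rewrite sum_n_C_S, IH, (zsum_S f (S n)), ZtoC_plus. ring.
Qed.

Definition zpower (a : nat -> Z) (s : C) : C := Csum (fun n => Cmult (ZtoC (a n)) (Cpow s n)).

(** The radius of convergence is at least 1. *)
Definition geom_bounded (a : nat -> Z) : Prop :=
  forall r, 0 <= r < 1 -> ex_series (fun n => Rabs (IZR (a n)) * r ^ n).

Lemma Cmod_zterm a s n : Cmod (Cmult (ZtoC a) (Cpow s n)) = Rabs (IZR a) * Cmod s ^ n.
Proof. rewrite Cmod_mult, Cmod_pow, Cmod_ZtoC. trivial. Qed.

Lemma summable_zpower a s : geom_bounded a -> Cmod s < 1 ->
  summable (fun n => Cmult (ZtoC (a n)) (Cpow s n)).
Proof.
  intros Ha Hs. apply ex_series_ext with (fun n => Rabs (IZR (a n)) * Cmod s ^ n).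
  - intro n. symmetry. apply Cmod_zterm.
  - apply Ha. split; [apply Cmod_ge_0|trivial].
Qed.

(** Splitting r^n into two equal powers, one to keep a series convergent and one to spare, is how
    bounds with separated variables are found below. *)
Lemma sqrt_disc r : 0 <= r < 1 -> 0 <= sqrt r < 1 /\ r = sqrt r * sqrt r.
Proof.
  intro Hr. split; [split; [apply sqrt_pos|]|symmetry; apply sqrt_sqrt; lra].
  rewrite <- sqrt_1. apply sqrt_lt_1; lra.
Qed.

Lemma geom_bounded_terms a r : geom_bounded a -> 0 <= r < 1 ->
  exists B, 0 <= B /\ forall n, Rabs (IZR (a n)) * r ^ n <= B.
Proof.
  intros Ha Hr. specialize (Ha r Hr).
  assert (H0 : forall n, 0 <= Rabs (IZR (a n)) * r ^ n).
  { intro n. apply Rmult_le_pos; [apply Rabs_pos|apply pow_le; lra]. }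
  exists (Series (fun n => Rabs (IZR (a n)) * r ^ n)). split; [apply Series_nonneg; trivial|].
  intro n. eapply Rle_trans; [|apply (Series_ge_term _ n); trivial].
  apply (sum_n_ge_last (fun n => Rabs (IZR (a n)) * r ^ n)). trivial.
Qed.

Definition zconv (a b : nat -> Z) : nat -> Z :=
  fun n => zsum (fun i => a i * b (n - i)%nat)%Z (S n).

(** The Cauchy product as a triangular matrix: row i is the series of [b] shifted by i and
    multiplied by a_i, and column n sums to the coefficient of s^n. With r^2 = |s|, half of |s|^n
    bounds a_i b_(n-i) and the other half makes the sum over n converge. *)
Lemma zpower_conv_aux a b s : geom_bounded a -> geom_bounded b -> Cmod s < 1 ->
  summable (fun n => Cmult (ZtoC (zconv a b n)) (Cpow s n)) /\
  zpower (zconv a b) s = Cmult (zpower a s) (zpower b s).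
Proof.
  intros Ha Hb Hs. assert (Hs0 := Cmod_ge_0 s).
  destruct (sqrt_disc (Cmod s) ltac:(lra)) as [Hr Hrr]. set (r := sqrt (Cmod s)) in *.
  destruct (geom_bounded_terms b r Hb Hr) as (B & HB & HbB).
  set (u := fun i n => if Nat.leb i n then Cmult (ZtoC (a i * b (n - i)%nat)) (Cpow s n) else RtoC 0).
  destruct (summable_prod_bound u (fun i => B * (Rabs (IZR (a i)) * r ^ i)) (fun n => r ^ n)) as [H1 H2].
  { intros i n. assert (Hn := pow_le r n (proj1 Hr)). assert (Hi := pow_le r i (proj1 Hr)).
    assert (Hai := Rabs_pos (IZR (a i))).
    unfold u. destruct (Nat.leb_spec i n) as [Hin|Hin].
    - rewrite Cmod_zterm, Hrr, mult_IZR, Rabs_mult, Rpow_mult_distr.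
      replace (r ^ n * r ^ n) with (r ^ i * r ^ (n - i) * r ^ n)
        by (rewrite <- pow_add; do 2 f_equal; lia).
      replace (Rabs (IZR (a i)) * Rabs (IZR (b (n - i)%nat)) * (r ^ i * r ^ (n - i) * r ^ n))
        with ((Rabs (IZR (b (n - i)%nat)) * r ^ (n - i)) * (Rabs (IZR (a i)) * r ^ i) * r ^ n) by ring.
      apply Rmult_le_compat_r; trivial. apply Rmult_le_compat_r; auto. apply Rmult_le_pos; trivial.
    - rewrite Cmod_0. repeat (apply Rmult_le_pos; trivial). }
  { apply ex_series_scal_R, Ha, Hr. }
  { apply ex_series_geom. rewrite Rabs_pos_eq; lra. }
  destruct (fubini u H1 H2) as (H3 & H4 & H5).
  assert (Hcol : forall n, Csum (fun i => u i n) = Cmult (ZtoC (zconv a b n)) (Cpow s n)).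
  { intro n. rewrite (Csum_finite _ n).
    - unfold zconv. rewrite <- sum_n_zsum.
      apply (@sum_n_ext_loc C_AbelianMonoid). intros i Hi. unfold u.
      rewrite (proj2 (Nat.leb_le i n)) by trivial. reflexivity.
    - intros i Hi. unfold u. rewrite (proj2 (Nat.leb_gt i n)) by trivial. trivial. }
  assert (Hbs := summable_zpower b s Hb Hs).
  assert (Hrow : forall i, Csum (u i) = Cmult (zpower b s) (Cmult (ZtoC (a i)) (Cpow s i))).
  { intro i. destruct (Csum_reindex (fun j => i + j)%nat (u i)) as [_ <-].
    - intros; lia.
    - intros n Hn. unfold u. destruct (Nat.leb_spec i n) as [Hin|Hin]; trivial.
      exfalso. apply (Hn (n - i)%nat). lia.
    - apply (summable_subseq (fun j => i + j)%nat (u i)); [intros; lia|apply H1].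
    - rewrite Cmult_comm. unfold zpower. rewrite <- Csum_scal by trivial. apply Csum_ext. intro j. unfold u.
      rewrite (proj2 (Nat.leb_le i (i + j))) by lia.
      replace (i + j - i)%nat with j by lia. rewrite ZtoC_mult, Cpow_add_r. ring. }
  split.
  - apply summable_le with (2 := H4). intro n. rewrite <- Hcol. apply Cmod_Csum_le, H3.
  - unfold zpower at 1. rewrite <- (Csum_ext _ _ Hcol), <- H5, (Csum_ext _ _ Hrow).
    rewrite Csum_scal by (apply summable_zpower; trivial). apply Cmult_comm.
Qed.

Lemma geom_bounded_conv a b : geom_bounded a -> geom_bounded b -> geom_bounded (zconv a b).
Proof.
  intros Ha Hb r Hr. destruct (zpower_conv_aux a b (RtoC r) Ha Hb) as [H _].
  { rewrite Cmod_R, Rabs_pos_eq; lra. }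
  apply ex_series_ext with (2 := H). intro n.
  rewrite Cmod_zterm, Cmod_R, (Rabs_pos_eq r) by lra. trivial.
Qed.

Lemma zpower_conv a b s : geom_bounded a -> geom_bounded b -> Cmod s < 1 ->
  zpower (zconv a b) s = Cmult (zpower a s) (zpower b s).
Proof. apply zpower_conv_aux. Qed.

(** * Lambert series *)

(** The index j stands for the divisor j + 1. For n = 0 the divisibility test always succeeds; the
    sequences [d] used below vanish at 0, so that nothing is contributed. *)
Definition lambert_term (chi : nat -> bool) (d : nat -> Z) (n j : nat) : Z :=
  if chi (S j) && Nat.eqb (n mod S j) 0 then d (n / S j)%nat else 0%Z.

Definition lambert (chi : nat -> bool) (d : nat -> Z) (n : nat) : Z :=
  zsum (lambert_term chi d n) (S n).

(** Row j of the matrix is the series in s^(j+1), column n the divisor sum. A nonzero entry has j <=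
    n, so with r^2 = |s| one gets |s|^n <= r^j r^n, which separates the variables. *)
Lemma lambert_expansion chi d s :
  (forall k, Rabs (IZR (d k)) <= INR k ^ 3) -> Cmod s < 1 ->
  summable (fun n => Cmult (ZtoC (lambert chi d n)) (Cpow s n)) /\
  summable (fun j => if chi (S j) then zpower d (Cpow s (S j)) else RtoC 0) /\
  Csum (fun j => if chi (S j) then zpower d (Cpow s (S j)) else RtoC 0) = zpower (lambert chi d) s.
Proof.
  intros Hd Hs. assert (Hs0 := Cmod_ge_0 s).
  destruct (sqrt_disc (Cmod s) ltac:(lra)) as [Hr Hrr]. set (r := sqrt (Cmod s)) in *.
  assert (Hd0 : d O = 0%Z).
  { specialize (Hd O). simpl in Hd. rewrite Rmult_0_l in Hd.
    apply eq_IZR. apply Rabs_eq_0. apply Rle_antisym; [exact Hd|apply Rabs_pos]. }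
  set (u := fun j n => Cmult (ZtoC (lambert_term chi d n j)) (Cpow s n)).
  destruct (summable_prod_bound u (fun j => r ^ j) (fun n => INR n ^ 3 * r ^ n)) as [H1 H2].
  { intros j n. assert (Hn := pow_le r n (proj1 Hr)). assert (Hj := pow_le r j (proj1 Hr)).
    assert (Hn3 : 0 <= INR n ^ 3) by (apply pow_le, pos_INR).
    unfold u. rewrite Cmod_zterm. unfold lambert_term.
    assert (Hpos : 0 <= r ^ j * (INR n ^ 3 * r ^ n)) by (apply Rmult_le_pos; trivial; apply Rmult_le_pos; trivial).
    destruct (chi (S j)); [|simpl; rewrite Rabs_R0, Rmult_0_l; trivial].
    destruct (Nat.eqb_spec (n mod S j) 0) as [Hmod|]; [|simpl; rewrite Rabs_R0, Rmult_0_l; trivial].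
    cbn [andb]. destruct (Nat.eq_dec n 0) as [->|Hn0].
    { rewrite Nat.Div0.div_0_l, Hd0, Rabs_R0, Rmult_0_l. trivial. }
    assert (Hjn : (j <= n)%nat).
    { destruct (Nat.le_gt_cases j n); trivial. rewrite Nat.mod_small in Hmod; lia. }
    rewrite Hrr, Rpow_mult_distr.
    replace (r ^ j * (INR n ^ 3 * r ^ n)) with (INR n ^ 3 * (r ^ j * r ^ n)) by ring.
    apply Rmult_le_compat; [apply Rabs_pos|apply Rmult_le_pos; trivial| |].
    - eapply Rle_trans; [apply Hd|]. apply pow_incr. split; [apply pos_INR|].
      apply le_INR. apply Nat.Div0.div_le_upper_bound. nia.
    - apply Rmult_le_compat_r; trivial.
      replace n with (j + (n - j))%nat by lia. rewrite pow_add.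
      rewrite <- (Rmult_1_r (r ^ j)) at 2. apply Rmult_le_compat_l; trivial.
      rewrite <- (pow1 (n - j)). apply pow_incr. lra. }
  { apply ex_series_geom. rewrite Rabs_pos_eq; lra. }
  { apply ex_series_poly_geom. trivial. }
  destruct (fubini u H1 H2) as (H3 & H4 & H5).
  assert (Hcol : forall n, Csum (fun j => u j n) = Cmult (ZtoC (lambert chi d n)) (Cpow s n)).
  { intro n. rewrite (Csum_finite _ n).
    - unfold lambert. rewrite <- sum_n_zsum. reflexivity.
    - intros j Hj. unfold u, lambert_term. destruct (Nat.eq_dec n 0) as [->|Hn0].
      + rewrite Nat.Div0.div_0_l, Hd0. destruct (_ && _); unfold ZtoC; ring.
      + rewrite (Nat.mod_small n) by lia. destruct n; [lia|].
        rewrite andb_false_r. unfold ZtoC. ring. }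
  assert (Hrow : forall j, Csum (u j) = if chi (S j) then zpower d (Cpow s (S j)) else RtoC 0).
  { intro j. destruct (chi (S j)) eqn:Hchi.
    - destruct (Csum_reindex (fun k => S j * k)%nat (u j)) as [_ <-].
      + intros i k E. nia.
      + intros n Hn. unfold u, lambert_term.
        destruct (Nat.eqb_spec (n mod S j) 0) as [E|E].
        * exfalso. apply (Hn (n / S j)%nat). rewrite (Nat.div_mod_eq n (S j)) at 2. lia.
        * rewrite andb_false_r. unfold ZtoC. ring.
      + apply (summable_subseq (fun k => S j * k)%nat (u j)); [intros; nia|apply H1].
      + apply Csum_ext. intro k. unfold u, lambert_term. rewrite Hchi.
        rewrite (Nat.mul_comm (S j) k), Nat.Div0.mod_mul, Nat.div_mul by lia.
        cbn [andb Nat.eqb]. rewrite (Nat.mul_comm k), Cpow_mult_r. reflexivity.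
    - rewrite (Csum_finite _ O); [rewrite sum_O|intros n _]; unfold u, lambert_term; rewrite Hchi;
        cbn [andb]; unfold ZtoC; ring. }
  split; [|split].
  - apply summable_le with (2 := H4). intro n. rewrite <- Hcol. apply Cmod_Csum_le, H3.
  - apply summable_ext with (1 := Hrow). apply summable_Csum; trivial.
  - unfold zpower at 2. rewrite <- (Csum_ext _ _ Hcol), <- H5. symmetry. apply Csum_ext, Hrow.
Qed.

Lemma geom_bounded_lambert chi d : (forall k, Rabs (IZR (d k)) <= INR k ^ 3) ->
  geom_bounded (lambert chi d).
Proof.
  intros Hd r Hr. destruct (lambert_expansion chi d (RtoC r) Hd) as [H _].
  { rewrite Cmod_R, Rabs_pos_eq; lra. }
  apply ex_series_ext with (2 := H). intro n.
  rewrite Cmod_zterm, Cmod_R, (Rabs_pos_eq r) by lra. trivial.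
Qed.

Definition cube (k : nat) : Z := (Z.of_nat k ^ 3)%Z.
(** The coefficients of P(- s). *)
Definition alt_cube (k : nat) : Z := if Nat.even k then cube k else (- cube k)%Z.

Lemma IZR_cube k : IZR (cube k) = INR k ^ 3.
Proof. unfold cube. rewrite INR_IZR_INZ, pow_IZR. reflexivity. Qed.

Lemma cube_bound k : Rabs (IZR (cube k)) <= INR k ^ 3.
Proof. rewrite IZR_cube, Rabs_pos_eq; [lra|apply pow_le, pos_INR]. Qed.

Lemma alt_cube_bound k : Rabs (IZR (alt_cube k)) <= INR k ^ 3.
Proof.
  unfold alt_cube. destruct (Nat.even k); [|rewrite opp_IZR, Rabs_Ropp]; apply cube_bound.
Qed.

Lemma zpower_cube s : zpower cube s = polylog 3 s.
Proof. apply Csum_ext. intro k. unfold ZtoC. rewrite IZR_cube. trivial. Qed.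

Lemma Cpow_opp (s : C) n : Cpow (Copp s) n = if Nat.even n then Cpow s n else Copp (Cpow s n).
Proof.
  induction n as [|n IH]; [reflexivity|].
  rewrite !Cpow_S, IH, Nat.even_succ, <- Nat.negb_even. destruct (Nat.even n); simpl; ring.
Qed.

Lemma zpower_alt_cube s : zpower alt_cube s = polylog 3 (Copp s).
Proof.
  apply Csum_ext. intro k. unfold alt_cube. rewrite Cpow_opp, <- IZR_cube.
  destruct (Nat.even k); rewrite ?ZtoC_opp; unfold ZtoC; ring.
Qed.

Definition odd_coef : nat -> Z := lambert Nat.odd cube.
Definition full_coef : nat -> Z := lambert (fun _ => true) alt_cube.

Lemma odd_lambert_expansion s : Cmod s < 1 -> odd_lambert s = zpower odd_coef s.
Proof.
  intro Hs. destruct (lambert_expansion Nat.odd cube s cube_bound Hs) as (_ & H1 & H2).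
  unfold odd_coef. rewrite <- H2, Csum_even_odd by trivial.
  rewrite (Csum_ext (fun k => if Nat.odd (S (2 * k + 1)) then _ else _) (fun _ => RtoC 0)).
  - rewrite (Csum_finite (fun _ => RtoC 0) O) by trivial. rewrite sum_O, Cplus_0_r.
    apply Csum_ext. intro k. rewrite zpower_cube.
    replace (S (2 * k)) with (2 * k + 1)%nat by lia. rewrite Nat.odd_add, Nat.odd_mul. reflexivity.
  - intro k. replace (S (2 * k + 1)) with (2 * (k + 1))%nat by lia. rewrite Nat.odd_mul. reflexivity.
Qed.

Lemma full_lambert_expansion s : Cmod s < 1 -> full_lambert s = zpower full_coef s.
Proof.
  intro Hs. destruct (lambert_expansion (fun _ => true) alt_cube s alt_cube_bound Hs) as (_ & H1 & H2).
  unfold full_coef. rewrite <- H2. apply Csum_ext. intro j. rewrite zpower_alt_cube.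
  do 3 f_equal. lia.
Qed.

(** * The expansion of the cusp form *)

Definition alternate (a : nat -> Z) (n : nat) : Z := if Nat.even n then a n else (- a n)%Z.

Lemma zpower_alternate a s : zpower (alternate a) s = zpower a (Copp s).
Proof.
  apply Csum_ext. intro n. unfold alternate. rewrite Cpow_opp.
  destruct (Nat.even n); rewrite ?ZtoC_opp; ring.
Qed.

Lemma geom_bounded_alternate a : geom_bounded a -> geom_bounded (alternate a).
Proof.
  intros Ha r Hr. apply ex_series_ext with (2 := Ha r Hr). intro n. unfold alternate.
  destruct (Nat.even n); rewrite ?opp_IZR, ?Rabs_Ropp; trivial.
Qed.

(** The series a(s) a(- s) is even in s; on coefficients, reversing the order of summation changes
    the sign. *)
Lemma zconv_alternate_odd a n : Nat.even n = false -> zconv a (alternate a) n = 0%Z.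
Proof.
  intro Hn. assert (H : zconv a (alternate a) n = (- zconv a (alternate a) n)%Z); [|lia].
  unfold zconv at 2. rewrite <- zsum_opp, <- zsum_rev. apply zsum_ext. intros i Hi.
  unfold alternate. replace (n - (n - i))%nat with i by lia.
  assert (E : Nat.even (n - i) = negb (Nat.even i)).
  { replace n with (n - i + i)%nat in Hn by lia. rewrite Nat.even_add in Hn.
    destruct (Nat.even (n - i)), (Nat.even i); trivial; discriminate. }
  rewrite E. destruct (Nat.even i); simpl; ring.
Qed.

(** The product - [alpha] [beta] as a series in x = s^2, with only the even powers of s retained. *)
Definition sq_coef (n : nat) : Z := (- zconv odd_coef (alternate odd_coef) (2 * n))%Z.

Lemma geom_bounded_odd_coef : geom_bounded odd_coef.
Proof. apply geom_bounded_lambert, cube_bound. Qed.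

Lemma geom_bounded_sq_coef : geom_bounded sq_coef.
Proof.
  intros r Hr. destruct (sqrt_disc r Hr) as [Ht Htt].
  assert (H := geom_bounded_conv _ _ geom_bounded_odd_coef
     (geom_bounded_alternate _ geom_bounded_odd_coef) _ Ht).
  apply (ex_series_subseq (fun n => 2 * n)%nat) in H.
  - apply ex_series_ext with (2 := H). intro n. unfold sq_coef.
    rewrite opp_IZR, Rabs_Ropp, pow_mult. f_equal. f_equal. simpl. rewrite Rmult_1_r. symmetry; trivial.
  - intros; lia.
  - intro n. apply Rmult_le_pos; [apply Rabs_pos|apply pow_le; lra].
Qed.

Lemma zpower_sq_coef s : Cmod s < 1 ->
  zpower sq_coef (Cpow s 2) = Copp (Cmult (odd_lambert s) (odd_lambert (Copp s))).
Proof.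
  intro Hs. assert (Hs' : Cmod (Copp s) < 1) by (rewrite Cmod_opp; trivial).
  rewrite !odd_lambert_expansion, <- zpower_alternate by trivial.
  assert (Ha := geom_bounded_odd_coef). assert (Hb := geom_bounded_alternate _ Ha).
  rewrite <- zpower_conv by trivial.
  assert (Hsum := summable_zpower _ s (geom_bounded_conv _ _ Ha Hb) Hs).
  unfold zpower at 2. rewrite Csum_even_odd by trivial.
  rewrite (Csum_ext (fun k => Cmult (ZtoC (zconv _ _ (2 * k + 1))) _) (fun _ => RtoC 0)).
  - rewrite (Csum_finite (fun _ => RtoC 0) O) by trivial. rewrite sum_O, Cplus_0_r.
    replace (Copp (Csum _)) with (Cmult (-1) (Csum (fun k =>
      Cmult (ZtoC (zconv odd_coef (alternate odd_coef) (2 * k))) (Cpow s (2 * k)))))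
      by (replace (RtoC (-1)) with (Copp 1) by (rewrite <- RtoC_opp; f_equal); ring).
    rewrite <- Csum_scal by (apply (summable_subseq (fun k => 2 * k)%nat (fun k =>
      Cmult (ZtoC (zconv odd_coef (alternate odd_coef) k)) (Cpow s k))); trivial; intros; lia).
    apply Csum_ext. intro k. unfold sq_coef. rewrite ZtoC_opp, Cpow_mult_r.
    replace (RtoC (-1)) with (Copp 1) by (rewrite <- RtoC_opp; f_equal). ring.
  - intro k. rewrite zconv_alternate_odd.
    + unfold ZtoC. ring.
    + rewrite Nat.even_add, Nat.even_mul. reflexivity.
Qed.

Definition gamma_coef (n : nat) : Z := ((if Nat.eqb n 0 then 1 else 0) + 16 * full_coef n)%Z.

Lemma zpower_gamma_coef_aux q : Cmod q < 1 ->
  summable (fun n => Cmult (ZtoC (gamma_coef n)) (Cpow q n)) /\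
  zpower gamma_coef q = Cplus 1 (Cmult 16 (full_lambert q)).
Proof.
  intro Hq.
  assert (H1 := summable_zpower _ q (geom_bounded_lambert (fun _ => true) _ alt_cube_bound) Hq).
  fold full_coef in H1.
  set (e := fun n => if Nat.eqb n 0 then RtoC 1 else RtoC 0).
  assert (He : summable e).
  { apply (ex_series_finite _ O). intros n Hn. unfold e. destruct n; [lia|]. apply Cmod_0. }
  assert (E : forall n, Cplus (e n) (Cmult 16 (Cmult (ZtoC (full_coef n)) (Cpow q n))) =
     Cmult (ZtoC (gamma_coef n)) (Cpow q n)).
  { intro n. unfold gamma_coef, e. rewrite ZtoC_plus, ZtoC_mult.
    destruct n; unfold ZtoC; simpl; ring. }
  split.
  - apply summable_ext with (1 := E). apply summable_plus; trivial. apply summable_scal; trivial.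
  - unfold zpower. rewrite <- (Csum_ext _ _ E), Csum_plus, Csum_scal by auto using summable_scal.
    rewrite full_lambert_expansion by trivial. f_equal.
    rewrite (Csum_finite e O); [rewrite sum_O; reflexivity|]. intros n Hn. unfold e. destruct n; [lia|trivial].
Qed.

Lemma geom_bounded_gamma_coef : geom_bounded gamma_coef.
Proof.
  intros r Hr. destruct (zpower_gamma_coef_aux (RtoC r)) as [H _].
  { rewrite Cmod_R, Rabs_pos_eq; lra. }
  apply ex_series_ext with (2 := H). intro n.
  rewrite Cmod_zterm, Cmod_R, (Rabs_pos_eq r) by lra. trivial.
Qed.

Definition cusp_coef : nat -> Z := zconv sq_coef gamma_coef.

Lemma geom_bounded_cusp_coef : geom_bounded cusp_coef.
Proof. apply geom_bounded_conv; [apply geom_bounded_sq_coef|apply geom_bounded_gamma_coef]. Qed.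

Lemma cusp_form_expansion z : 0 < Im z ->
  cusp_form z = zpower cusp_coef (Cpow (cexp z) 2).
Proof.
  intro Hz. assert (Hs := Cmod_cexp_lt_1 z Hz). assert (Hs0 := Cmod_ge_0 (cexp z)).
  assert (Hq : Cmod (Cpow (cexp z) 2) < 1) by (rewrite Cmod_pow; simpl; nra).
  unfold cusp_coef. rewrite zpower_conv by auto using geom_bounded_sq_coef, geom_bounded_gamma_coef.
  rewrite zpower_sq_coef by trivial. destruct (zpower_gamma_coef_aux _ Hq) as [_ ->].
  unfold cusp_form, alpha, beta, gamma. ring.
Qed.

(** * Reduction modulo 2 *)

Definition red2 (a : nat -> Z) : ps2 := fun n => Z.odd (a n).

Lemma odd_zsum f n : Z.odd (zsum f n) = xsum (fun i => Z.odd (f i)) (seq 0 n).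
Proof.
  induction n as [|n IH]; [reflexivity|].
  rewrite zsum_S, Z.odd_add, IH, seq_S, xsum_app, xsum_cons. f_equal.
  simpl. unfold xsum; simpl. rewrite xorb_false_r. trivial.
Qed.

Lemma red2_conv a b : red2 (zconv a b) = ps_mul (red2 a) (red2 b).
Proof.
  apply functional_extensionality; intro n. rewrite ps_mul_xsum. unfold red2, zconv.
  rewrite odd_zsum. apply xsum_ext. intros i _. apply Z.odd_mul.
Qed.

Lemma Zodd_of_nat k : Z.odd (Z.of_nat k) = Nat.odd k.
Proof.
  apply eq_true_iff_eq. rewrite Z.odd_spec, Nat.odd_spec. split; intros [m Hm].
  - exists (Z.to_nat m). lia.
  - exists (Z.of_nat m). lia.
Qed.

(** As k^3 has the parity of k, the coefficient counts the factorisations n = (j + 1) k into odd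
    factors. Exchanging the factors is j -> n/(j + 1) - 1, with a fixed point exactly when n is an
    odd square. *)
Lemma red2_odd_coef : red2 odd_coef = Fser.
Proof.
  rewrite Fser_theta. apply functional_extensionality; intro n.
  unfold red2, odd_coef, lambert. rewrite odd_zsum. unfold xsum.
  set (l := filter _ _).
  assert (Hl : NoDup l) by (apply NoDup_filter, seq_NoDup).
  assert (Hin : forall j, In j l <-> exists k, Nat.odd (S j) = true /\ Nat.odd k = true /\ n = (S j * k)%nat).
  { intro j. unfold l. rewrite filter_In, in_seq. unfold lambert_term, cube. split.
    - intros [_ H]. destruct (Nat.odd (S j)); [|discriminate].
      destruct (Nat.eqb_spec (n mod S j) 0) as [E|E]; [|discriminate].
      simpl andb in H. cbv iota in H. exists (n / S j)%nat. split; trivial. split.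
      + rewrite Z.odd_pow, Zodd_of_nat in H by lia. exact H.
      + rewrite (Nat.div_mod_eq n (S j)) at 1. lia.
    - intros (k & H1 & H2 & ->). destruct k; [discriminate|]. split; [nia|].
      rewrite H1, (Nat.mul_comm (S j)), Nat.Div0.mod_mul, Nat.div_mul by lia.
      simpl andb. cbv iota. rewrite Z.odd_pow, Zodd_of_nat by lia. exact H2. }
  set (f := fun j => (n / S j - 1)%nat).
  assert (Hf : forall j k, Nat.odd k = true -> n = (S j * k)%nat -> f j = (k - 1)%nat).
  { intros j k _ ->. unfold f. rewrite Nat.mul_comm, Nat.div_mul; lia. }
  assert (Hstep : forall j, In j l -> In (f j) l /\ f (f j) = j /\
      (f j = j <-> Nat.odd (S j) = true /\ n = (S j * S j)%nat)).
  { intros j Hj. apply Hin in Hj. destruct Hj as (k & H1 & H2 & H3).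
    rewrite (Hf j k) by trivial. destruct k as [|k]; [discriminate|].
    replace (S k - 1)%nat with k by lia. split; [|split].
    - apply Hin. exists (S j). repeat split; trivial. lia.
    - rewrite (Hf k (S j)); trivial; lia.
    - split; [intros ->; auto|]. intros [_ E]. rewrite E in H3.
      apply Nat.mul_cancel_l in H3; lia. }
  destruct (theta Nat.odd 1 n) eqn:E.
  - apply thetaP in E; [|lia]. destruct E as (m & Hm & E). destruct m as [|m]; [discriminate|].
    apply (involution_odd _ f _ m); trivial.
    + apply Hin. exists (S m). repeat split; trivial. lia.
    + intros j Hj. destruct (Hstep j Hj) as (H1 & H2 & H3). repeat split; trivial; rewrite H3.
      * intros [_ E']. rewrite <- E in E'. assert (S m = S j) by (apply (mul_sqr_inj 1); lia). lia.
      * intros ->. split; trivial. lia.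
  - apply (involution_even _ f); trivial. intros j Hj. destruct (Hstep j Hj) as (H1 & H2 & H3).
    repeat split; trivial. rewrite H3. intros [Hm E'].
    assert (Ht : theta Nat.odd 1 n = true) by (apply thetaP; [lia|]; exists (S j); split; [trivial|lia]).
    congruence.
Qed.

(** Modulo 2 the factor [gamma] is 1 and signs disappear, so that [sq_coef] picks the even
    coefficients of the square of F(s); this undoes the dilation by Frobenius. *)
Lemma red2_cusp_coef : red2 cusp_coef = Fser.
Proof.
  unfold cusp_coef. rewrite red2_conv.
  assert (Hg : red2 gamma_coef = ps_one).
  { apply functional_extensionality; intro n. unfold red2, gamma_coef, ps_one.
    rewrite Z.odd_add, Z.odd_mul. destruct (Nat.eqb n 0); reflexivity. }
  assert (Ha : red2 (alternate odd_coef) = red2 odd_coef).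
  { apply functional_extensionality; intro n. unfold red2, alternate.
    destruct (Nat.even n); rewrite ?Z.odd_opp; trivial. }
  assert (Hs : red2 sq_coef = Fser).
  { apply functional_extensionality; intro n. unfold red2, sq_coef. rewrite Z.odd_opp.
    change (red2 (zconv odd_coef (alternate odd_coef)) (2 * n)%nat = Fser n).
    rewrite red2_conv, Ha, ps_sqr, red2_odd_coef. apply dilate_mult. lia. }
  rewrite Hg, Hs, ps_mul_comm. apply ps_mul_1_l.
Qed.

(** * Termwise differentiation of power series *)

Lemma Cpow_taylor (w h : C) (rho : R) n : 0 < rho -> Cmod w + Cmod h <= rho ->
  Cmod (Cminus (Cminus (Cpow (Cplus w h) n) (Cpow w n)) (Cmult h (Cmult (RtoC (INR n)) (Cpow w (pred n)))))
  <= Cmod h ^ 2 / rho ^ 2 * (INR n ^ 2 * rho ^ n).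
Proof.
  intros Hr Hwh. assert (Hw := Cmod_ge_0 w). assert (Hh := Cmod_ge_0 h).
  set (c := Cmod h ^ 2 / rho ^ 2).
  assert (Hc : 0 <= c).
  { apply Rmult_le_pos; [apply pow_le; trivial|]. left. apply Rinv_0_lt_compat, pow_lt; trivial. }
  assert (Hc2 : Cmod h ^ 2 = c * rho ^ 2) by (unfold c; field; lra).
  induction n as [|n IH].
  - simpl. replace (_ - _)%C with (RtoC 0) by (simpl; ring). rewrite Cmod_0. lra.
  (* The remainders satisfy R_(n+1) = (w + h) R_n + n h^2 w^(n-1). *)
  - replace (_ - _)%C with (Cplus
      (Cmult (Cplus w h) (Cminus (Cminus (Cpow (Cplus w h) n) (Cpow w n))
          (Cmult h (Cmult (RtoC (INR n)) (Cpow w (pred n))))))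
      (Cmult (Cpow h 2) (Cmult (RtoC (INR n)) (Cpow w (pred n))))).
    2: { rewrite S_INR, RtoC_plus. destruct n as [|n]; [simpl; ring|].
         change (pred (S (S n))) with (S n). change (pred (S n)) with n. rewrite !Cpow_S. ring. }
    eapply Rle_trans; [apply Cmod_triangle|]. rewrite !Cmod_mult, !Cmod_pow, Cmod_INR.
    assert (Hn := pos_INR n). assert (Hrn := pow_le rho n ltac:(lra)).
    assert (H1 : Cmod (Cplus w h) <= rho) by (eapply Rle_trans; [apply Cmod_triangle|trivial]).
    assert (H2 : INR n * Cmod w ^ pred n * rho <= INR n * rho ^ n).
    { destruct n as [|n]; [simpl; lra|]. change (pred (S n)) with n.
      rewrite Rmult_assoc. apply Rmult_le_compat_l; trivial.
      simpl pow. rewrite Rmult_comm. apply Rmult_le_compat_l; [lra|]. apply pow_incr. lra. }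
    apply Rle_trans with (rho * (c * (INR n ^ 2 * rho ^ n)) + c * rho * (INR n * rho ^ n)).
    + apply Rplus_le_compat.
      * apply Rmult_le_compat; trivial; apply Cmod_ge_0.
      * rewrite Hc2. replace (c * rho ^ 2 * (INR n * Cmod w ^ pred n))
          with (c * rho * (INR n * Cmod w ^ pred n * rho)) by ring.
        apply Rmult_le_compat_l; trivial. apply Rmult_le_pos; lra.
    + rewrite S_INR. simpl (rho ^ S n).
      replace (c * ((INR n + 1) ^ 2 * (rho * rho ^ n)))
        with (rho * (c * (INR n ^ 2 * rho ^ n)) + c * rho * (INR n * rho ^ n)
              + c * rho * ((INR n + 1) * rho ^ n)) by ring.
      assert (0 <= c * rho * ((INR n + 1) * rho ^ n)); [|lra].
      apply Rmult_le_pos; apply Rmult_le_pos; lra.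
Qed.

Lemma ex_series_weighted a p r : geom_bounded a -> 0 <= r < 1 ->
  ex_series (fun n => Rabs (IZR (a n)) * (INR n ^ p * r ^ n)).
Proof.
  intros Ha Hr. destruct (sqrt_disc r Hr) as [Ht Htt]. set (t := sqrt r) in *.
  assert (Hex := ex_series_poly_geom p t Ht).
  assert (H0 : forall n, 0 <= INR n ^ p * t ^ n).
  { intro n. apply Rmult_le_pos; apply pow_le; [apply pos_INR|lra]. }
  set (B := Series (fun n => INR n ^ p * t ^ n)).
  assert (HB : forall n, INR n ^ p * t ^ n <= B).
  { intro n. eapply Rle_trans; [|apply (Series_ge_term _ n); trivial].
    apply (sum_n_ge_last (fun n => INR n ^ p * t ^ n)). trivial. }
  apply ex_series_ge0_le with (fun n => B * (Rabs (IZR (a n)) * t ^ n)).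
  - intro n. assert (Hn := pow_le t n (proj1 Ht)). assert (Han := Rabs_pos (IZR (a n))).
    rewrite Htt, Rpow_mult_distr. split.
    + apply Rmult_le_pos; trivial. apply Rmult_le_pos; [apply pow_le, pos_INR|].
      apply Rmult_le_pos; trivial.
    + replace (Rabs (IZR (a n)) * (INR n ^ p * (t ^ n * t ^ n)))
        with (INR n ^ p * t ^ n * (Rabs (IZR (a n)) * t ^ n)) by ring.
      apply Rmult_le_compat_r; trivial. apply Rmult_le_pos; trivial.
  - apply ex_series_scal_R, Ha, Ht.
Qed.

Lemma ex_derive_zpower a w : geom_bounded a -> Cmod w < 1 ->
  @ex_derive C_AbsRing C_NormedModule (zpower a) w.
Proof.
  intros Ha Hw. assert (Hw0 := Cmod_ge_0 w).
  (* A radius strictly between |w| and 1, leaving room both for the increment h and for the weights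
     n^2 in the remainder. *)
  set (rho := (1 + Cmod w) / 2). assert (Hr : Cmod w < rho < 1) by (unfold rho; lra).
  set (D := fun n => Cmult (ZtoC (a n)) (Cmult (RtoC (INR n)) (Cpow w (pred n)))).
  assert (Hs2 := ex_series_weighted a 2 rho Ha ltac:(lra)).
  assert (HD : summable D).
  { apply summable_le with (fun n => / rho * (Rabs (IZR (a n)) * (INR n ^ 2 * rho ^ n))).
    - intro n. unfold D. rewrite !Cmod_mult, Cmod_ZtoC, Cmod_INR, Cmod_pow.
      destruct n as [|n]; [simpl; rewrite !Rmult_0_l, !Rmult_0_r; lra|].
      change (pred (S n)) with n.
      replace (/ rho * (Rabs (IZR (a (S n))) * (INR (S n) ^ 2 * rho ^ S n)))
        with (Rabs (IZR (a (S n))) * (INR (S n) ^ 2 * rho ^ n)) by (simpl; field; lra).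
      apply Rmult_le_compat_l; [apply Rabs_pos|].
      apply Rmult_le_compat; [apply pos_INR|apply pow_le; trivial| |apply pow_incr; lra].
      assert (H1 : 1 <= INR (S n)) by (rewrite <- INR_1; apply le_INR; lia).
      replace (INR (S n) ^ 2) with (INR (S n) * INR (S n)) by ring. nra.
    - apply ex_series_scal_R, Hs2. }
  exists (Csum D).
  apply is_C_derive_quadratic with (rho - Cmod w)
    (/ rho ^ 2 * Series (fun n => Rabs (IZR (a n)) * (INR n ^ 2 * rho ^ n))); [lra|].
  intros h Hh. assert (Hh0 := Cmod_ge_0 h).
  assert (Hwh : Cmod (Cplus w h) < 1) by (eapply Rle_lt_trans; [apply Cmod_triangle|lra]).
  assert (H1 := summable_zpower a _ Ha Hwh). assert (H2 := summable_zpower a _ Ha Hw).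
  replace (Cminus (Cminus (zpower a (Cplus w h)) (zpower a w)) (Cmult h (Csum D))) with
    (Csum (fun n => Cmult (ZtoC (a n)) (Cminus (Cminus (Cpow (Cplus w h) n) (Cpow w n))
       (Cmult h (Cmult (RtoC (INR n)) (Cpow w (pred n))))))).
  - replace (/ rho ^ 2 * Series (fun n => Rabs (IZR (a n)) * (INR n ^ 2 * rho ^ n)) * (Cmod h * Cmod h))
      with (Cmod h ^ 2 / rho ^ 2 * Series (fun n => Rabs (IZR (a n)) * (INR n ^ 2 * rho ^ n)))
      by (field; lra).
    rewrite <- Series_scal_l. apply Csum_bound.
    + intro n. rewrite Cmod_mult, Cmod_ZtoC.
      replace (Cmod h ^ 2 / rho ^ 2 * (Rabs (IZR (a n)) * (INR n ^ 2 * rho ^ n)))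
        with (Rabs (IZR (a n)) * (Cmod h ^ 2 / rho ^ 2 * (INR n ^ 2 * rho ^ n))) by ring.
      apply Rmult_le_compat_l; [apply Rabs_pos|]. apply Cpow_taylor; lra.
    + apply ex_series_scal_R, Hs2.
  - unfold zpower.
    transitivity (Csum (fun n => Cplus (Cplus (Cmult (ZtoC (a n)) (Cpow (Cplus w h) n))
       (Cmult (-1) (Cmult (ZtoC (a n)) (Cpow w n)))) (Cmult (Copp h) (D n)))).
    + apply Csum_ext. intro n. unfold D.
      replace (RtoC (-1)) with (Copp 1) by (rewrite <- RtoC_opp; f_equal). ring.
    + rewrite !Csum_plus, !Csum_scal by auto using summable_scal, summable_plus.
      replace (RtoC (-1)) with (Copp 1) by (rewrite <- RtoC_opp; f_equal). ring.
Qed.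

(** * The form of level 1 *)

Definition level1_form (z : C) : C := zpower cusp_coef (Cpow (cexp z) 2).

(** The power series gives holomorphy, periodicity and boundedness; the product of Eisenstein series
    gives the behaviour under z -> -1/z. *)
Lemma level1_form_cusp z : 0 < Im z -> level1_form z = cusp_form z.
Proof. intro Hz. symmetry. apply cusp_form_expansion. trivial. Qed.

Lemma Cmod_q_lt_1 z : 0 < Im z -> Cmod (Cpow (cexp z) 2) < 1.
Proof.
  intro Hz. assert (H := Cmod_cexp_lt_1 z Hz). assert (H0 := Cmod_ge_0 (cexp z)).
  rewrite Cmod_pow. simpl. nra.
Qed.

Lemma is_derive_q z : @is_derive C_AbsRing C_NormedModule (fun z => Cpow (cexp z) 2) z
  (Cmult (Cmult (Cmult 2 (RtoC PI)) Ci) (Cpow (cexp z) 2)).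
Proof.
  destruct cexp_taylor as (K & HK & H).
  apply is_C_derive_quadratic with (1 / 2) (Cmod (Cpow (cexp z) 2) * (4 * K)); [lra|].
  intros h Hh.
  assert (E2 : forall v, Cpow (cexp v) 2 = cexp (Cmult 2 v)).
  { intro v. change (RtoC 2) with (RtoC (INR 2)). rewrite cexp_nat_mult. trivial. }
  rewrite !E2. rewrite Cmult_plus_distr_l, cexp_plus.
  replace (Cminus _ _) with (Cmult (cexp (Cmult 2 z)) (Cminus (Cminus (cexp (Cmult 2 h)) 1)
     (Cmult (Cmult (RtoC PI) Ci) (Cmult 2 h)))) by ring.
  rewrite Cmod_mult, Rmult_assoc. apply Rmult_le_compat_l; [apply Cmod_ge_0|].
  assert (E : Cmod (Cmult 2 h) = 2 * Cmod h) by (rewrite Cmod_mult, Cmod_R, Rabs_pos_eq; lra).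
  eapply Rle_trans; [apply H; lra|]. rewrite E. right. ring.
Qed.

Lemma ex_derive_C_comp (f g : C -> C) z :
  @ex_derive C_AbsRing C_NormedModule f (g z) -> @ex_derive C_AbsRing C_NormedModule g z ->
  @ex_derive C_AbsRing C_NormedModule (fun z => f (g z)) z.
Proof.
  intros Hf [l Hl]. apply (@ex_derive_comp C_AbsRing C_NormedModule f g z Hf).
  exists l. split; [apply is_linear_scal_l|exact (proj2 Hl)].
Qed.

Lemma ex_derive_level1 z : 0 < Im z -> @ex_derive C_AbsRing C_NormedModule level1_form z.
Proof.
  intro Hz. apply (ex_derive_C_comp (zpower cusp_coef) (fun z => Cpow (cexp z) 2)).
  - apply ex_derive_zpower; [apply geom_bounded_cusp_coef|apply Cmod_q_lt_1; trivial].
  - eexists. apply is_derive_q.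
Qed.

Lemma level1_plus_nat n z : level1_form (Cplus z (RtoC (INR n))) = level1_form z.
Proof.
  revert z. induction n as [|n IH]; intro z.
  - simpl INR. rewrite Cplus_0_r. trivial.
  - rewrite S_INR, RtoC_plus, Cplus_assoc. unfold level1_form at 1. rewrite cexp_plus_1.
    replace (Cpow (Copp (cexp (Cplus z (RtoC (INR n))))) 2)
      with (Cpow (cexp (Cplus z (RtoC (INR n)))) 2) by ring. apply IH.
Qed.

Lemma level1_plus_Z k z : level1_form (Cplus z (ZtoC k)) = level1_form z.
Proof.
  destruct (Z_le_gt_dec 0 k) as [Hk|Hk].
  - replace (ZtoC k) with (RtoC (INR (Z.to_nat k))).
    + apply level1_plus_nat.
    + unfold ZtoC. rewrite INR_IZR_INZ, Z2Nat.id by trivial. trivial.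
  - rewrite <- (level1_plus_nat (Z.to_nat (- k)) (Cplus z (ZtoC k))). f_equal.
    unfold ZtoC. rewrite INR_IZR_INZ, Z2Nat.id, opp_IZR, RtoC_opp by lia. ring.
Qed.

Lemma level1_neg_inv z : 0 < Im z ->
  level1_form (Copp (Cinv z)) = Cmult (Cpow z 12) (level1_form z).
Proof.
  intro Hz. rewrite !level1_form_cusp by auto using Im_neg_inv. apply cusp_form_neg_inv. trivial.
Qed.

Lemma Im_ZtoC_lin z (c d : Z) : Im (Cplus (Cmult (ZtoC c) z) (ZtoC d)) = IZR c * Im z.
Proof. apply Im_lin. Qed.

Lemma denom_neq_0 z (c d : Z) : 0 < Im z -> (c <> 0 \/ d <> 0)%Z ->
  Cplus (Cmult (ZtoC c) z) (ZtoC d) <> 0.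
Proof.
  intros Hz Hcd E. destruct (Z.eq_dec c 0) as [->|Hc].
  - destruct Hcd as [Hcd|Hd]; [lia|]. apply Hd. unfold ZtoC in E.
    rewrite Cmult_0_l, Cplus_0_l in E. apply RtoC_inj in E. apply eq_IZR. trivial.
  - apply (f_equal Im) in E. rewrite Im_ZtoC_lin in E. change (Im 0) with 0 in E.
    apply Rmult_integral in E. destruct E as [E|E]; [|lra]. apply Hc, eq_IZR. trivial.
Qed.

Lemma ZtoC_minus a b : ZtoC (a - b) = Cminus (ZtoC a) (ZtoC b).
Proof. unfold ZtoC. rewrite minus_IZR. apply RtoC_minus. Qed.

(** Euclid's algorithm on the bottom row, that is, generation of SL_2(Z) by translations and z ->
    -1/z. With w = - 1/(z + k) and k the quotient of d by c, the given transformation of z is that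
    of w by the matrix with rows (b - a k, - a) and (d - c k, - c), whose lower left entry is
    smaller than c in absolute value. *)
Lemma level1_modular (a b c d : Z) z : (a * d - b * c = 1)%Z -> 0 < Im z ->
  level1_form (mobius a b c d z) = Cmult (autfac c d 12 z) (level1_form z).
Proof.
  remember (Z.abs_nat c) as n eqn:Hn. revert a b c d z Hn.
  induction n as [n IH] using lt_wf_ind. intros a b c d z Hn Hdet Hz.
  unfold mobius, autfac.
  destruct (Z.eq_dec c 0) as [->|Hc].
  - assert (Had : (a = 1 /\ d = 1 \/ a = -1 /\ d = -1)%Z).
    { rewrite Z.mul_0_r, Z.sub_0_r in Hdet. destruct (Z.eq_mul_1 a d Hdet); nia. }
    destruct Had as [[-> ->]|[-> ->]].
    + rewrite <- (level1_plus_Z b z). unfold ZtoC.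
      replace (Cdiv _ _) with (Cplus z (RtoC (IZR b))) by field.
      replace (Cpow _ 12) with (RtoC 1) by ring. ring.
    + rewrite <- (level1_plus_Z (- b) z). rewrite ZtoC_opp. unfold ZtoC.
      replace (RtoC (-1)) with (Copp 1) by (rewrite <- RtoC_opp; f_equal).
      replace (Cdiv _ _) with (Cplus z (Copp (RtoC (IZR b)))).
      2: { field. }
      replace (Cpow _ 12) with (RtoC 1) by ring. ring.
  - set (k := (d / c)%Z). set (r := (d - c * k)%Z). set (b' := (b - a * k)%Z).
    assert (Hr : (Z.abs r < Z.abs c)%Z).
    { unfold r, k. assert (E := Z.div_mod d c Hc).
      destruct (Z_lt_le_dec 0 c).
      - assert (Hb := Z.mod_pos_bound d c ltac:(lia)). lia.
      - assert (Hb := Z.mod_neg_bound d c ltac:(lia)). lia. }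
    assert (Hzk : 0 < Im (Cplus z (ZtoC k))) by (destruct z; unfold Im in *; simpl in *; lra).
    assert (Hzk0 : Cplus z (ZtoC k) <> 0) by (apply Im_neq_0; lra).
    set (w := Copp (Cinv (Cplus z (ZtoC k)))).
    assert (Hw : 0 < Im w) by (apply Im_neg_inv; trivial).
    assert (Hdet' : (b' * - c - - a * r = 1)%Z) by (unfold b', r; lia).
    assert (H1 := IH (Z.abs_nat r) ltac:(lia) b' (- a)%Z r (- c)%Z w eq_refl Hdet' Hw).
    unfold mobius, autfac in H1.
    assert (Hden := denom_neq_0 z c d Hz ltac:(lia)).
    assert (Hden' := denom_neq_0 w r (- c) Hw ltac:(lia)).
    assert (Ed : Cmult (Cplus (Cmult (ZtoC r) w) (ZtoC (- c))) (Cplus z (ZtoC k)) =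
      Copp (Cplus (Cmult (ZtoC c) z) (ZtoC d))).
    { unfold w, r. rewrite ZtoC_opp, ZtoC_minus, ZtoC_mult. field. trivial. }
    assert (En : Cmult (Cplus (Cmult (ZtoC b') w) (ZtoC (- a))) (Cplus z (ZtoC k)) =
      Copp (Cplus (Cmult (ZtoC a) z) (ZtoC b))).
    { unfold w, b'. rewrite ZtoC_opp, ZtoC_minus, ZtoC_mult. field. trivial. }
    replace (Cdiv (Cplus (Cmult (ZtoC a) z) (ZtoC b)) (Cplus (Cmult (ZtoC c) z) (ZtoC d)))
      with (Cdiv (Cplus (Cmult (ZtoC b') w) (ZtoC (- a))) (Cplus (Cmult (ZtoC r) w) (ZtoC (- c)))).
    + rewrite H1. unfold w at 2. rewrite level1_neg_inv, level1_plus_Z by trivial.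
      rewrite Cmult_assoc, <- Cpow_mult_l, Ed. f_equal. ring.
    + set (nu' := Cplus (Cmult (ZtoC b') w) (ZtoC (- a))) in *.
      set (de' := Cplus (Cmult (ZtoC r) w) (ZtoC (- c))) in *.
      set (nu := Cplus (Cmult (ZtoC a) z) (ZtoC b)) in *.
      set (de := Cplus (Cmult (ZtoC c) z) (ZtoC d)) in *.
      set (t := Cplus z (ZtoC k)) in *.
      replace nu with (Copp (Cmult nu' t)) by (rewrite En; ring).
      replace de with (Copp (Cmult de' t)) by (rewrite Ed; ring).
      field. split; trivial.
Qed.

(** The threshold 1/5 is dictated by level 5, where the expansion at the cusp 0 involves (z + t)/5
    with Im z > 1. *)
Lemma level1_bounded : exists B, 0 <= B /\ forall z, 1 / 5 <= Im z -> Cmod (level1_form z) <= B.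
Proof.
  set (r := exp (- PI * (1 / 5))). assert (Hp := PI_RGT_0).
  assert (Hr : 0 <= r < 1).
  { split; [left; apply exp_pos|]. rewrite <- exp_0. apply exp_increasing. lra. }
  assert (Hex := geom_bounded_cusp_coef r Hr).
  exists (Series (fun n => Rabs (IZR (cusp_coef n)) * r ^ n)). split.
  { apply Series_nonneg; trivial. intro n. apply Rmult_le_pos; [apply Rabs_pos|apply pow_le; lra]. }
  intros z Hz. apply Csum_bound; trivial. intro n. rewrite Cmod_zterm.
  apply Rmult_le_compat_l; [apply Rabs_pos|]. apply pow_incr. split; [apply Cmod_ge_0|].
  rewrite Cmod_pow. assert (H0 := Cmod_ge_0 (cexp z)).
  assert (H1 := Cmod_cexp_lt_1 z ltac:(lra)).
  apply Rle_trans with (Cmod (cexp z)); [simpl; nra|].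
  rewrite Cmod_cexp. unfold r. destruct Hz as [Hz|Hz].
  - left. apply exp_increasing. nra.
  - rewrite <- Hz. lra.
Qed.

Lemma autfac_neq_0 a b c d z : (a * d - b * c = 1)%Z -> 0 < Im z -> autfac c d 12 z <> 0.
Proof. intros Hdet Hz. apply Cpow_nz, denom_neq_0; trivial. nia. Qed.

Lemma level1_form_modular_form : modular_form_G0_5 12 level1_form.
Proof.
  split; [exact ex_derive_level1|split].
  - intros a b c d z [Hdet _] Hz. apply level1_modular; trivial.
  - intros a b c d Hdet. destruct level1_bounded as (B & HB & H). exists B, 1. intros z Hz Hz1.
    rewrite level1_modular by trivial. assert (Hne := autfac_neq_0 a b c d z Hdet Hz).
    replace (Cdiv _ _) with (level1_form z) by (field; trivial). apply H. lra.
Qed.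

(** * The form of level 5 *)

Definition level5_form (z : C) : C := level1_form (Cmult 5 z).

(** Conjugation by the diagonal matrix (5, 1), which maps Gamma_0(5) into SL_2(Z). *)
Lemma mobius_times_5 (a b c d c' : Z) z : (c = 5 * c')%Z ->
  Cmult 5 (mobius a b c d z) = mobius a (5 * b) c' d (Cmult 5 z) /\
  autfac c d 12 z = autfac c' d 12 (Cmult 5 z).
Proof.
  intros ->. unfold mobius, autfac. rewrite !ZtoC_mult. change (ZtoC 5) with (RtoC 5). split.
  - unfold Cdiv. rewrite Cmult_assoc. f_equal; [ring|]. f_equal. ring.
  - f_equal. ring.
Qed.

Lemma level5_Gamma0 (a b c d : Z) z : (a * d - b * c = 1)%Z -> (5 | c)%Z -> 0 < Im z ->
  level5_form (mobius a b c d z) = Cmult (autfac c d 12 z) (level5_form z).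
Proof.
  intros Hdet [c' Hc'] Hz. destruct (mobius_times_5 a b c d c' z ltac:(lia)) as [E1 E2].
  unfold level5_form. rewrite E1, E2. apply level1_modular; [lia|]. rewrite Im_scal. lra.
Qed.

(** Take t to be d times an inverse of c modulo 5. This provides the factorisation used at the cusp
    0. *)
Lemma inverse_mod_5 (c d : Z) : ~ (5 | c)%Z -> exists t v, (d = c * t + 5 * v)%Z.
Proof.
  intro Hc. assert (Hc5 : (c mod 5 <> 0)%Z) by (intro E; apply Hc, Z.mod_divide; lia).
  assert (H : exists u, (c * u mod 5 = 1)%Z).
  { assert (Hb := Z.mod_pos_bound c 5 ltac:(lia)).
    assert (Hm : forall u, (c * u mod 5 = (c mod 5) * u mod 5)%Z).
    { intro u. symmetry. apply Z.mul_mod_idemp_l. lia. }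
    assert (Hcase : (c mod 5 = 1 \/ c mod 5 = 2 \/ c mod 5 = 3 \/ c mod 5 = 4)%Z) by lia.
    destruct Hcase as [E|[E|[E|E]]];
      [exists 1%Z|exists 3%Z|exists 2%Z|exists 4%Z]; rewrite Hm, E; reflexivity. }
  destruct H as [u Hu]. exists (u * d)%Z, (- (c * u / 5) * d)%Z.
  assert (E := Z.div_mod (c * u) 5 ltac:(lia)). rewrite Hu in E.
  replace (c * (u * d))%Z with (c * u * d)%Z by ring. rewrite E at 1. ring.
Qed.

(** The matrix with rows (5 a, 5 b) and (c, d) is the product of the one with rows (5 a, b - a t)
    and (c, v), of determinant 1, and the one with rows (1, t) and (0, 5). As c w + v = (c z + d)/5,
    the automorphy factor acquires 5^(-12). *)
Lemma level5_other_cusp (a b c d t v : Z) z : (a * d - b * c = 1)%Z -> (d = c * t + 5 * v)%Z -> 0 < Im z ->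
  level5_form (mobius a b c d z) =
  Cmult (Cmult (autfac c d 12 z) (/ 5 ^ 12)%C) (level1_form (Cdiv (Cplus z (ZtoC t)) 5)).
Proof.
  intros Hdet Hd Hz. set (w := Cdiv (Cplus z (ZtoC t)) 5).
  assert (Ew : Cmult 5 w = Cplus z (ZtoC t)) by (unfold w; field).
  assert (Hw : 0 < Im w).
  { assert (H : 5 * Im w = Im z).
    { rewrite <- Im_scal, Ew. destruct z; unfold Im; simpl. ring. }
    lra. }
  assert (Hdet' : (5 * a * v - (b - a * t) * c = 1)%Z) by (rewrite <- Hdet, Hd; ring).
  assert (Hden := denom_neq_0 z c d Hz ltac:(nia)).
  assert (Hden' := denom_neq_0 w c v Hw ltac:(nia)).
  assert (Ed : Cmult 5 (Cplus (Cmult (ZtoC c) w) (ZtoC v)) = Cplus (Cmult (ZtoC c) z) (ZtoC d)).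
  { transitivity (Cplus (Cmult (ZtoC c) (Cmult 5 w)) (Cmult 5 (ZtoC v))); [ring|].
    rewrite Ew, Hd, ZtoC_plus, !ZtoC_mult. change (ZtoC 5) with (RtoC 5). ring. }
  assert (E : Cmult 5 (mobius a b c d z) = mobius (5 * a) (b - a * t) c v w).
  { unfold mobius. rewrite <- Ed.
    replace (Cplus (Cmult (ZtoC (5 * a)) w) (ZtoC (b - a * t))) with (Cplus (Cmult (ZtoC a) z) (ZtoC b)).
    - field. trivial.
    - rewrite ZtoC_minus, !ZtoC_mult. change (ZtoC 5) with (RtoC 5).
      replace z with (Cminus (Cmult 5 w) (ZtoC t)) by (rewrite Ew; ring). ring. }
  unfold level5_form. rewrite E, level1_modular by trivial. f_equal.
  unfold autfac. rewrite <- Ed. field.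
Qed.

Lemma level5_form_modular_form : modular_form_G0_5 12 level5_form.
Proof.
  split; [|split].
  - intros z Hz. apply (ex_derive_C_comp level1_form (fun z => Cmult 5 z)).
    + apply ex_derive_level1. rewrite Im_scal. lra.
    + exists (RtoC 5). apply is_C_derive_quadratic with 1 0; [lra|]. intros h _.
      replace (Cminus _ _) with (RtoC 0) by ring. rewrite Cmod_0. lra.
  - intros a b c d z [Hdet Hc] Hz. apply level5_Gamma0; trivial.
  - intros a b c d Hdet. destruct level1_bounded as (B & HB & H). exists B, 1. intros z Hz Hz1.
    assert (Hne := autfac_neq_0 a b c d z Hdet Hz).
    (* The two classes of cusps of Gamma_0(5): that of infinity when 5 divides c, and that of 0
       otherwise. *)
    destruct (Znumtheory.Zdivide_dec 5 c) as [Hc|Hc].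
    + rewrite level5_Gamma0 by trivial.
      replace (Cdiv _ _) with (level5_form z) by (field; trivial).
      apply H. rewrite Im_scal. lra.
    + destruct (inverse_mod_5 c d Hc) as (t & v & Hd).
      rewrite (level5_other_cusp a b c d t v) by trivial.
      set (w := Cdiv (Cplus z (ZtoC t)) 5).
      assert (Hw : 1 / 5 <= Im w).
      { assert (E : 5 * Im w = Im z).
        { rewrite <- Im_scal. replace (Cmult 5 w) with (Cplus z (ZtoC t)) by (unfold w; field).
          destruct z; unfold Im; simpl. ring. }
        lra. }
      replace (Cdiv _ _) with (Cmult (RtoC (/ 5 ^ 12)) (level1_form w)).
      2: { rewrite RtoC_inv, RtoC_pow by (apply pow_nonzero; lra). field. trivial. }
      rewrite Cmod_mult, Cmod_R, Rabs_pos_eq by (left; apply Rinv_0_lt_compat, pow_lt; lra).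
      specialize (H w Hw). assert (H0 := Cmod_ge_0 (level1_form w)).
      assert (H5 : / 5 ^ 12 <= 1).
      { rewrite <- Rinv_1. apply Rinv_le_contravar; [lra|]. apply pow_R1_Rle. lra. }
      assert (0 < / 5 ^ 12) by (apply Rinv_0_lt_compat, pow_lt; lra). nra.
Qed.

(** * Integral expansions at infinity *)

Lemma qpow_cexp n z : qpow n z = Cpow (Cpow (cexp z) 2) n.
Proof.
  rewrite <- Cpow_mult_r, <- cexp_nat_mult. unfold qpow, cexp.
  rewrite Im_scal, mult_INR.
  replace (Re (Cmult (RtoC (INR 2 * INR n)) z)) with (INR 2 * INR n * Re z)
    by (destruct z; unfold Re; simpl; ring).
  simpl (INR 2). f_equal; f_equal; f_equal; ring.
Qed.

Lemma M_Fser : M 12 Fser.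
Proof.
  exists level1_form. split; [apply level1_form_modular_form|].
  exists cusp_coef. split.
  - intros z Hz. assert (Hs := summable_zpower _ _ geom_bounded_cusp_coef (Cmod_q_lt_1 z Hz)).
    apply is_series_ext with (fun n => Cmult (ZtoC (cusp_coef n)) (Cpow (Cpow (cexp z) 2) n)).
    + intro n. rewrite qpow_cexp. reflexivity.
    + apply is_Cseries_Csum. trivial.
  - intro n. rewrite <- red2_cusp_coef. reflexivity.
Qed.

(** The expansion of [level5_form] is a series in x^5; reindexing along k -> 5 k turns it into a
    series over all exponents with zeros off the multiples of 5. *)
Lemma M_Gser : M 12 Gser.
Proof.
  exists level5_form. split; [apply level5_form_modular_form|].
  exists (fun n => if Nat.eqb (n mod 5) 0 then cusp_coef (n / 5) else 0%Z). split.
  - intros z Hz.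
    assert (Hz5 : 0 < Im (Cmult 5 z)) by (rewrite Im_scal; lra).
    assert (Hs := summable_zpower _ _ geom_bounded_cusp_coef (Cmod_q_lt_1 _ Hz5)).
    set (u := fun n => Cmult (ZtoC (if Nat.eqb (n mod 5) 0 then cusp_coef (n / 5) else 0%Z)) (qpow n z)).
    assert (Hu : forall k, Cmult (ZtoC (cusp_coef k)) (Cpow (Cpow (cexp (Cmult 5 z)) 2) k) = u (5 * k)%nat).
    { intro k. unfold u. rewrite Nat.mul_comm, Nat.Div0.mod_mul, Nat.div_mul by lia.
      rewrite qpow_cexp, <- !Cpow_mult_r. cbn [Nat.eqb]. f_equal.
      replace (RtoC 5) with (RtoC (INR 5)) by (f_equal; simpl; ring).
      rewrite cexp_nat_mult, <- Cpow_mult_r. f_equal. lia. }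
    destruct (Csum_reindex (fun k => 5 * k)%nat u) as [H1 H2].
    + intros; lia.
    + intros n Hn. unfold u. destruct (Nat.eqb_spec (n mod 5) 0) as [E|E].
      * exfalso. apply (Hn (n / 5)%nat). lia.
      * unfold ZtoC. ring.
    + apply summable_ext with (1 := Hu). trivial.
    + unfold level5_form, level1_form, zpower. rewrite (Csum_ext _ _ Hu), H2.
      apply is_Cseries_Csum. trivial.
  - intro n. rewrite Gser_dilate, <- red2_cusp_coef. unfold dilate.
    destruct (Nat.eqb (n mod 5) 0); reflexivity.
Qed.

Theorem theorem1p12 :
  (M 12 Fser /\ M 12 Gser) /\
  (Gser = ps_mul (ps_pow rser 5) (ps_add rser ps_one) /\
   Fser = ps_mul rser (ps_pow (ps_add rser ps_one) 5) /\
   ps_pow (ps_add Fser Gser) 6 = ps_mul Fser Gser).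
Proof.
  split; [exact (conj M_Fser M_Gser)|].
  exact (conj Gser_factor (conj Fser_factor FG_sextic)).
Qed.
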